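(* Let $K$ be a field with algebraic closure $\overline K$, let $n,s$ be integers with $0<s<n$, let $d_1\ge\cdots\ge d_s\ge 1$ be integers with $d_1\ge 2$, and put $\delta=d_1\cdots d_s$. There exists a nonzero multihomogeneous polynomial $P_{\mathrm{stci}}\in K[\mathrm{coeffs}(\mathbf F)]$, of degree at most $\delta/d_i$ in the set of variables $\mathrm{coeffs}(F_i)$ for each $1\le i\le s$, with the following property: for every $\mathbf f\in\mathbb P^{\mathbf D}_{\overline K}$ with $P_{\mathrm{stci}}(\mathbf f)\neq 0$, the variety $Z(\mathbf f)\subset\mathbb P^n_{\overline K}$ has dimension $n-s$. In particular $Z(\mathbf f)$ is a set-theoretic complete intersection and $\mathbf f=(f_1,\dots,f_s)$ is a regular sequence.
   Context: Put $D_i=\binom{d_i+n}{n}-1$ and $\mathbb P^{\mathbf D}_{\overline K}=\mathbb P^{D_1}_{\overline K}\times\cdots\times\mathbb P^{D_s}_{\overline K}$. The homogeneous coordinates of the $i$th factor are indexed by the multi-indices $\alpha\in\mathbb N^{n+1}$ with $|\alpha|=d_i$, and a point $\mathbf f=(\lambda_1,\dots,\lambda_s)$ is identified with the $s$-tuple of homogeneous polynomials $f_i=\sum_{|\alpha|=d_i}\lambda_{i,\alpha}X^\alpha\in\overline K[X_0,\dots,X_n]$. For each $i$, $\mathrm{coeffs}(F_i)=\{F_{i,\alpha}:|\alpha|=d_i\}$ is a set of indeterminates (the coefficients of the generic polynomial $F_i=\sum_{|\alpha|=d_i}F_{i,\alpha}X^\alpha$), and $\mathrm{coeffs}(\mathbf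 F)=\bigcup_i\mathrm{coeffs}(F_i)$. A polynomial in $K[\mathrm{coeffs}(\mathbf F)]$ is multihomogeneous if it is homogeneous in each set $\mathrm{coeffs}(F_i)$; for such $P$, whether $P(\mathbf f)=0$ is well defined. $Z(\mathbf f)$ denotes the set of common zeros of $f_1,\dots,f_s$ in $\mathbb P^n_{\overline K}$. $Z(\mathbf f)$ is a set-theoretic complete intersection if it is of pure dimension $n-s$. A sequence $(f_1,\dots,f_s)$ is regular if $f_1\neq0$ and each $f_i$ is neither zero nor a zero divisor in $\overline K[X_0,\dots,X_n]/(f_1,\dots,f_{i-1})$. *)

(* Defs.v *)
From HB Require Import structures.
From mathcomp Require Import all_boot all_order all_algebra.
From mathcomp Require Import mpoly.

Set Implicit Arguments.
Unset Strict Implicit.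
Unset Printing Implicit Defensive.

Import GRing.Theory.
Local Open Scope ring_scope.

(* Indices are 0-based: F_i for i : 'I_s.                              *)

Definition monos (n e : nat) : finType :=
  {m : 'X_{1..n.+1 < e.+1} | mdeg m == e}.

Definition coeff_idx (n s : nat) (d : 'I_s -> nat) : finType :=
  {i : 'I_s & monos n (d i)}.

(* number of coefficient variables; K[coeffs(F)] = {mpoly K[ncoeffs n d]} *)
Definition ncoeffs (n s : nat) (d : 'I_s -> nat) : nat := #|{: coeff_idx n d}|.

Definition var_block (n s : nat) (d : 'I_s -> nat) (j : 'I_(ncoeffs n d)) : 'I_s :=
  tag (enum_val j).

Definition multihomog (R : ringType) (n s : nat) (d : 'I_s -> nat)
    (P : {mpoly R[ncoeffs n d]}) (e : 'I_s -> nat) : Prop :=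
  forall m, m \in msupp P ->
    forall i : 'I_s, (\sum_(j < ncoeffs n d | var_block j == i) m j)%N = e i.

(* a point f = (lambda_1,...,lambda_s) of P^D over L, given by its coordinates *)
Definition is_multiproj_point (L : ringType) (n s : nat) (d : 'I_s -> nat)
    (lam : coeff_idx n d -> L) : Prop :=
  forall i : 'I_s, exists a : monos n (d i), lam (Tagged (fun i => monos n (d i)) a) != 0.

Definition gen_poly (L : ringType) (n s : nat) (d : 'I_s -> nat)
    (lam : coeff_idx n d -> L) (i : 'I_s) : {mpoly L[n.+1]} :=
  \sum_(a : monos n (d i)) lam (Tagged (fun i => monos n (d i)) a) *: 'X_[val (val a)].

Definition eval_coeffs (K L : ringType) (iota : {rmorphism K -> L})
    (n s : nat) (d : 'I_s -> nat) (P : {mpoly K[ncoeffs n d]})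
    (lam : coeff_idx n d -> L) : L :=
  (map_mpoly iota P).@[fun j => lam (enum_val j)].

(* Projective geometry in P^n_L.  A point of P^n is represented by a   *)
(* nonzero vector of homogeneous coordinates; subsets of P^n are        *)
(* represented by the (scaling invariant) sets of such representatives. *)

Definition coords (L : Type) (n : nat) := 'I_n.+1 -> L.
Definition pset (L : Type) (n : nat) := coords L n -> Prop.

Definition psubset (L : Type) (n : nat) (A B : pset L n) : Prop :=
  forall x, A x -> B x.

Definition pstrict (L : Type) (n : nat) (A B : pset L n) : Prop :=
  psubset A B /\ exists x, B x /\ ~ A x.

Definition proj_zeros (L : ringType) (n : nat) (G : {mpoly L[n.+1]} -> Prop) : pset L n :=
  fun x => (exists j, x j != 0) /\ forall g, G g -> g.@[x] = 0.

Definition Zf (L : ringType) (n s : nat) (f : 'I_s -> {mpoly L[n.+1]}) : pset L n :=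
  proj_zeros (fun g => exists i, g = f i).

Definition proj_closed (L : ringType) (n : nat) (S : pset L n) : Prop :=
  exists G : {mpoly L[n.+1]} -> Prop,
    (forall g, G g -> exists k, g \is k.-homog) /\
    forall x, S x <-> proj_zeros G x.

Definition proj_irreducible (L : ringType) (n : nat) (S : pset L n) : Prop :=
  [/\ proj_closed S, exists x, S x &
      forall A B : pset L n, proj_closed A -> proj_closed B ->
        (forall x, S x -> A x \/ B x) -> psubset S A \/ psubset S B].

Definition irr_chain (L : ringType) (n : nat) (Z : pset L n) (k : nat)
    (C : nat -> pset L n) : Prop :=
  (forall j, (j <= k)%N -> proj_irreducible (C j) /\ psubset (C j) Z) /\
  (forall j, (j < k)%N -> pstrict (C j) (C j.+1)).

Definition proj_dim_is (L : ringType) (n : nat) (Z : pset L n) (k : nat) : Prop :=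
  (exists C, irr_chain Z k C) /\ ~ (exists C, irr_chain Z k.+1 C).

Definition irr_component (L : ringType) (n : nat) (Z C : pset L n) : Prop :=
  [/\ proj_irreducible C, psubset C Z &
      forall C', proj_irreducible C' -> psubset C' Z -> psubset C C' -> psubset C' C].

Definition pure_dim (L : ringType) (n : nat) (Z : pset L n) (k : nat) : Prop :=
  forall C, irr_component Z C -> proj_dim_is C k.

Definition stci (L : ringType) (n s : nat) (f : 'I_s -> {mpoly L[n.+1]}) : Prop :=
  pure_dim (Zf f) (n - s).

Definition in_ideal_lt (L : comRingType) (n s : nat) (f : 'I_s -> {mpoly L[n.+1]})
    (i : nat) (g : {mpoly L[n.+1]}) : Prop :=
  exists h : 'I_s -> {mpoly L[n.+1]}, g = \sum_(j < s | (j < i)%N) h j * f j.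

Definition regular_seq (L : comRingType) (n s : nat) (f : 'I_s -> {mpoly L[n.+1]}) : Prop :=
  (forall i0 : 'I_s, val i0 = 0%N -> f i0 != 0) /\
  forall i : 'I_s,
    ~ in_ideal_lt f i (f i) /\
    forall g, in_ideal_lt f i (g * f i) -> in_ideal_lt f i g.

Definition is_alg_closure (K : fieldType) (L : closedFieldType)
    (iota : {rmorphism K -> L}) : Prop :=
  forall x : L, exists p : {poly K}, p != 0 /\ root (map_poly iota p) x.

(* Main.v *)
Require Import Defs.
From HB Require Import structures.
From mathcomp Require Import all_boot all_order all_algebra perm.
From mathcomp Require Import mpoly.
From mathcomp Require Import zify ring.
From mathcomp Require boolp classical_sets.

Set Implicit Arguments.
Unset Strict Implicit.
Unset Printing Implicit Defensive.

Import GRing.Theory.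
Local Open Scope ring_scope.

(* [P_stci] is the resultant of [F_1, ..., F_s, X_s, ..., X_n].  The polynomials in the
   coefficients that vanish at every system with a common zero [x <> 0], [x_s = ... = x_n = 0],
   form a prime ideal.  It contains no nonzero polynomial free of the coefficient of
   [X_0^(d_0)] in [F_0], because generic [F_i], [i <> 0], have a common zero with [x_0 = 1].  As
   polynomial rings are factorial, an element [R] of least degree in the ideal is irreducible
   and divides all the others.  For each [i] the ideal contains a determinant of Macaulay of
   degree [delta / d_i] in the coefficients of [F_i], whence the degrees of [R].

   If [R(f) <> 0] then [X_j^M] lies in [(f_1, ..., f_s, X_s, ..., X_n)] for all [j].  Such a
   system of [n + 1] forms is a regular sequence in any order: deform it into powers of the
   variables, one form at a time, comparing dimensions of graded pieces at each step.  Hence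
   [S / (f)] is finite and torsion-free over [T = L[X_s, ..., X_n]].  Torsion-freeness makes
   every component of [Z(f)] dominate the projective space of [T], going up and lying over
   produce chains of length [n - s] below it, and counting monomials bounds all chains. *)

(** The bound [delta / d_i] is wanted for all [i] at once, whereas a determinant of Macaulay has the
    right degree only in the block of the form with lowest priority, and in general too large a
    degree in the others. Hence the detour through a common divisor [R] of these determinants: a
    divisor of a polynomial homogeneous in a block is homogeneous there, of no larger degree. The
    coefficient of [X_0^(d_0)] serves to prove divisibility: if [R] did not divide a member [D] of
    the ideal, eliminating that coefficient between [R] and [D] would produce a nonzero member free
    of it.

    The forms [X_s, ..., X_n] cut out a linear space of dimension [s - 1]; that it misses [Z(f)]
    bounds the dimension of [Z(f)] by [n - s]. Regularity in any order yields the torsion-freeness: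
    a nonzero form of [T] may be placed right after [f_1, ..., f_s], whichever linear forms complete
    the system. *)

Lemma ex_least (P : nat -> Prop) :
  (exists n, P n) -> exists n, P n /\ forall m, P m -> (n <= m)%N.
Proof.
case=> n Pn; have [|k Pk kmin] := @ex_minnP (fun n => boolp.asbool (P n)).
  by exists n; apply/boolp.asboolP.
by exists k; split=> [|m Pm]; [apply/boolp.asboolP | apply/kmin/boolp.asboolP].
Qed.

(** * Factorization in polynomial rings *)

Section Divisibility.
Variable A : idomainType.
Implicit Types a b c : A.

Definition divides a b := exists c, b = c * a.

Definition irred a :=
  [/\ a != 0, a \isn't a GRing.unit
    & forall b c, a = b * c -> b \is a GRing.unit \/ c \is a GRing.unit].

Definition irred_prime := forall a b c,
  irred a -> divides a (b * c) -> divides a b \/ divides a c.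

(* Such a [nu] makes [A] atomic. *)
Definition unit_degree (nu : A -> nat) :=
  (forall a b, a != 0 -> b != 0 -> nu (a * b) = (nu a + nu b)%N) /\
  (forall a, a != 0 -> (nu a == 0%N) = (a \is a GRing.unit)).

Lemma divides_mull a b c : divides a b -> divides a (c * b).
Proof. by case=> d ->; exists (c * d); rewrite mulrA. Qed.

Lemma dividesD a b c : divides a b -> divides a c -> divides a (b + c).
Proof. by move=> [x ->] [y ->]; exists (x + y); rewrite mulrDl. Qed.

Lemma dividesB a b c : divides a b -> divides a c -> divides a (b - c).
Proof. by move=> [x ->] [y ->]; exists (x - y); rewrite mulrBl. Qed.

Lemma divides0 a : divides a 0.
Proof. by exists 0; rewrite mul0r. Qed.

Lemma divides_sum a I (r : seq I) (P : pred I) (F : I -> A) :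
  (forall i, P i -> divides a (F i)) -> divides a (\sum_(i <- r | P i) F i).
Proof.
by move=> aF; apply: (@big_ind _ (divides a)) => //; [apply: divides0 | apply: dividesD].
Qed.

Lemma irred_factor nu a : unit_degree nu -> a != 0 -> a \isn't a GRing.unit ->
  exists b c, a = b * c /\ irred b.
Proof.
move=> [nuM nu0]; have [n] := ubnP (nu a).
elim: n a => // n IHn a; rewrite ltnS => le_an a0 aU.
case: (boolp.EM (irred a)) => [ia|nia]; first by exists a, 1; rewrite mulr1.
have [[b c] /= [a_bc bU cU]] : exists bc : A * A, [/\ a = bc.1 * bc.2,
    bc.1 \isn't a GRing.unit & bc.2 \isn't a GRing.unit].
  apply: boolp.contrapT => nex; apply: nia; split=> // b c a_bc.
  case: (boolP (b \is a GRing.unit)) => [|bU]; first by left.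
  case: (boolP (c \is a GRing.unit)) => [|cU]; first by right.
  by case: nex; exists (b, c).
have [b0 c0] : b != 0 /\ c != 0.
  by apply/andP; rewrite -negb_or -mulf_eq0 -a_bc.
have [|b1 [b2 [b_12 ib1]]] := IHn b _ b0 bU; last first.
  by exists b1, (b2 * c); rewrite mulrA -b_12.
apply: leq_trans le_an; rewrite a_bc nuM // -addn1 leq_add2l lt0n.
by rewrite nu0.
Qed.

End Divisibility.

Section PolyIrreducible.
Variables (A : idomainType) (nu : A -> nat).
Hypotheses (nuP : unit_degree nu) (primeA : irred_prime A).
Implicit Types (a b c : A) (f g h q R : {poly A}).

Lemma divides_polyC a f : divides a%:P f <-> forall i, divides a f`_i.
Proof.
split=> [[q ->] i|af]; first by exists q`_i; rewrite coefMC.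
have [c cP] := boolp.choice af.
exists (\poly_(i < size f) c i); apply/polyP => i.
rewrite coefMC coef_poly; case: ltnP => [_|/(nth_default 0) ->]; first exact: cP.
by rewrite mul0r.
Qed.

(** Gauss's lemma. Let [i] and [j] be the first indices of coefficients of [f] and [g] not divisible
    by [a]: modulo [a], the coefficient [i + j] of [f * g] is the product of these two. *)
Lemma irred_polyC_prime a f g :
  irred a -> divides a%:P (f * g) -> divides a%:P f \/ divides a%:P g.
Proof.
move=> ia afg; apply: boolp.contrapT => /boolp.not_orP[].
move=> /divides_polyC/boolp.existsNP/ex_least[i [naf imin]].
move=> /divides_polyC/boolp.existsNP/ex_least[j [nag jmin]].
have : divides a (f`_i * g`_j); last by case/(primeA ia).
have /divides_polyC/(_ (i + j)%N) := afg; rewrite coefM.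
have ltij : (i < (i + j).+1)%N by rewrite ltnS leq_addr.
rewrite (bigD1 (Ordinal ltij)) //= addKn => a_sum.
rewrite -[f`_i * _](addrK (\sum_(k < (i + j).+1 | k != Ordinal ltij) f`_k * g`_(i + j - k))).
apply: dividesB a_sum _; apply: divides_sum => k ki.
case: (ltngtP k i) => [lt_ki|lt_ik|k_eq].
- rewrite mulrC; apply: divides_mull; apply: boolp.contrapT => /imin.
  by rewrite leqNgt lt_ki.
- apply: divides_mull; apply: boolp.contrapT => /jmin.
  by have := ltn_ord k; lia.
- by case/negP: ki; apply/eqP/val_inj.
Qed.

(** The irreducible factors of [c] are prime in [{poly A}] by Gauss's lemma, so they can be
    distributed one at a time between [q] and [h]. *)
Lemma polyC_mul_eq c f q h : c != 0 -> c%:P * f = q * h ->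
  exists c1 c2 q1 h1, [/\ c = c1 * c2, q = c1%:P * q1, h = c2%:P * h1 & f = q1 * h1].
Proof.
have [n] := ubnP (nu c); elim: n c q h => // n IHn c q h; rewrite ltnS => le_cn c0 cf.
case: (boolP (c \is a GRing.unit)) => cU.
  exists c, 1, (c^-1%:P * q), h; split; rewrite ?mulr1 ?mul1r //.
    by rewrite mulrA -polyCM divrr ?mul1r.
  by rewrite -mulrA -cf mulrA -polyCM mulVr ?mul1r.
have [p [c' [c_pc ip]]] := irred_factor nuP c0 cU.
have [p0 c'0] : p != 0 /\ c' != 0 by apply/andP; rewrite -negb_or -mulf_eq0 -c_pc.
have lt_c'n : (nu c' < n)%N.
  apply: leq_trans le_cn; rewrite c_pc nuP.1 // -[X in (X < _)%N]add0n ltn_add2r lt0n.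
  by rewrite nuP.2 //; case: ip.
have pP0 : p%:P != 0 by rewrite polyC_eq0.
have : divides p%:P (q * h).
  by exists (c'%:P * f); rewrite -cf c_pc polyCM -mulrA mulrC.
case/(irred_polyC_prime ip) => [[q' q_eq]|[h' h_eq]].
- have [|c1 [c2 [q1 [h1 [c'_eq q'_eq h'_eq f_eq]]]]] := IHn c' q' h lt_c'n c'0.
    by apply: (mulfI pP0); rewrite mulrA -polyCM -c_pc cf q_eq; ring.
  exists (p * c1), c2, q1, h1; split=> //; first by rewrite c_pc c'_eq mulrA.
  by rewrite q_eq q'_eq polyCM; ring.
- have [|c1 [c2 [q1 [h1 [c'_eq q'_eq h'_eq f_eq]]]]] := IHn c' q h' lt_c'n c'0.
    by apply: (mulfI pP0); rewrite mulrA -polyCM -c_pc cf h_eq; ring.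
  exists c1, (p * c2), q1, h1; split=> //; first by rewrite c_pc c'_eq mulrCA.
  by rewrite h_eq h'_eq polyCM; ring.
Qed.

Lemma irred_size_primitive R c f : irred R -> (1 < size R)%N -> R = c%:P * f ->
  c \is a GRing.unit.
Proof.
move=> [_ _ Rirr] sR R_cf; have c0 : c != 0.
  by apply: contraTneq sR => c0; rewrite R_cf c0 mul0r size_poly0.
case: (Rirr _ _ R_cf); rewrite poly_unitE => /andP[/eqP sz1 U].
  by move: U; rewrite coefC.
by move: sR; rewrite R_cf size_Cmul // sz1.
Qed.

(* [h] of least size in the ideal [(R, f)]: pseudo-division makes multiples of [R] and
   [f] by nonzero constants divisible by [h]. *)
Lemma irred_bezout R f : irred R -> (1 < size R)%N -> ~ divides R f ->
  exists k u v, k != 0 /\ k%:P = u * R + v * f.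
Proof.
move=> iR sR nRf; have [R0 RU Rirr] := iR.
have [|m [[h [h0 [[u [v h_uv]] sh]]] hmin]] := @ex_least (fun m => exists h,
    h != 0 /\ (exists u v, h = u * R + v * f) /\ size h = m).
  by exists (size R), R; split=> //; split=> //; exists 1, 0; rewrite mul1r mul0r addr0.
have red p : (exists u v, p = u * R + v * f) -> exists c q, c != 0 /\ c%:P * p = q * h.
  case=> u1 [v1 p_uv]; exists (lead_coef h ^+ scalp p h), (p %/ h).
  rewrite expf_neq0 ?lead_coef_eq0 //; split=> //.
  rewrite mul_polyC Pdiv.Idomain.divp_eq; have [->|r0] := eqVneq (p %% h) 0; first by rewrite addr0.
  have := Pdiv.Idomain.ltn_modp p h; rewrite h0 ltnNge sh hmin //.
  exists (p %% h); split=> //; split=> //.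
  exists (lead_coef h ^+ scalp p h *: u1 - p %/ h * u), (lead_coef h ^+ scalp p h *: v1 - p %/ h * v).
  apply: (addrI (p %/ h * h)); rewrite -Pdiv.Idomain.divp_eq p_uv -!mul_polyC.
  set q := _ %/ h; set c := _%:P; have -> : q * h = q * (u * R + v * f) by rewrite -h_uv.
  ring.
have [|c [q [c0 cR]]] := red R; first by exists 1, 0; rewrite mul1r mul0r addr0.
have [|c' [q' [c'0 cf]]] := red f; first by exists 0, 1; rewrite mul1r mul0r add0r.
have [c1 [c2 [q1 [h1 [_ _ h_c2 R_qh]]]]] := polyC_mul_eq c0 cR.
case: (Rirr _ _ R_qh) => [q1U|h1U]; last first.
  have := h1U; rewrite poly_unitE => /andP[/size_poly1P[k k0 h1k] _].
  exists (c2 * k), u, v; rewrite -h_uv h_c2 h1k polyCM; split=> //.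
  by move: h0; rewrite h_c2 h1k -polyCM polyC_eq0.
have {}cf : c'%:P * f = (q' * c2%:P * q1^-1) * R.
  by rewrite cf h_c2 R_qh !mulrA divrK.
have [c3 [c4 [q3 [h3 [_ _ R_c4 f_qh]]]]] := polyC_mul_eq c'0 cf.
case: nRf; exists (q3 * c4^-1%:P); rewrite {1}f_qh R_c4 -!mulrA; congr (_ * _).
by rewrite mulrA -polyCM mulVr ?mul1r // (irred_size_primitive iR sR R_c4).
Qed.

(** For [R] of positive degree not dividing [f], multiply the identity [k = u R + v f] by [g]: then
    [R] divides [k * g], and the constant [k] cancels because [R] is primitive. *)
Lemma irred_prime_poly : irred_prime {poly A}.
Proof.
move=> R f g iR [w fg_wR]; have [R0 RU Rirr] := iR.
have [sR|sR] := leqP (size R) 1.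
  move: R0 RU Rirr fg_wR; rewrite [R]size1_polyC //; move: R`_0 => a.
  rewrite polyC_eq0 => a0 aU Rirr fg_wR; apply: irred_polyC_prime; last by exists w.
  split=> //; first by apply: contra aU => aU; rewrite poly_unitE size_polyC a0 coefC.
  move=> b c bc; have [] := Rirr b%:P c%:P; first by rewrite -polyCM -bc.
    by rewrite poly_unitE coefC => /andP[_]; left.
  by rewrite poly_unitE coefC => /andP[_]; right.
apply: boolp.contrapT => /boolp.not_orP[nRf nRg].
have [k [u [v [k0 k_uv]]]] := irred_bezout iR sR nRf.
have kg : k%:P * g = (u * g + v * w) * R.
  by rewrite k_uv [RHS]mulrDl -[v * w * R]mulrA -fg_wR; ring.
have [c1 [c2 [q1 [h1 [_ _ R_c2 g_qh]]]]] := polyC_mul_eq k0 kg.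
case: nRg; exists (q1 * c2^-1%:P); rewrite {1}g_qh R_c2 -!mulrA; congr (_ * _).
by rewrite mulrA -polyCM mulVr ?mul1r // (irred_size_primitive iR sR R_c2).
Qed.

End PolyIrreducible.

Lemma rmorph_inj_eq0 (A B : idomainType) (phi : {rmorphism A -> B}) :
  bijective phi -> forall a, (phi a == 0) = (a == 0).
Proof. by move=> /bij_inj phi_inj a; rewrite -(inj_eq phi_inj) rmorph0. Qed.

Lemma irred_morph (A B : idomainType) (phi : {rmorphism A -> B}) :
  bijective phi -> forall a, irred a <-> irred (phi a).
Proof.
move=> [psi phiK psiK] a.
have phi_inj : injective phi by apply: can_inj phiK.
have phi_eq0 := rmorph_inj_eq0 (Bijective phiK psiK).
have psi1 : psi 1 = 1 by apply: phi_inj; rewrite psiK rmorph1.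
have psiM : {morph psi : x y / x * y}.
  by move=> x y; apply: phi_inj; rewrite rmorphM !psiK.
have phiU x : (phi x \is a GRing.unit) = (x \is a GRing.unit).
  apply/idP/idP => [|/(rmorph_unit phi) //] /divrr phix.
  apply/unitrPr; exists (psi (phi x)^-1).
  by apply: phi_inj; rewrite rmorphM psiK phix rmorph1.
split=> -[a0 aU airr]; split.
- by rewrite phi_eq0.
- by rewrite phiU.
- move=> b c a_bc; rewrite -[b]psiK -[c]psiK !phiU; apply: airr.
  by rewrite -psiM -a_bc phiK.
- by rewrite -phi_eq0.
- by rewrite -phiU.
- by move=> b c a_bc; rewrite -!phiU; apply: airr; rewrite a_bc rmorphM.
Qed.

Lemma divides_morph (A B : idomainType) (phi : {rmorphism A -> B}) :
  bijective phi -> forall a b, divides a b <-> divides (phi a) (phi b).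
Proof.
move=> [psi phiK psiK] a b; split=> -[c b_ca].
  by exists (phi c); rewrite b_ca rmorphM.
by exists (psi c); apply: (can_inj phiK); rewrite rmorphM psiK.
Qed.

(** * Factoriality and elimination in several variables *)

Section MultivariateIrreducible.
Variable K : fieldType.

Lemma mpoly_unit_degree k : unit_degree (fun p : {mpoly K[k]} => (msize p).-1).
Proof.
split=> [p q p0 q0|p p0].
  by rewrite msizeM // (mpolySpred mdeg p0) (mpolySpred mdeg q0) /= addnS.
rewrite (_ : _ == 0%N = (msize p == 1%N)); last first.
  by rewrite (mpolySpred mdeg p0).
apply/msize_poly1P/idP => [[c c0 ->]|]; first by rewrite rmorph_unit // unitfE.
move=> /andP[/eqP p_eq pU]; exists p@_0%MM => //.
by rewrite -unitfE.
Qed.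

Let max_widen k (i : 'I_k) : (ord_max == widen_ord (leqnSn k) i) = false.
Proof. by rewrite -val_eqE /= gtn_eqF. Qed.

Lemma widen_split k (m : 'X_{1..k.+1}) :
  m = (mnmwiden [multinom m (widen_ord (leqnSn k) i) | i < k] + U_(ord_max) *+ m ord_max)%MM.
Proof.
apply/mnmP => l; rewrite mnmDE mulmnE mnm1E; case: (unliftP ord_max l) => [l' ->|->].
  rewrite (_ : lift ord_max l' = widen_ord (leqnSn k) l').
    by rewrite mnmwiden_widen mnmE max_widen addn0.
  by apply: val_inj; rewrite /= /bump leqNgt ltn_ord.
by rewrite mnmwiden_ordmax eqxx mul1n.
Qed.

Lemma coef_muni k (p : {mpoly K[k.+1]}) i m :
  (muni p)`_i@_m = p@_(mnmwiden m + U_(ord_max) *+ i).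
Proof.
rewrite muniE coef_sum raddf_sum [RHS](congr1 _ (mpolyE p)) raddf_sum /=.
apply: eq_bigr => m' _.
rewrite coefZ coefXn mulr_natr mcoeffMn !mcoeffZ !mcoeffX -mulrnAr -mulrnA mulnb.
congr (_ * (nat_of_bool _)%:R); apply/idP/idP => [/andP[/eqP<- /eqP->]|/eqP eq_m].
  by rewrite -widen_split.
apply/andP; split; last by have /mnmP/(_ ord_max) := eq_m; rewrite !mnmDE !mnmwiden_ordmax !mulmnE !mnm1E eqxx !mul1n !add0n => ->.
apply/eqP/mnmP => l; rewrite mnmE; have /mnmP/(_ (widen_ord (leqnSn k) l)) := eq_m.
by rewrite !mnmDE !mnmwiden_widen !mulmnE !mnm1E max_widen !addn0.
Qed.

Lemma muni_bij k : bijective (@muni k K).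
Proof.
have muniX m : muni 'X_[K, m] =
    'X_[[multinom m (widen_ord (leqnSn k) i) | i < k]] *: 'X^(m ord_max).
  by rewrite muniE msuppX big_seq1 mcoeffX eqxx scale1r.
have muni_widen q : muni (mwiden q) = q%:P :> {poly {mpoly K[k]}}.
  rewrite {1}(mpolyE q) [in RHS](mpolyE q) (raddf_sum (@mwiden k K)) (raddf_sum (@muni k K)) (raddf_sum polyC) /=. apply: eq_bigr => m _.
  rewrite mwidenZ mwidenX muniZ muniX mnmwiden_ordmax expr0.
  rewrite scalerA mul_mpolyC alg_polyC; congr (_ *: 'X_[_])%:P.
  by apply/mnmP => i; rewrite mnmE mnmwiden_widen.
have muniK : cancel (@mmulti k K) (@muni k K).
  move=> q; rewrite /mmulti raddf_sum /= -[RHS]coefK poly_def; apply: eq_bigr => i _.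
  rewrite muniM rmorphXn /= muni_widen muniX mnm1E eqxx -[RHS]mul_polyC.
  rewrite (_ : [multinom _ | _ < _] = 0%MM) ?mpolyX0 ?scale1r //.
  by apply/mnmP => l; rewrite mnmE mnm1E mnm0E max_widen.
exists (@mmulti k K) => // p.
apply/mpolyP => m; rewrite (widen_split m).
by rewrite -!coef_muni muniK.
Qed.

Lemma irred_prime_mpoly k : irred_prime {mpoly K[k]}.
Proof.
elim: k => [|k IHk].
  move=> a b c [a0 /negP[]]; rewrite (nvar0_mpolyC a) rmorph_unit // unitfE.
  by apply: contra a0 => /eqP a0; rewrite (nvar0_mpolyC a) a0 mpolyC0.
move=> a b c ia /(divides_morph (muni_bij k)); rewrite rmorphM.
have ia' := (irred_morph (muni_bij k) a).1 ia.
case/(irred_prime_poly (mpoly_unit_degree k) IHk ia').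
  by move=> /(divides_morph (muni_bij k)); left.
by move=> /(divides_morph (muni_bij k)); right.
Qed.

Definition free_of k (j : 'I_k) (p : {mpoly K[k]}) :=
  forall m, m \in msupp p -> m j = 0%N.

(** This is [irred_bezout] in the last variable, over the polynomials in the others; as [R] is not
    free of that variable, it has positive degree in it. *)
Lemma irred_elim_max k (R f : {mpoly K[k.+1]}) :
  irred R -> ~ free_of ord_max R -> ~ divides R f ->
  exists c u v, [/\ c != 0, free_of ord_max c & c = u * R + v * f].
Proof.
move=> iR nfR nRf.
have sR : (1 < size (muni R))%N.
  rewrite ltnNge; apply/negP => sR; case: nfR => m; apply: contraTeq => m0.
  rewrite -mcoeff_eq0 (widen_split m) -coef_muni nth_default ?mcoeff0 //.
  by apply: leq_trans sR _; rewrite lt0n.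
have iR' := (irred_morph (muni_bij k) R).1 iR.
have nRf' : ~ divides (muni R) (muni f) by rewrite -(divides_morph (muni_bij k)).
have [c [u [v [c0 c_uv]]]] := irred_bezout (mpoly_unit_degree k) (@irred_prime_mpoly k) iR' sR nRf'.
have [psi muniK psiK] := muni_bij k.
exists (psi c%:P), (psi u), (psi v); split.
- by rewrite -(rmorph_inj_eq0 (muni_bij k)) /= psiK polyC_eq0.
- move=> m; apply: contraTeq => m0; rewrite -mcoeff_eq0 (widen_split m) -coef_muni psiK coefC.
  by rewrite (negPf m0) mcoeff0.
- by apply: (can_inj muniK); rewrite muniD !muniM !psiK.
Qed.

Lemma irred_elim k (j : 'I_k) (R f : {mpoly K[k]}) :
  irred R -> ~ free_of j R -> ~ divides R f ->
  exists c u v, [/\ c != 0, free_of j c & c = u * R + v * f].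
Proof.
case: k j R f => [[]//|k] j R f iR nfR nRf.
pose sg := tperm j ord_max; have sgK : cancel (msym sg : {mpoly K[k.+1]} -> _) (msym sg).
  by move=> p; rewrite -msymMm tperm2 msym1m.
have sgB : bijective (msym sg : {mpoly K[k.+1]} -> _) by exists (msym sg).
have free_sg p : free_of ord_max (msym sg p) <-> free_of j p.
  pose mp (m : 'X_{1..k.+1}) := [multinom m (sg i) | i < k.+1].
  have mpj m : mp m j = m ord_max by rewrite mnmE tpermL.
  have mpk m : mp m ord_max = m j by rewrite mnmE tpermR.
  have mpK m : mp (mp m) = m by apply/mnmP => i; rewrite !mnmE tpermK.
  split=> fp m; rewrite mcoeff_msupp => pm.
    by rewrite -mpk; apply: fp; rewrite mcoeff_msupp mcoeff_sym -/(mp (mp m)) mpK.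
  by rewrite -mpj; apply: fp; rewrite mcoeff_msupp; rewrite mcoeff_sym in pm.
have [|||c [u [v [c0 fc c_uv]]]] := @irred_elim_max k (msym sg R) (msym sg f).
- by rewrite -(irred_morph sgB).
- by rewrite free_sg.
- by rewrite -(divides_morph sgB).
exists (msym sg c), (msym sg u), (msym sg v); split.
- by rewrite (rmorph_inj_eq0 sgB).
- by rewrite -free_sg sgK.
- by rewrite c_uv msymD !msymM !sgK.
Qed.

End MultivariateIrreducible.

Lemma mmap_muni (K : fieldType) (R : comNzRingType) (f : {rmorphism K -> R}) k
    (p : {mpoly K[k.+1]}) (w : 'I_k.+1 -> R) :
  mmap f w p = (map_poly (mmap f (fun i => w (widen_ord (leqnSn k) i))) (muni p)).[w ord_max].
Proof.
rewrite muniE rmorph_sum horner_sum; apply: eq_bigr => m _ /=.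
rewrite map_polyZ map_polyXn hornerZ hornerXn /= mmapZ mmapX.
rewrite /mmap1 big_ord_recr /= mulrA; congr (_ * _ * _); apply: eq_bigr => i _.
by rewrite mnmE.
Qed.

Lemma mpoly_nonroot (L : closedFieldType) k (p : {mpoly L[k]}) : p != 0 -> exists v, p.@[v] != 0.
Proof.
elim: k p => [|k IHk] p p0.
  exists (fun=> 0); rewrite (nvar0_mpolyC p) mevalC; apply: contra p0 => /eqP p0.
  by rewrite (nvar0_mpolyC p) p0 mpolyC0.
have [i pi0] : exists i, (muni p)`_i != 0.
  exists (size (muni p)).-1; rewrite -lead_coefE lead_coef_eq0.
  by rewrite (rmorph_inj_eq0 (muni_bij L k)).
have [v vP] := IHk _ pi0; have /closed_nonrootP[c] : map_poly (meval v) (muni p) != 0.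
  by apply: contraNneq vP => p_eq0; rewrite -(coef_map (meval v)) /= p_eq0 coef0.
rewrite rootE => pc.
exists (fun i : 'I_k.+1 => if unlift ord_max i is Some j then v j else c).
rewrite /meval mmap_muni unlift_none -/(meval _); apply: contra pc => /eqP<-.
apply/eqP; congr (_.[_]); apply: eq_map_poly => q; apply: meval_eq => j.
by rewrite (_ : widen_ord _ j = lift ord_max j) ?liftK //; apply: val_inj; rewrite /= /bump leqNgt ltn_ord.
Qed.

Lemma mmap_scale_homog (R : nzRingType) (S : comNzRingType) (f : {rmorphism R -> S}) N k
    (u : 'I_N -> S) r (p : {mpoly R[N]}) : p \is k.-homog ->
  mmap f (fun i => r * u i) p = r ^+ k * mmap f u p.
Proof.
move=> hp; rewrite /mmap big_distrr /= !big_seq; apply: eq_bigr => m /(dhomog_mf hp) /= <-.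
rewrite mulrCA /mmap1; congr (_ * _); under eq_bigr do rewrite exprMn.
by rewrite big_split /= prodrXr mdegE.
Qed.

(** * Prime and graded ideals *)

Section Ideals.
Variable R : comNzRingType.
Implicit Types (a b x y : R) (J Q U : R -> Prop).

Definition ideal J :=
  [/\ J 0, forall a b, J a -> J b -> J (a + b) & forall a b, J b -> J (a * b)].

Definition prime_ideal Q :=
  [/\ ideal Q, ~ Q 1 & forall a b, Q (a * b) -> Q a \/ Q b].

Lemma idealN J a : ideal J -> J a -> J (- a).
Proof. by move=> [_ _ JM] /(JM (-1)); rewrite mulN1r. Qed.

Lemma idealB J a b : ideal J -> J a -> J b -> J (a - b).
Proof. by move=> iJ Ja Jb; have [_ JD _] := iJ; apply: JD Ja (idealN iJ Jb). Qed.

Lemma idealMr J a b : ideal J -> J a -> J (a * b).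
Proof. by move=> [_ _ JM] Ja; rewrite mulrC; apply: JM. Qed.

Lemma ideal_sum J I (r : seq I) (P : pred I) (F : I -> R) : ideal J ->
  (forall i, P i -> J (F i)) -> J (\sum_(i <- r | P i) F i).
Proof. by move=> [J0 JD _] JF; apply: big_ind. Qed.

Lemma prime_idealX Q a k : prime_ideal Q -> Q (a ^+ k) -> Q a.
Proof.
move=> [_ Q1 QM]; elim: k => [|k IHk]; first by rewrite expr0 => /Q1.
by rewrite exprS => /QM[|/IHk].
Qed.

(** An ideal maximal among those that contain [J] and miss the multiplicative set [U] is prime. *)
Lemma prime_avoidance J U : ideal J -> U 1 ->
  (forall a b, U a -> U b -> U (a * b)) -> (forall a, J a -> ~ U a) ->
  exists Q, [/\ prime_ideal Q, forall a, J a -> Q a & forall a, Q a -> ~ U a].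
Proof.
move=> iJ U1 UM JU; have [J0 JD JM] := iJ.
(* Adjoining [J] to every set lets the empty chain, whose union is empty, satisfy the condition [P]
   of Zorn's lemma. *)
pose E X a := X a \/ J a.
pose P X := ideal (E X) /\ forall a, E X a -> ~ U a.
have [F FP totF|A [PA Amax]] := @classical_sets.Zorn_bigcup R P.
  have chain a : E (classical_sets.bigcup F id) a <->
      J a \/ exists2 X, F X & E X a.
    split=> [[Fa|Ja]|[Ja|[X FX [Xa|Ja]]]]; try by [left|right].
      have [X FX Xa] : exists2 X, F X & X a := Fa.
      by right; exists X => //; left.
    by left; exists X.
  split=> [|a /chain[/JU //|[X /FP[_ XU] /XU] //]].
  split=> [|a b /chain Ea /chain Eb|a b /chain Eb]; apply/chain; first by left.
    case: Ea Eb => [Ja|[X FX Xa]] [Jb|[Y FY Yb]]; first by left; apply: JD.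
    - by right; exists Y => //; have [[_ YD _] _] := FP _ FY; apply: YD => //; right.
    - by right; exists X => //; have [[_ XD _] _] := FP _ FX; apply: XD => //; right.
    - right; case: (totF _ _ FX FY) => XY.
        exists Y => //; have [[_ YD _] _] := FP _ FY; apply: YD => //.
        by case: Xa => [/XY|]; [left|right].
      exists X => //; have [[_ XD _] _] := FP _ FX; apply: XD => //.
      by case: Yb => [/XY|]; [left|right].
  case: Eb => [Jb|[Y FY Yb]]; first by left; apply: JM.
  by right; exists Y => //; have [[_ _ YM] _] := FP _ FY; apply: YM.
have [iQ QU] : ideal (E A) /\ forall a, E A a -> ~ U a := PA.
have [Q0 QD QM] := iQ.
have meet x : ~ E A x -> exists q y, E A q /\ U (q + y * x).
  move=> Ax; pose B b := exists q y, E A q /\ b = q + y * x.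
  have EB b : E B b <-> B b.
    by split=> [[//|Jb]|]; [exists b, 0; rewrite mul0r addr0; split=> //; right | left].
  have AB : classical_sets.proper A B.
    split=> [a Aa|BA]; first by exists a, 0; rewrite mul0r addr0; split=> //; left.
    by apply: Ax; left; apply: BA; exists 0, 1; rewrite mul1r add0r.
  apply: boolp.contrapT => nex; apply: (Amax _ AB); split=> [|b /EB[q [y [Qq ->]]] Uqy]; last first.
    by apply: nex; exists q, y.
  split=> [|b c /EB[q [y [Qq ->]]] /EB[r [z [Qr ->]]]|b c /EB[q [y [Qq ->]]]]; apply/EB.
  - by exists 0, 0; rewrite mul0r addr0.
  - by exists (q + r), (y + z); rewrite mulrDl addrACA; split=> //; apply: QD.
  - by exists (b * q), (b * y); rewrite mulrDr mulrA; split=> //; apply: QM.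
exists (E A); split=> //; last by move=> a Ja; right.
split=> // [Q1|a b Qab]; first exact: QU Q1 U1.
apply: boolp.contrapT => /boolp.not_orP[/meet[q [y [Qq Uq]]] /meet[r [z [Qr Ur]]]].
apply: QU (UM _ _ Uq Ur); rewrite mulrDl; apply: (QD); first exact: idealMr.
rewrite mulrDr; apply: QD; first exact: (QM).
by rewrite mulrACA; apply: (QM).
Qed.

End Ideals.

(** * Homogeneous components and graded ideals *)

Notation hc := (pihomog (@mdeg _)).

Section Graded.
Variables (L : fieldType) (N : nat).
Implicit Types (p q a b : {mpoly L[N]}) (J Q : {mpoly L[N]} -> Prop).

Lemma mcoeff_hc k p m : (hc k p)@_m = if mdeg m == k then p@_m else 0.
Proof.
rewrite pihomogE raddf_sum /= [in RHS](mpolyE p) raddf_sum big_mkcond /=.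
case: eqVneq => [mk|mk]; last first.
  apply: big1 => m' _; case: eqP => // m'k; rewrite mcoeffZ mcoeffX.
  by case: eqP => [m'_eq|_]; [rewrite -m'_eq m'k eqxx in mk | rewrite mulr0].
apply: eq_bigr => m' _; case: eqP => // m'k; rewrite mcoeffZ mcoeffX.
by case: eqP => [m'_eq|_]; [rewrite m'_eq mk in m'k | rewrite mulr0].
Qed.

Lemma hcM k e p q : q \is e.-homog ->
  hc k (p * q) = if (e <= k)%N then hc (k - e) p * q else 0.
Proof.
move=> hq; rewrite {1}(pihomog_partitionE (mf := mdeg) (leq_maxl (msize p) k.+1)).
rewrite mulr_suml linear_sum /=.
have hpq i : hc i p * q \is (i + e).-homog by apply: dhomogM => //; apply: pihomogP.
case: leqP => [le_ek|lt_ke]; last first.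
  by apply: big1 => i _; apply: pihomog_ne0 (hpq i); lia.
have ltk : (k - e < maxn (msize p) k.+1)%N by lia.
rewrite (bigD1 (Ordinal ltk)) //= big1 ?addr0 => [|i ik].
  by apply: pihomog_dE; rewrite -[X in X.-homog](subnK le_ek).
apply: pihomog_ne0 (hpq i); apply: contra ik => /eqP ie; apply/eqP/val_inj => /=; lia.
Qed.

Lemma homog_hc k p : p \is k.-homog -> hc k p = p.
Proof. exact: pihomog_dE. Qed.

Lemma homog_hc0 k l p : p \is k.-homog -> k != l -> hc l p = 0.
Proof. by move=> hp kl; apply: pihomog_ne0 hp. Qed.

Definition graded J := ideal J /\ forall k p, J p -> J (hc k p).

(** For an ideal [Q], this is the largest graded ideal inside it. *)
Definition graded_core Q p := forall k, Q (hc k p).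

(** Primality is asked of forms only; in this shape the graded core inherits it at once from a prime
    ideal. *)
Definition hprime Q := [/\ graded Q, ~ Q 1
  & forall k l a b, a \is k.-homog -> b \is l.-homog -> Q (a * b) -> Q a \/ Q b].

Lemma graded_core_sub Q p : ideal Q -> graded_core Q p -> Q p.
Proof.
move=> iQ Qp; rewrite (pihomog_partitionE (mf := mdeg) (leqnn (msize p))).
by apply: ideal_sum => // i _; apply: Qp.
Qed.

Lemma graded_core_homog Q k p : ideal Q -> p \is k.-homog -> Q p -> graded_core Q p.
Proof.
move=> [Q0 _ _] hp Qp l; have [<-|kl] := eqVneq k l; first by rewrite homog_hc.
by rewrite (homog_hc0 hp kl).
Qed.

Lemma graded_coreP Q : ideal Q -> graded (graded_core Q).
Proof.
move=> iQ; have [Q0 QD QM] := iQ; split; first split=> [k|a b Qa Qb k|a b Qb k].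
- by rewrite linear0.
- by rewrite linearD; apply: QD; [apply: Qa | apply: Qb].
- rewrite (pihomog_partitionE (mf := mdeg) (leqnn (msize b))) mulr_sumr linear_sum /=.
  apply: ideal_sum => // i _; rewrite (hcM _ _ (pihomogP _ _ _)); case: leqP => // _.
  exact/QM/Qb.
by move=> k p Qp; apply: graded_core_homog (pihomogP _ _ _) (Qp k).
Qed.

Lemma sub_graded_core J Q : graded J -> (forall p, J p -> Q p) ->
  forall p, J p -> graded_core Q p.
Proof. by move=> [_ Jh] JQ p Jp k; apply/JQ/Jh. Qed.

Lemma graded_core_hprime Q : prime_ideal Q -> hprime (graded_core Q).
Proof.
move=> [iQ Q1 QM]; split; [exact: graded_coreP | by move/(graded_core_sub iQ) |].
move=> k l a b ha hb /(graded_core_sub iQ) /QM[Qa|Qb]; [left|right].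
  exact: graded_core_homog ha Qa.
exact: graded_core_homog hb Qb.
Qed.

(** Multiplication by a form only shifts degrees, so [Q] contains [a] times each component of
    [b]. *)
Lemma hprime_mulKl Q k a b : hprime Q -> a \is k.-homog -> ~ Q a -> Q (a * b) -> Q b.
Proof.
move=> [[iQ Qh] _ QM] ha Qa Qab.
rewrite (pihomog_partitionE (mf := mdeg) (leqnn (msize b))); apply: ideal_sum => // i _.
have := Qh (i + k)%N _ Qab; rewrite mulrC (hcM _ _ ha) leq_addl addnK mulrC.
by case/(QM _ _ _ _ ha (pihomogP _ _ _)).
Qed.

End Graded.

Section Generated.
Variables (L : fieldType) (N : nat) (I : finType).
Implicit Types (h : I -> {mpoly L[N]}) (A B : {set I}) (g : {mpoly L[N]}).

Definition gen h A g := exists w : I -> {mpoly L[N]}, g = \sum_(j in A) w j * h j.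

Lemma gen_ideal h A : ideal (gen h A).
Proof.
split=> [|a b [u ->] [v ->]|a b [v ->]].
- by exists (fun=> 0); rewrite big1 // => j _; rewrite mul0r.
- by exists (fun j => u j + v j); rewrite -big_split; apply: eq_bigr => j _; rewrite mulrDl.
- by exists (fun j => a * v j); rewrite mulr_sumr; apply: eq_bigr => j _; rewrite mulrA.
Qed.

Lemma gen_mem h A j : j \in A -> gen h A (h j).
Proof.
move=> jA; exists (fun i => (i == j)%:R); rewrite (bigD1 j) //= eqxx mul1r big1 ?addr0 //.
by move=> i /andP[_ /negPf->]; rewrite mul0r.
Qed.

Lemma gen_min h A (J : {mpoly L[N]} -> Prop) : ideal J ->
  (forall j, j \in A -> J (h j)) -> forall g, gen h A g -> J g.
Proof.
move=> iJ Jh g [w ->]; apply: ideal_sum => // j jA.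
by have [_ _ JM] := iJ; apply: JM; apply: Jh.
Qed.

Lemma gen_sub h A B g : A \subset B -> gen h A g -> gen h B g.
Proof. by move=> /subsetP AB; apply: gen_min (gen_ideal _ _) _ _ => j /AB; apply: gen_mem. Qed.

Lemma eq_gen h h' A g : {in A, h =1 h'} -> gen h A g -> gen h' A g.
Proof. by move=> hh' [w ->]; exists w; apply: eq_bigr => j jA; rewrite hh'. Qed.

Lemma genU1 h A j g : j \notin A ->
  gen h (j |: A) g <-> exists a b, gen h A a /\ g = a + b * h j.
Proof.
move=> jA; split=> [[w ->]|[a [b [Aa ->]]]].
  by exists (\sum_(i in A) w i * h i), (w j); rewrite big_setU1 // addrC; split=> //; exists w.
have [_ JD JM] := gen_ideal h (j |: A); apply: JD.
  by apply: gen_sub Aa; apply: subsetU1.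
by apply: JM; apply: gen_mem; rewrite setU11.
Qed.

Variable e : I -> nat.

(** Only the component of degree [k - e j] of the coefficient of [h j] contributes in degree [k].
    The case [k < e j] is stated apart because the subtraction truncates. *)
Lemma gen_homog h A k g : (forall j, j \in A -> h j \is (e j).-homog) -> g \is k.-homog ->
  gen h A g -> exists w, [/\ g = \sum_(j in A) w j * h j,
    forall j, w j \is (k - e j).-homog & forall j, (k < e j)%N -> w j = 0].
Proof.
move=> hh hg [w g_w]; exists (fun j => if (e j <= k)%N then hc (k - e j) (w j) else 0); split.
- rewrite -(homog_hc hg) g_w linear_sum /=; apply: eq_bigr => j jA.
  by rewrite (hcM _ _ (hh j jA)); case: ifP; rewrite ?mul0r.
- by move=> j; case: ifP; rewrite ?dhomog0 ?pihomogP.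
- by move=> j; rewrite ltnNge => /negPf->.
Qed.

Lemma gen_graded h A : (forall j, j \in A -> h j \is (e j).-homog) -> graded (gen h A).
Proof.
move=> hh; split=> [|k p [w ->]]; first exact: gen_ideal.
rewrite linear_sum /=; apply: ideal_sum; first exact: gen_ideal.
move=> j jA; rewrite (hcM _ _ (hh j jA)); have [J0 _ JM] := gen_ideal h A.
by case: ifP => // _; apply: JM; apply: gen_mem.
Qed.

Lemma gen_not1 h A : (forall j, j \in A -> h j \is (e j).-homog) ->
  (forall j, j \in A -> (0 < e j)%N) -> ~ gen h A 1.
Proof.
move=> hh e0; move=> /(gen_homog hh (dhomog1 _ _))[w [g_w _ w0]].
move/eqP: (oner_neq0 {mpoly L[N]}); apply.
by rewrite g_w big1 // => j /e0 ej; rewrite w0 ?mul0r.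
Qed.

End Generated.

(** * Systems of parameters are regular *)

Section SurjectiveInjective.
Variables (F : fieldType).

(* By Cayley-Hamilton: writing [char_poly C = q * 'X^k] with [q.[0] != 0], [W] contains
   [v - v B^k C^k], hence [v q(C)]. *)
Lemma surj_inj_mod D (W : 'rV[F]_D -> Prop) (B C : 'M[F]_D) :
  W 0 -> (forall u v, W u -> W v -> W (u + v)) -> (forall c v, W v -> W (c *: v)) ->
  (forall v, W v -> W (v *m C)) -> (forall v, W (v - v *m B *m C)) ->
  forall v, W (v *m C) -> W v.
Proof.
case: D W B C => [|D] W B C W0 WD WZ WC WBC v WvC; first by rewrite thinmx0.
have WB u w : W u -> W w -> W (u - w).
  by move=> Wu Ww; rewrite -scaleN1r; apply: WD Wu (WZ _ _ Ww).
have Whorner u r : W u -> W (u *m horner_mx C r).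
  elim/poly_ind: r u => [|r c IHr] u Wu; first by rewrite linear0 mulmx0.
  rewrite linearD /= horner_mx_C mulmxDr mul_mx_scalar; apply: WD (WZ _ _ Wu).
  by rewrite rmorphM /= horner_mx_X mulmxA; apply/WC/IHr.
have [k [q q0 p_eq]] := multiplicity_XsubC (char_poly C) 0.
rewrite (monic_neq0 (char_poly_monic C)) /= in q0; rewrite polyC0 subr0 in p_eq.
have WBk j u : W (u - u *m B ^+ j *m C ^+ j).
  elim: j u => [|j IHj] u; first by rewrite !expr0 !mulmx1 subrr.
  rewrite -[u](subrK (u *m B ^+ j *m C ^+ j)) -addrA; apply: WD (IHj u) _.
  rewrite subrK exprSr exprS -!mulmxE !mulmxA -mulmxBl.
  rewrite -(horner_mx_X C) -rmorphXn; apply: Whorner; rewrite horner_mx_X; exact: WBC.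
have Wvq : W (v *m horner_mx C q).
  have /(Whorner _ q) := WBk k v; rewrite mulmxBl -[X in _ - X]mulmxA.
  rewrite -{2}(horner_mx_X C) -rmorphXn mulmxE -rmorphM mulrC -p_eq /= Cayley_Hamilton.
  by rewrite mulmx0 subr0.
have Wq0 : W (v *m horner_mx C q - q.[0] *: v).
  elim/poly_ind: (q) => [|r c _]; first by rewrite linear0 mulmx0 horner0 scale0r subrr.
  rewrite hornerMXaddC mulr0 add0r linearD /= horner_mx_C mulmxDr mul_mx_scalar addrK.
  by rewrite mulrC rmorphM /= horner_mx_X mulmxA; apply: Whorner.
have := WB _ _ Wvq Wq0; rewrite opprB addrC subrK => /(WZ q.[0]^-1).
by rewrite scalerA mulVf ?scale1r.
Qed.

End SurjectiveInjective.

Section MonomialBasis.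
Variables (L : fieldType) (n k : nat).
Implicit Types (p : {mpoly L[n.+1]}).

Definition nmonos := #|{: monos n k}|.
Definition mono_of (i : 'I_nmonos) : 'X_{1..n.+1} := val (val (enum_val i)).

Lemma mdeg_mono_of i : mdeg (mono_of i) = k.
Proof. by apply/eqP/(valP (enum_val i)). Qed.

Lemma mono_of_inj : injective mono_of.
Proof. by move=> i j /val_inj/val_inj/enum_val_inj. Qed.

Lemma mono_ofP (m : 'X_{1..n.+1}) : mdeg m = k -> exists i, m = mono_of i.
Proof.
move=> mk; have mk1 : (mdeg m < k.+1)%N by rewrite mk.
have mk2 : mdeg (BMultinom mk1) == k by apply/eqP.
by exists (enum_rank (Sub (BMultinom mk1) mk2 : monos n k)); rewrite /mono_of enum_rankK.
Qed.

Definition row_poly (v : 'rV[L]_nmonos) : {mpoly L[n.+1]} :=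
  \sum_i v 0 i *: 'X_[mono_of i].

Definition poly_row p : 'rV[L]_nmonos := \row_i p@_(mono_of i).

Lemma row_poly_is_linear : linear row_poly.
Proof.
move=> c u v; rewrite /row_poly scaler_sumr -big_split /=; apply: eq_bigr => i _.
by rewrite !mxE scalerDl scalerA.
Qed.

HB.instance Definition _ := GRing.isLinear.Build L 'rV[L]_nmonos {mpoly L[n.+1]} _
  row_poly row_poly_is_linear.

Lemma poly_rowK p : p \is k.-homog -> row_poly (poly_row p) = p.
Proof.
move=> hp; apply/mpolyP => m; rewrite raddf_sum /=.
have [mk|mk] := eqVneq (mdeg m) k; last first.
  rewrite (dhomog_nemf_coeff hp mk) big1 // => i _; rewrite mcoeffZ mcoeffX.
  by case: eqP => [m_eq|_]; [rewrite -m_eq mdeg_mono_of eqxx in mk | rewrite mulr0].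
have [i ->] := mono_ofP mk.
rewrite (bigD1 i) //= mcoeffZ mcoeffX eqxx mulr1 mxE big1 ?addr0 // => j ji.
by rewrite mcoeffZ mcoeffX (inj_eq mono_of_inj) (negPf ji) mulr0.
Qed.

Lemma row_poly_mul v (C : 'M[L]_nmonos) :
  row_poly (v *m C) = \sum_i v 0 i *: row_poly (row i C).
Proof. by rewrite mulmx_sum_row linear_sum; apply: eq_bigr => i _; rewrite linearZ. Qed.

End MonomialBasis.

Section ExchangeNonzerodivisor.
Variables (L : fieldType) (n : nat).
Implicit Types (p x : {mpoly L[n.+1]}) (J : {mpoly L[n.+1]} -> Prop).

Definition nzd J a := forall x, J (x * a) -> J x.

Lemma nzd_homog J a d : graded J -> a \is d.-homog ->
  (forall k x, x \is k.-homog -> J (x * a) -> J x) -> nzd J a.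
Proof.
move=> [iJ Jh] ha Ja x Jxa; rewrite (pihomog_partitionE (mf := mdeg) (leqnn (msize x))).
apply: ideal_sum => // k _; apply: Ja (pihomogP _ _ _) _.
by have := Jh (k + d)%N _ Jxa; rewrite (hcM _ _ ha) leq_addl addnK.
Qed.

(* On the quotient by [J], multiplication by [l] from degree [t] to degree [t + d] is
   bijective for large [t] and multiplication by [g] is surjective; both source and
   target have the same finite dimension, so [g] is injective. *)
Lemma exchange_nzd J l g d tau : graded J -> l \is d.-homog -> g \is d.-homog ->
  (forall k p, (tau <= k)%N -> p \is k.-homog -> exists a b, J a /\ p = a + b * l) ->
  (forall k p, (tau <= k)%N -> p \is k.-homog -> exists a b, J a /\ p = a + b * g) ->
  (0 < d)%N -> nzd J l -> nzd J g.
Proof.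
move=> [iJ Jh] hl hg Jl Jg d0 nl; have [J0 JD JM] := iJ.
have JZ c p : J p -> J (c *: p) by rewrite -mul_mpolyC; apply: JM.
have lift u w t : u \is d.-homog -> w \is d.-homog -> (tau <= t)%N ->
    (forall k p, (tau <= k)%N -> p \is k.-homog -> exists a b, J a /\ p = a + b * w) ->
    exists C : 'M[L]_(nmonos n t), forall v, J (row_poly v * u - row_poly (v *m C) * w).
  move=> hu hw tt Jw.
  have Cex (i : 'I_(nmonos n t)) : exists c, c \is t.-homog /\ J ('X_[mono_of i] * u - c * w).
    have hi : ('X_[mono_of i] * u : {mpoly L[n.+1]}) \is (t + d).-homog.
      by apply: dhomogM => //; rewrite dhomogX /= mdeg_mono_of.
    have [|a [b [Ja eq_ab]]] := Jw _ _ _ hi; first by rewrite (leq_trans tt) ?leq_addr.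
    exists (hc t b); split; first exact: pihomogP.
    rewrite -(homog_hc hi) eq_ab linearD /= (hcM _ _ hw) leq_addl addnK addrK.
    exact: Jh.
  have [C CP] := boolp.choice Cex; exists (\matrix_i poly_row t (C i)) => v; rewrite row_poly_mul !mulr_suml -sumrB.
  apply: ideal_sum => // i _; rewrite rowK poly_rowK; last by case: (CP i).
  by rewrite -!scalerAl -scalerBr; apply: JZ; case: (CP i).
apply: (nzd_homog (conj iJ Jh) hg) => k x hx Jxg.
have nlX j : nzd J (l ^+ j).
  elim: j => [|j IHj] y; first by rewrite mulr1.
  by rewrite exprS mulrA => /IHj/nl.
pose t := (k + d * tau)%N; pose y := x * l ^+ tau.
have hy : y \is t.-homog by apply: dhomogM => //; apply: dhomogMn.
have tt : (tau <= t)%N by rewrite /t; nia.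
have [C CP] := lift g l t hg hl tt Jl; have [B BP] := lift l g t hl hg tt Jg.
apply: (nlX tau); rewrite -/y -(poly_rowK hy).
apply: (surj_inj_mod (W := fun v => J (row_poly v)) (B := B) (C := C)).
- by rewrite linear0.
- by move=> u v Ju Jv; rewrite linearD; apply: JD.
- by move=> c v Jv; rewrite linearZ; apply: JZ.
- move=> v Jv; apply: nl; have := idealB iJ (idealMr g iJ Jv) (CP v).
  by rewrite opprB addrC subrK.
- move=> v; apply: nl; rewrite linearB mulrBl /=.
  by have := JD _ _ (BP v) (CP (v *m B)); rewrite addrA subrK.
apply: nl; have := CP (poly_row t y); rewrite poly_rowK // => Jy.
have Jyg : J (y * g) by rewrite /y mulrAC; apply: idealMr.
by have := idealB iJ Jyg Jy; rewrite opprB addrC subrK.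
Qed.

(** The last hypothesis says that [b] is a nonzerodivisor modulo [J + (a)]. If [x * b] is in [J],
    then [x = u + v * a] with [u] in [J]; cancelling [a] leaves [v * b] in [J], with [v] of smaller
    degree than [x]. *)
Lemma nakayama_nzd J a b d e : graded J -> a \is d.-homog -> b \is e.-homog -> (0 < d)%N ->
  nzd J a ->
  (forall x u v, J u -> x * b = u + v * a -> exists u' v', J u' /\ x = u' + v' * a) ->
  nzd J b.
Proof.
move=> [iJ Jh] ha hb d0 na ab; have [J0 JD JM] := iJ.
apply: (nzd_homog (conj iJ Jh) hb) => k; elim/ltn_ind: k => k IHk x hx Jxb.
have [u [v [Ju x_uv]]] : exists u' v', J u' /\ x = u' + v' * a.
  by apply: (ab x (x * b) 0); rewrite ?mul0r ?addr0.
have {x_uv} x_eq : x = hc k u + (if (d <= k)%N then hc (k - d) v * a else 0).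
  by rewrite -(homog_hc hx) {1}x_uv linearD /= (hcM _ _ ha).
case: leqP x_eq => dk x_eq; last by rewrite x_eq addr0; apply: Jh.
rewrite x_eq; apply: JD; first exact: Jh.
apply: idealMr => //; apply: IHk (pihomogP _ _ _) _; first by lia.
apply: na; have := idealB iJ Jxb (idealMr b iJ (Jh k _ Ju)).
by rewrite -mulrBl x_eq addrC addKr mulrAC.
Qed.

End ExchangeNonzerodivisor.

Section RegularFamilies.
Variables (L : fieldType) (n : nat).
Local Notation S := {mpoly L[n.+1]}.
Implicit Types (h : 'I_n.+1 -> S) (A : {set 'I_n.+1}).
Variable e : 'I_n.+1 -> nat.
Hypothesis e_gt0 : forall i, (0 < e i)%N.

Definition forms h := forall i, h i \is (e i).-homog.

(** Over an algebraically closed field this amounts to having no common zero in projective space; as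
    an ideal membership it is accessible to linear algebra in a fixed degree. *)
Definition param_system h := forall j, exists k, gen h setT ('X_j ^+ k).

(** [A] stands for the forms placed before [h i], so all orders are covered. *)
Definition regular_family h := forall A i, i \notin A -> nzd (gen h A) (h i).

Lemma param_system_deg h : param_system h ->
  exists tau, forall k p, (tau <= k)%N -> p \is k.-homog -> gen h setT p.
Proof.
move=> /boolp.choice[M MP]; exists (\sum_j M j).+1 => k p tk hp.
rewrite [p]mpolyE big_seq; apply: ideal_sum => [|m /(dhomog_mf hp) /= mk]; first exact: gen_ideal.
have [_ _ gM] := gen_ideal h setT; rewrite -mul_mpolyC; apply: (gM).
have [j le_Mm] : exists j, (M j <= m j)%N.
  apply: boolp.contrapT => /boolp.forallNP lt_mM; suff : (k <= \sum_j M j)%N by rewrite leqNgt tk.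
  rewrite -mk mdegE; apply: leq_sum => j _.
  by rewrite ltnW // ltnNge; apply/negP/lt_mM.
rewrite -(submK (m := U_(j) *+ M j) (m' := m)); last first.
  apply/mnm_lepP => i; rewrite mulmnE mnm1E; case: eqP => [<-|_]; first by rewrite mul1n.
  by rewrite mul0n.
by rewrite mpolyXD -mpolyXn; apply: (gM).
Qed.

Lemma param_system_of_deg h k : (forall i : 'I_(nmonos n k), gen h setT 'X_[mono_of i]) ->
  param_system h.
Proof.
move=> hk j; exists k; rewrite mpolyXn.
have [|i ->] := @mono_ofP n k (U_(j) *+ k)%MM; last exact: hk.
by rewrite mdegMn mdeg1 mul1n.
Qed.

(** The ideal is monomial: membership means that every monomial is divisible by some [X_j ^ e j]
    with [j] in [A]. Multiplying by a power of [X_i], [i] outside [A], does not change these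
    exponents. *)
Lemma regular_monomials : regular_family (fun i => 'X_i ^+ e i).
Proof.
move=> A i iA; pose Y j : S := 'X_j ^+ e j.
pose J (p : S) := forall m, m \in msupp p -> exists2 j, j \in A & (e j <= m j)%N.
have iJ : ideal J.
  split=> [m|a b Ja Jb m /msuppD_le|a b Jb m /msuppM_le].
  - by rewrite msupp0.
  - by rewrite mem_cat => /orP[/Ja|/Jb].
  - case/allpairsP=> -[m1 m2] /= [_ /Jb[j jA le_ej] ->]; exists j => //.
    by rewrite mnmDE (leq_trans le_ej) ?leq_addl.
have JY p : J p <-> gen Y A p.
  split=> [Jp|]; last first.
    apply: gen_min => // j jA m; rewrite /Y mpolyXn msuppX inE => /eqP->.
    by exists j => //; rewrite mulmnE mnm1E eqxx mul1n.
  rewrite [p]mpolyE big_seq; apply: ideal_sum => [|m /Jp[j jA le_ej]]; first exact: gen_ideal.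
  have [_ _ gM] := gen_ideal Y A; rewrite -mul_mpolyC; apply: (gM).
  rewrite -(submK (m := U_(j) *+ e j) (m' := m)); last first.
    apply/mnm_lepP => l; rewrite mulmnE mnm1E; case: eqP => [<-|_]; first by rewrite mul1n.
    by rewrite mul0n.
  by rewrite mpolyXD -mpolyXn; apply/gM/gen_mem.
move=> x /JY Jx; apply/JY => m mx.
have [|j jA] := Jx (m + U_(i) *+ e i)%MM.
  by rewrite /= mpolyXn mcoeff_msupp addmC mcoeffMX -mcoeff_msupp.
rewrite mnmDE mulmnE mnm1E; case: eqP => [ij|_]; first by rewrite ij jA in iA.
by rewrite addn0; exists j.
Qed.

Lemma param_system_monomials : param_system (fun i => 'X_i ^+ e i).
Proof. by move=> j; exists (e j); apply: (gen_mem (fun i => 'X_i ^+ e i)); rewrite inE. Qed.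

Lemma forms_monomials : forms (fun i => 'X_i ^+ e i).
Proof. by move=> i; rewrite mpolyXn dhomogX /= mdegMn mdeg1 mul1n. Qed.

(** For [h' i], start from [A] the whole complement of [i], where [exchange_nzd] compares [h i] with
    [h' i], and pass to smaller [A] by [nakayama_nzd]. The other forms follow by permuting them with
    [h' i]. *)
Lemma regular_exchange h h' i : forms h -> forms h' ->
  (forall j, j != i -> h' j = h j) -> param_system h -> param_system h' ->
  regular_family h -> regular_family h'.
Proof.
move=> fh fh' hh' ph ph' rh.
have gr A : graded (gen h' A) by apply: (gen_graded (e := e)) => j _; apply: fh'.
have eq_h A : i \notin A -> forall g, gen h A g <-> gen h' A g.
  by move=> iA g; split; apply: eq_gen => j jA; rewrite hh' //; apply: contraNneq iA => <-.
have compl : forall f : 'I_n.+1 -> S, param_system f -> exists tau, forall k p, (tau <= k)%N ->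
    p \is k.-homog -> exists a b, gen f (~: [set i]) a /\ p = a + b * f i.
  move=> f /param_system_deg[tau ft]; exists tau => k p tk hp.
  apply/genU1; first by rewrite !inE eqxx.
  by apply: gen_sub (ft _ _ tk hp); apply/subsetP => j; rewrite !inE; case: eqP.
have nzd_i A : i \notin A -> nzd (gen h' A) (h' i).
  have [m] := ubnP #|~: A|; elim: m A => // m IHm A; rewrite ltnS => le_m iA.
  have [A_eq|[k kA ki]] : A = ~: [set i] \/ exists2 k, k \notin A & k != i.
    case: (boolP [forall k, (k \notin A) ==> (k == i)]) => [/forallP Ai|].
      left; apply/setP => k; rewrite !inE; have := Ai k.
      by have [->|ki] := eqVneq k i; [rewrite (negPf iA) | case: (k \in A)].
    by case/forallPn => k; rewrite negb_imply => /andP[kA ki]; right; exists k.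
    have [tau1 t1] := compl h ph; have [tau2 t2] := compl h' ph'.
    have iC : i \notin ~: [set i] by rewrite !inE eqxx.
    rewrite A_eq; apply: (@exchange_nzd _ _ _ (h i) (h' i) (e i) (maxn tau1 tau2)) => //.
    - move=> l p tl hp; have [a [b [Ja p_eq]]] := t1 l p (leq_trans (leq_maxl _ _) tl) hp.
      by exists a, b; split=> //; apply/eq_h.
    - by move=> l p tl hp; apply: (t2 l p) hp; apply: leq_trans tl; apply: leq_maxr.
    - by move=> x /(eq_h _ iC) /(rh _ _ iC) /(eq_h _ iC).
  have hk : h' k = h k by apply: hh'.
  apply: (@nakayama_nzd _ _ _ (h' k) (h' i) (e k) (e i)) => //.
    by rewrite hk => x /(eq_h _ iA) /(rh _ _ kA) /(eq_h _ iA).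
  move=> x u v Ju x_uv; apply/genU1 => //; apply: (IHm (k |: A)).
  - have := cardsC A; have := cardsC (k |: A); rewrite cardsU1 kA; lia.
  - by rewrite !inE negb_or eq_sym ki.
  - by apply/genU1 => //; exists u, v.
move=> A k kA; have [k_i|ki] := eqVneq k i; first by rewrite k_i in kA *; apply: nzd_i.
case: (boolP (i \in A)) => [iA|iA]; last first.
  by rewrite hh' // => x /(eq_h _ iA) /(rh _ _ kA) /(eq_h _ iA).
(* Modulo [A :\ i], [h' k] is a nonzerodivisor, and [h' i] remains one once [h' k] is added; the two
   can then be interchanged. *)
have iA0 : i \notin A :\ i by rewrite !inE eqxx.
have kA0 : k \notin A :\ i by rewrite !inE negb_and kA orbT.
have [_ JD _] := gen_ideal h' (A :\ i); have iJ := gen_ideal h' (A :\ i).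
have nk : nzd (gen h' (A :\ i)) (h' k).
  by rewrite hh' // => x /(eq_h _ iA0) /(rh _ _ kA0) /(eq_h _ iA0).
rewrite -(setD1K iA) => x /(genU1 _ _ iA0)[j [y [Jj xk]]].
have /(genU1 _ _ kA0)[j2 [z [Jj2 y_eq]]] : gen h' (k |: A :\ i) y.
  apply: (nzd_i (k |: A :\ i)); first by rewrite !inE eqxx /= orbF eq_sym ki.
  apply/(genU1 _ _ kA0); exists (- j), x; split; first exact: idealN.
  by rewrite xk addKr.
apply/(genU1 _ _ iA0); exists (x - z * h' i), z; split; last by rewrite subrK.
apply: nk; have -> : (x - z * h' i) * h' k = j + j2 * h' i.
  by rewrite mulrBl xk y_eq; ring.
by apply: JD => //; apply: idealMr.
Qed.

(** The coefficients [w] that express the monomials of degree [tau] through [h0], applied to the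
    segment, give the matrix [(1 - c) + c R]. Its determinant [p] is 1 at [c = 0]; where it is
    nonzero, all monomials of degree [tau] lie in the ideal. *)
Lemma param_system_open h0 h1 : forms h0 -> forms h1 -> param_system h0 ->
  exists p : {poly L}, p.[0] != 0 /\ forall c, p.[c] != 0 ->
    param_system (fun i => (1 - c) *: h0 i + c *: h1 i).
Proof.
move=> f0 f1 /param_system_deg[tau gt].
have wex (i : 'I_(nmonos n tau)) : exists w, 'X_[mono_of i] = \sum_j w j * h0 j /\
    \sum_j w j * h1 j \is tau.-homog.
  have hX : ('X_[mono_of i] : S) \is tau.-homog by rewrite dhomogX /= mdeg_mono_of.
  have [|w [Xw hw w0]] := gen_homog (e := e) _ hX (gt _ _ (leqnn _) hX); first by move=> j _; apply: f0.
  exists w; split; first by rewrite Xw; apply: eq_bigl => j; rewrite inE.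
  apply: rpred_sum => j _; case: (leqP (e j) tau) => [le_e|/w0->]; last by rewrite mul0r dhomog0.
  by have := dhomogM (hw j) (f1 j); rewrite subnK.
have [w wP] := boolp.choice wex.
pose R := \matrix_i poly_row tau (\sum_j w i j * h1 j).
pose M : 'M[{poly L}]_(nmonos n tau) := (1 - 'X)%:M + 'X *: map_mx polyC R.
have MR c : map_mx (horner_eval c) M = (1 - c)%:M + c *: R.
  by rewrite map_mxD map_scalar_mx map_mxZ /= /horner_eval !hornerE -map_mx_comp map_mx_id // => x; rewrite /= hornerC.
exists (\det M); split=> [|c].
  by rewrite -[X in X != 0]/(horner_eval 0 (\det M)) -det_map_mx MR subr0 scale0r addr0 det1 oner_neq0.
rewrite -[X in X != 0]/(horner_eval c (\det M)) -det_map_mx MR => detM.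
set h := fun i => _; pose N := (1 - c)%:M + c *: R.
have NU : N \in unitmx by rewrite unitmxE unitfE.
have iJ := gen_ideal h setT; have [_ _ gM] := iJ.
have rowN i : row_poly (row i N) = \sum_j w i j * h j.
  have -> : row i N = (1 - c) *: delta_mx 0 i + c *: poly_row tau (\sum_j w i j * h1 j).
    apply/rowP => l; rewrite !mxE; congr (_ + _); rewrite eqxx /= eq_sym.
    by rewrite mulr_natr.
  rewrite linearD !linearZ /= poly_rowK; last by case: (wP i).
  have -> : row_poly (delta_mx 0 i) = 'X_[mono_of i] :> S.
    rewrite /row_poly (bigD1 i) //= mxE !eqxx scale1r big1 ?addr0 // => j ji.
    by rewrite mxE eqxx (negPf ji) scale0r.
  have [-> _] := wP i; rewrite !scaler_sumr -big_split /=; apply: eq_bigr => j _.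
  by rewrite /h mulrDr !scalerAr.
apply: (@param_system_of_deg _ tau) => i.
have -> : 'X_[mono_of i] = row_poly (delta_mx 0 i *m invmx N *m N) :> S.
  rewrite mulmxKV // /row_poly (bigD1 i) //= mxE !eqxx scale1r big1 ?addr0 // => j ji.
  by rewrite mxE eqxx (negPf ji) scale0r.
rewrite row_poly_mul; apply: ideal_sum => // j _; rewrite -mul_mpolyC; apply: (gM).
by rewrite rowN; exists (w j); apply: eq_bigl => l; rewrite inE.
Qed.

End RegularFamilies.

(* The entries of [a] are replaced one at a time by those of [b]; each single
   replacement passes through a generic point [c] of the segment between the two
   entries, at which the systems stay finite. *)
Lemma regular_deform (L : closedFieldType) n (e : 'I_n.+1 -> nat) :
  (forall i, (0 < e i)%N) -> forall a b : 'I_n.+1 -> {mpoly L[n.+1]},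
  forms e a -> forms e b -> param_system a -> param_system b ->
  regular_family a -> regular_family b.
Proof.
move=> e0 a b; pose D := [set i | a i != b i]; have abD i : i \notin D -> a i = b i.
  by rewrite inE negbK => /eqP.
have [m] := ubnP #|D|; move: D abD => D; elim: m D a b => // m IHm D a b abD.
rewrite ltnS => le_m fa fb pa pb ra.
have [D0|[k kD]] := set_0Vmem D.
  move=> A i iA x; rewrite -abD ?D0 ?inE // => bx.
  have eq_ab : {in A, b =1 a} by move=> j _; rewrite abD ?D0 ?inE.
  have eq_ba : {in A, a =1 b} by move=> j _; rewrite abD ?D0 ?inE.
  by apply: (eq_gen eq_ba); apply: (ra A i iA); apply: (eq_gen eq_ab).
pose upd (h : 'I_n.+1 -> {mpoly L[n.+1]}) g i := if i == k then g else h i.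
have fupd h g : forms e h -> g \is (e k).-homog -> forms e (upd h g).
  by move=> fh hg i; rewrite /upd; case: eqP => [->|].
have [p [p0 pP]] := param_system_open fa (fupd _ _ fa (fb k)) pa.
have [q [q0 qP]] := param_system_open fb (fupd _ _ fb (fa k)) pb.
have /closed_nonrootP[c] : p * (q \Po (1 - 'X)) != 0.
  rewrite mulf_neq0 //; first by apply: contraNneq p0 => ->; rewrite horner0.
  apply: contraNneq q0 => q0; have := congr1 (fun r => r.[1]) q0.
  by rewrite horner_comp !hornerE subrr => ->.
rewrite rootM negb_or !rootE horner_comp !hornerE => /andP[pc qc].
pose g := (1 - c) *: a k + c *: b k.
have hg : g \is (e k).-homog by apply: rpredD; apply: rpredZ.
have peq h h' : h =1 h' -> param_system h -> param_system h'.
  by move=> hh ph j; have [l hl] := ph j; exists l; apply: eq_gen hl => i _.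
have pa' : param_system (upd a g).
  apply: peq (pP c pc) => i; rewrite /upd; case: eqP => [->//|_].
  by rewrite -scalerDl subrK scale1r.
have pb' : param_system (upd b g).
  apply: peq (qP _ qc) => i; rewrite /upd /g subKr addrC.
  by case: eqP => [->//|_]; rewrite -scalerDl subrK scale1r.
have ra' : regular_family (upd a g).
  apply: (regular_exchange e0 fa (fupd _ _ fa hg) _ pa pa' ra (i := k)) => j jk.
  by rewrite /upd (negPf jk).
have rb' : regular_family (upd b g).
  apply: (IHm (D :\ k) (upd a g)) => //; try exact: fupd.
    by move=> i; rewrite !inE negb_and negbK /upd => /orP[->//|/abD->].
  by move: le_m; rewrite (cardsD1 k) kD.
apply: (regular_exchange e0 (fupd _ _ fb hg) fb _ pb' pb rb' (i := k)) => j jk.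
by rewrite /upd (negPf jk).
Qed.

Theorem param_system_regular (L : closedFieldType) n (e : 'I_n.+1 -> nat)
    (h : 'I_n.+1 -> {mpoly L[n.+1]}) :
  (forall i, (0 < e i)%N) -> forms e h -> param_system h -> regular_family h.
Proof.
move=> e0 fh ph; apply: (regular_deform e0 (forms_monomials _ _) fh (param_system_monomials _ _) ph).
exact: regular_monomials.
Qed.

(** * Finiteness over the last variables *)

Section Substitution.
Variables (K : nzRingType) (R : comNzRingType) (f : {rmorphism K -> R}) (N : nat).

Lemma mmap_congr_ideal (J : R -> Prop) (u v : 'I_N -> R) (p : {mpoly K[N]}) : ideal J ->
  (forall i, J (u i - v i)) -> J (mmap f u p - mmap f v p).
Proof.
move=> iJ uv; rewrite /mmap -sumrB; apply: ideal_sum => // m _; rewrite -mulrBr.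
have [J0 JD JM] := iJ; apply: (JM); rewrite /mmap1.
elim: (index_enum _) => [|i r IHr]; first by rewrite !big_nil subrr.
rewrite !big_cons -[X in X - _](subrK (v i ^+ m i * \prod_(j <- r) u j ^+ m j)) -addrA.
rewrite -mulrBl -mulrBr; apply: JD; last exact: JM.
by apply: idealMr => //; rewrite subrXX; apply: idealMr.
Qed.

End Substitution.

Section Restriction.
Variables (L : fieldType) (N : nat).
Local Notation S := {mpoly L[N]}.
Implicit Types (g p : S) (A B : {set 'I_N}) (x : 'I_N -> L).

(** The equation [restr A t = t] expresses that [t] lies in [L[X_j, j in A]], without a second
    polynomial ring. *)
Definition restr A : S -> S := mmap (@mpolyC N L) (fun i => if i \in A then 'X_i else 0).

HB.instance Definition _ A := GRing.RMorphism.copy (restr A) (restr A).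

Lemma restrX A i : restr A 'X_i = if i \in A then 'X_i else 0.
Proof. by rewrite /restr mmapX mmap1U. Qed.

Lemma restrC A c : restr A c%:MP = c%:MP.
Proof. exact: mmapC. Qed.

Lemma restrZ A c p : restr A (c *: p) = c *: restr A p.
Proof. by rewrite -!mul_mpolyC rmorphM /= restrC. Qed.

Lemma restrXm A (m : 'X_{1..N}) :
  restr A 'X_[m] = if [forall i, (i \notin A) ==> (m i == 0%N)] then 'X_[m] else 0.
Proof.
rewrite /restr mmapX /mmap1 [in RHS]mpolyXE_id; case: forallP => [mA|/forallP/forallPn[i]].
  apply: eq_bigr => i _; have := mA i; case: (i \in A) => //= /eqP->.
  by rewrite !expr0.
by rewrite negb_imply => /andP[/negPf iA mi]; rewrite (bigD1 i) //= iA expr0n (negPf mi) mul0r.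
Qed.

Lemma restrE A g : restr A g = \sum_(m <- msupp g) g@_m *: restr A 'X_[m].
Proof.
rewrite {1}(mpolyE g) (raddf_sum (restr A)); apply: eq_bigr => m _; exact: restrZ.
Qed.

Lemma restr_restr A B g : restr A (restr B g) = restr (A :&: B) g.
Proof.
rewrite (restrE B) (restrE (A :&: B)) (raddf_sum (restr A)); apply: eq_bigr => m _.
rewrite /= !restrZ !restrXm.
have -> : [forall i, (i \notin A :&: B) ==> (m i == 0%N)] =
    [forall i, (i \notin B) ==> (m i == 0%N)] && [forall i, (i \notin A) ==> (m i == 0%N)].
  apply/forallP/andP => [mAB|[/forallP mB /forallP mA] i]; last first.
    by have := mA i; have := mB i; rewrite inE; case: (i \in A) (i \in B) => [] [].
  by split; apply/forallP => i; have := mAB i; rewrite inE; case: (i \in A) (i \in B) => [] [].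
by case: ifP => _ /=; rewrite ?restrXm ?raddf0.
Qed.

Lemma restr_id A B g : B \subset A -> restr B g = g -> restr A g = g.
Proof. by move=> /setIidPr AB g_eq; rewrite -{1}g_eq restr_restr AB. Qed.

Lemma restr_meval A g x : (restr A g).@[x] = g.@[fun i => if i \in A then x i else 0].
Proof.
rewrite restrE [in RHS](mpolyE g) !raddf_sum; apply: eq_bigr => m _ /=; rewrite !mevalZ; congr (_ * _).
rewrite restrXm; case: forallP => [mA|/forallP/forallPn[i]].
  rewrite !mevalX; apply: eq_bigr => i _; have := mA i; case: (i \in A) => //= /eqP->.
  by rewrite !expr0.
rewrite negb_imply => /andP[/negPf iA mi]; rewrite meval0 mevalX (bigD1 i) //= iA.
by rewrite expr0n (negPf mi) mul0r.
Qed.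

Lemma restr_homog A g k : g \is k.-homog -> restr A g \is k.-homog.
Proof.
move=> hg; rewrite restrE big_seq; apply: rpred_sum => m /(dhomog_mf hg) mk.
by rewrite restrXm; apply: rpredZ; case: ifP => _; rewrite ?dhomog0 ?dhomogX ?mk.
Qed.

Lemma hc_restr A g k : hc k (restr A g) = restr A (hc k g).
Proof.
rewrite {1}(pihomog_partitionE (mf := mdeg) (leq_maxl (msize g) k.+1)).
rewrite (raddf_sum (restr A)) linear_sum /=.
have ltk : (k < maxn (msize g) k.+1)%N by lia.
rewrite (bigD1 (Ordinal ltk)) //= big1 ?addr0 => [|i ik].
  by rewrite homog_hc //; apply/restr_homog/pihomogP.
apply: homog_hc0 (restr_homog A (pihomogP _ i g)) _; apply: contra ik => /eqP ik.
exact/eqP/val_inj.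
Qed.

Lemma restr_congr A (J : S -> Prop) g : ideal J -> (forall i, i \notin A -> J 'X_i) ->
  J (g - restr A g).
Proof.
move=> iJ JX; rewrite -{1}[g]comp_mpoly_id; apply: mmap_congr_ideal => // i.
rewrite tnth_mktuple; case: ifPn => [_|/JX]; first by rewrite subrr; case: iJ.
by rewrite subr0.
Qed.

Lemma meval_congr B (J : S -> Prop) g x : ideal J -> (forall i, i \in B -> J ('X_i - (x i)%:MP)) ->
  restr B g = g -> J (g - (g.@[x])%:MP).
Proof.
move=> iJ Jx <-; rewrite restr_meval /restr.
have -> : (g.@[fun i => if i \in B then x i else 0])%:MP_[N] =
    mmap (@mpolyC N L) (fun i => (if i \in B then x i else 0)%:MP) g.
  rewrite mevalE rmorph_sum; apply: eq_bigr => m _ /=; rewrite rmorphM; congr (_ * _).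
  by rewrite rmorph_prod; apply: eq_bigr => i _; rewrite rmorphXn.
apply: mmap_congr_ideal => // i; case: ifP => [/Jx //|_].
by rewrite rmorph0 subrr; case: iJ.
Qed.

Lemma homog_meval0 g k x : g \is k.-homog -> (0 < k)%N -> (forall i, x i = 0) -> g.@[x] = 0.
Proof.
move=> hg k0 x0; rewrite mevalE big_seq big1 // => m /(dhomog_mf hg) /= mk.
have [i mi] : exists i, m i != 0%N.
  apply: boolp.contrapT => /boolp.forallNP m0; move: k0; rewrite -mk mdegE big1 // => i _.
  by apply/eqP/negPn/negP/m0.
by rewrite (bigD1 i) //= x0 expr0n (negPf mi) mul0r mulr0.
Qed.

End Restriction.

(** Multiply by the adjugate. When some [b j] is 1, the determinant itself lies in [J]; this is how
    integral equations arise below. *)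
Lemma cramer_ideal (R : comNzRingType) q (J : R -> Prop) (M : 'M[R]_q) (b : 'I_q -> R) : ideal J ->
  (forall i, J (\sum_j M i j * b j)) -> forall j, J (\det M * b j).
Proof.
move=> iJ Mb j; have [_ _ JM] := iJ.
have -> : \det M * b j = \sum_i \adj M j i * \sum_k M i k * b k.
  under eq_bigr do rewrite mulr_sumr; rewrite exchange_big /=.
  have adjM k : \sum_i \adj M j i * (M i k * b k) = (\det M)%:M j k * b k.
    by rewrite -mul_adj_mx mxE mulr_suml; apply: eq_bigr => i _; rewrite mulrA.
  under eq_bigr do rewrite adjM.
  rewrite (bigD1 j) //= big1 ?addr0 => [|k kj]; first by rewrite mxE eqxx mulr1n.
  by rewrite mxE eq_sym (negPf kj) mulr0n mul0r.
by apply: ideal_sum => // i _; apply: JM.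
Qed.

Section Finiteness.
Variables (L : closedFieldType) (n : nat).
Local Notation S := {mpoly L[n.+1]}.
Variables (e : 'I_n.+1 -> nat) (h : 'I_n.+1 -> S) (B : {set 'I_n.+1}).
Hypotheses (e_gt0 : forall i, (0 < e i)%N) (fh : forms e h) (ph : param_system h).
Hypothesis hB : forall j, j \in B -> h j = 'X_j.
Implicit Types (g c t : S) (J Q : S -> Prop).

(* [T = L[X_j, j in B]] is the image of [restr B]; [S / I0] is a finite [T]-module. *)
Local Notation I0 := (gen h (~: B)).

Let e1 j : j \in B -> e j = 1%N.
Proof.
move=> jB; apply: (@dhomog_uniq _ _ mdeg (h j)) (fh j) _.
  by rewrite hB // -msupp_eq0 msuppX.
by rewrite hB // dhomogX /= mdeg1.
Qed.

(** Graded Nakayama: the monomials of degree less than [tau] generate, because modulo [I0] a form of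
    degree at least [tau] is a combination of the [X_j], [j] in [B], with coefficients of lower
    degree. The bound on [msize], that is degree at most [k], is for the monomial count in
    [alg_dependent]. *)
Lemma finite_over_restr : exists q (b : 'I_q -> S) i0, b i0 = 1 /\
  forall k g, g \is k.-homog -> exists c : 'I_q -> S, [/\ forall i, restr B (c i) = c i,
    forall i, (msize (c i) <= k.+1)%N & I0 (g - \sum_i c i * b i)].
Proof.
(* The successor makes [tau] positive, so that the monomial 1 is among the generators. *)
have [tau0 gt0] := param_system_deg ph; pose tau := tau0.+1.
have gt k p : (tau <= k)%N -> p \is k.-homog -> gen h setT p.
  by move=> tk; apply: gt0; apply: leq_trans tk.
pose E : finType := 'X_{1..n.+1 < tau}.
pose b (i : 'I_#|E|) : S := 'X_[val (enum_val i)].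
exists #|E|, b, (enum_rank (bm0 : E)); rewrite /b enum_rankK; split; first exact: mpolyX0.
move=> k; elim/ltn_ind: k => k IHk g hg; have [I0_0 I0D I0M] := gen_ideal h (~: B).
have [tk|kt] := leqP tau k; last first.
  exists (fun i => (g@_(val (enum_val i)))%:MP); split=> [i|i|]; first exact: restrC.
    by rewrite msizeC; case: eqP.
  have sg : (msize g <= tau)%N.
    rewrite -[g](homog_hc hg); apply: leq_trans kt; apply/bigmax_leqP_seq => m mg _.
    by rewrite (dhomog_mf (pihomogP _ _ _) mg).
  rewrite [X in X - _](mpolywE sg) (reindex (fun i : 'I_#|E| => enum_val i)) /=; last first.
    by apply: onW_bij; apply: enum_val_bij.
  by rewrite -sumrB big1 // => i _; rewrite mul_mpolyC subrr.
have [|w [g_w hw w0]] := gen_homog (e := e) _ hg (gt _ _ tk hg); first by move=> j _; apply: fh.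
have cex (j : 'I_n.+1) : exists c : 'I_#|E| -> S, j \in B -> [/\ forall i, restr B (c i) = c i,
    forall i, (msize (c i) <= k)%N & I0 (w j - \sum_i c i * b i)].
  case: (boolP (j \in B)) => [jB|_]; last by exists (fun=> 0).
  have hwj : w j \is (k - 1).-homog by rewrite -(e1 jB).
  have [|c [rc sc Ic]] := IHk (k - 1)%N _ _ hwj; first by rewrite subn1 prednK // (leq_trans _ tk).
  by exists c => _; split=> // i; apply: leq_trans (sc i) _; rewrite subn1 prednK // (leq_trans _ tk).
have [c cP] := boolp.choice cex.
exists (fun i => \sum_(j in B) 'X_j * c j i); split=> [i|i|].
- rewrite (raddf_sum (restr B)); apply: eq_bigr => j jB; rewrite /= rmorphM /= restrX jB.
  by have [-> _ _] := cP j jB.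
- apply: leq_trans (msize_sum _ _ _) _; apply/bigmax_leqP => j jB.
  have [_ sc _] := cP j jB; have [->|cj0] := eqVneq (c j i) 0; first by rewrite mulr0 msize0.
  have X0 : ('X_j : S) != 0 by rewrite -msupp_eq0 msuppX.
  by rewrite msizeM // msizeX mdeg1 add2n /= ltnS; exact: sc.
have -> : g - \sum_i (\sum_(j in B) 'X_j * c j i) * b i =
    \sum_(j in ~: B) w j * h j + \sum_(j in B) 'X_j * (w j - \sum_i c j i * b i).
  rewrite {1}g_w (bigID (mem B)) /= addrAC addrC; congr (_ + _).
    by apply: eq_bigl => j; rewrite !inE.
  have -> : \sum_i (\sum_(j in B) 'X_j * c j i) * b i = \sum_(j in B) 'X_j * \sum_i c j i * b i.
    under eq_bigr do rewrite mulr_suml.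
    rewrite exchange_big /=; apply: eq_bigr => j _; rewrite mulr_sumr.
    by apply: eq_bigr => i _; rewrite mulrA.
  under [RHS]eq_bigr do rewrite mulrBr.
  rewrite sumrB; congr (_ - _); apply: eq_big => [j|j]; first by rewrite inE.
  by rewrite inE => jB; rewrite hB // mulrC.
apply: I0D; first by exists w.
by apply: ideal_sum => [|j jB]; [exact: gen_ideal | apply: (I0M); case: (cP j jB)].
Qed.

Lemma finite_over_restr_all : exists q (b : 'I_q -> S) i0, b i0 = 1 /\
  forall g, exists c : 'I_q -> S, (forall i, restr B (c i) = c i) /\ I0 (g - \sum_i c i * b i).
Proof.
have [q [b [i0 [b0 bP]]]] := finite_over_restr; exists q, b, i0; split=> // g.
have [c cP] := boolp.choice (fun k => bP k _ (pihomogP _ k g)).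
exists (fun i => \sum_(k < msize g) c k i); split=> [i|].
  rewrite (raddf_sum (restr B)); apply: eq_bigr => k _ /=; by have [-> _ _] := cP k.
rewrite {1}(pihomog_partitionE (mf := mdeg) (leqnn (msize g))).
rewrite (_ : \sum_i _ * _ = \sum_(k < msize g) \sum_i c k i * b i); last first.
  by rewrite exchange_big /=; apply: eq_bigr => i _; rewrite mulr_suml.
rewrite -sumrB; apply: ideal_sum => [|k _]; first exact: gen_ideal.
by case: (cP k).
Qed.

(** Modulo [J], [t] times a generator is a combination of generators with coefficients in the ideal
    of [T] spanned by the [y k]. If [N] is the matrix of these coefficients, [c] is the determinant
    of [t - N]; as [phi] kills [N], it sends [c] to a power of [phi t]. *)
Lemma integral_trick (R : comNzRingType) (phi : {rmorphism S -> R}) (K : finType)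
    (y w : K -> S) J t :
  ideal J -> (forall g, I0 g -> J g) -> restr B t = t -> (forall k, restr B (y k) = y k) ->
  (forall k, phi (y k) = 0) -> J (t - \sum_k y k * w k) ->
  exists c m, [/\ restr B c = c, J c & phi c = phi t ^+ m].
Proof.
move=> iJ IJ rt ry phiy Jt; have [J0 JD JM] := iJ.
have [q [b [i0 [b0 bP]]]] := finite_over_restr_all.
have [c cP] := boolp.choice (fun ki : K * 'I_q => bP (w ki.1 * b ki.2)).
pose M := t%:M - \matrix_(i, j) \sum_k y k * c (k, i) j.
exists (\det M), q; split; last 1 first.
- rewrite -det_map_mx map_mxB map_scalar_mx.
  rewrite (_ : map_mx _ _ = 0) ?subr0 ?det_scalar //.
  apply/matrixP => i j; rewrite !mxE raddf_sum big1 // => k _ /=.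
  by rewrite rmorphM phiy mul0r.
- rewrite -det_map_mx; congr (\det _); rewrite map_mxB map_scalar_mx /= rt; congr (_ - _).
  apply/matrixP => i j; rewrite !mxE (raddf_sum (restr B)); apply: eq_bigr => k _ /=.
  by rewrite rmorphM /= ry; have [-> _] := cP (k, i).
rewrite -[\det M]mulr1 -b0; apply: (cramer_ideal (b := b) iJ) => i.
have -> : \sum_j M i j * b j = t * b i - \sum_k y k * \sum_j c (k, i) j * b j.
  under eq_bigr do rewrite mxE mulrDl.
  rewrite big_split /= (bigD1 i) //= [X in _ + X + _]big1 ?addr0 => [|j ji]; last first.
    by rewrite mxE eq_sym (negPf ji) mulr0n mul0r.
  rewrite mxE eqxx mulr1n; congr (_ + _).
  under eq_bigr do rewrite !mxE mulNr mulr_suml.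
  rewrite sumrN exchange_big /=; congr (- _); apply: eq_bigr => k _; rewrite mulr_sumr.
  by apply: eq_bigr => j _; rewrite mulrA.
have -> : t * b i - \sum_k y k * \sum_j c (k, i) j * b j = (t - \sum_k y k * w k) * b i +
    \sum_k y k * (w k * b i - \sum_j c (k, i) j * b j).
  under [X in _ = _ + X]eq_bigr do rewrite mulrBr mulrA.
  by rewrite sumrB mulrBl mulr_suml addrA subrK.
apply: JD; first exact: idealMr.
apply: ideal_sum => // k _; apply: (JM); apply: IJ.
by have [] := cP (k, i).
Qed.

(* Lying over: otherwise [1] belongs to [J + (X_j - p_j)] and the integral trick gives
   an element of [J] in [T] with value [1] at [p].  In a prime ideal above [J + (X_j -
   p_j)] every [X_i] is congruent to a constant, an eigenvalue of multiplication by
   [X_i]. *)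
Lemma lying_over J (p : 'I_n.+1 -> L) : ideal J -> (forall g, I0 g -> J g) ->
  (forall c, restr B c = c -> J c -> c.@[p] = 0) ->
  exists x, (forall j, j \in B -> x j = p j) /\ forall g, J g -> g.@[x] = 0.
Proof.
move=> iJ IJ Jp; pose y j : S := if j \in B then 'X_j - (p j)%:MP else 0.
have rp : {morph (fun c : S => c.@[p]) : x z / x - z} by move=> x z; apply: rmorphB.
pose J' g := exists a w, J a /\ g = a + \sum_j y j * w j.
have [J0 JD JM] := iJ.
have iJ' : ideal J'.
  split=> [|f g [a [w [Ja ->]]] [a' [w' [Ja' ->]]]|f g [a [w [Ja ->]]]].
  - by exists 0, (fun=> 0); split=> //; rewrite big1 ?addr0 // => j _; rewrite mulr0.
  - exists (a + a'), (fun j => w j + w' j); split; first exact: JD.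
    by under [in RHS]eq_bigr do rewrite mulrDr; rewrite big_split addrACA.
  - exists (f * a), (fun j => f * w j); split; first exact: JM.
    by rewrite mulrDr mulr_sumr; congr (_ + _); apply: eq_bigr => j _; rewrite mulrCA.
have JJ' g : J g -> J' g.
  by move=> Jg; exists g, (fun=> 0); split=> //; rewrite big1 ?addr0 // => j _; rewrite mulr0.
have J'y j : j \in B -> J' ('X_j - (p j)%:MP).
  move=> jB; exists 0, (fun i => (i == j)%:R); split=> //; rewrite add0r (bigD1 j) //= eqxx mulr1.
  by rewrite /y jB big1 ?addr0 // => i /negPf->; rewrite mulr0.
have J'1 : ~ J' 1.
  case=> a [w [Ja eq1]].
  have [||||c [m [rc Jc]]] := @integral_trick _ (meval p) _ y w J 1 iJ IJ.
  - exact: rmorph1.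
  - by move=> j; rewrite /y; case: ifP => jB; rewrite ?raddf0 // raddfB /= restrC restrX jB.
  - by move=> j /=; rewrite /y; case: ifP => jB; rewrite ?raddf0 // rp mevalXU mevalC subrr.
  - by rewrite {1}eq1 addrK.
  by rewrite /= (Jp c rc Jc) meval1 expr1n => /eqP; rewrite eq_sym oner_eq0.
have [|||Q [[iQ Q1 QM] J'Q _]] := @prime_avoidance _ J' (eq 1) iJ'.
- by [].
- by move=> a b <- <-; rewrite mulr1.
- by move=> a J'a a1; apply: J'1; rewrite a1.
have [Q0 QD _] := iQ.
have xex i : exists z, Q ('X_i - z%:MP).
  have [q [b [i0 [b0 bP]]]] := finite_over_restr_all.
  have [c cP] := boolp.choice (fun k : 'I_q => bP ('X_i * b k)).
  pose M : 'M[L]_q := \matrix_(k, l) (c k l).@[p].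
  pose theta : {rmorphism {poly L} -> S} := horner_alg ('X_i : S).
  have Qchi : Q (theta (char_poly M)).
    apply: J'Q; rewrite -[theta _]mulr1 -b0 /char_poly -det_map_mx; apply: (cramer_ideal (b := b) iJ') => k.
    rewrite map_mxB map_scalar_mx /= -map_mx_comp.
    have -> : \sum_j ((theta 'X)%:M - map_mx (theta \o polyC) M) k j * b j =
        ('X_i * b k - \sum_j c k j * b j) + \sum_j (c k j - ((c k j).@[p])%:MP) * b j.
      under [X in _ = _ + X]eq_bigr do rewrite mulrBl.
      rewrite sumrB addrA subrK; under eq_bigr do rewrite mxE mulrDl.
      rewrite big_split /=; congr (_ + _).
        rewrite (bigD1 k) //= big1 ?addr0 => [|j jk]; last first.
          by rewrite mxE eq_sym (negPf jk) mulr0n mul0r.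
        by rewrite mxE eqxx mulr1n /theta horner_algX.
      by rewrite -sumrN; apply: eq_bigr => j _; rewrite !mxE mulNr /= horner_algC alg_mpolyC.
    have [rc Ic] := cP k; have [_ J'D _] := iJ'; apply: J'D; first exact/JJ'/IJ.
    apply: ideal_sum => // j _; apply: idealMr => //.
    exact: (meval_congr (B := B)).
  have [rs chi_eq] := closed_field_poly_normal (char_poly M).
  move: Qchi; rewrite chi_eq (monicP (char_poly_monic M)) scale1r rmorph_prod /=.
  elim: rs {chi_eq} => [|z rs IHrs]; first by rewrite big_nil => /Q1.
  rewrite big_cons => /QM[|/IHrs //].
  by rewrite rmorphB /= /theta horner_algX horner_algC alg_mpolyC; exists z.
have [x xP] := boolp.choice xex.
have Qconst (z : L) : Q z%:MP -> z = 0.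
  move=> Qz; apply: boolp.contrapT => z0; apply: Q1.
  have -> : 1 = (z^-1)%:MP * z%:MP :> S by rewrite -mpolyCM mulVf //; apply/eqP.
  by have [_ _ QMl] := iQ; apply: QMl.
exists x; split=> [j jB|g Jg].
  apply/eqP; rewrite -subr_eq0; apply/eqP/Qconst; rewrite mpolyCB.
  have := idealB iQ (J'Q _ (J'y j jB)) (xP j).
  by rewrite opprB addrC addrA subrK.
apply: Qconst; have Qg := J'Q _ (JJ' _ Jg).
have Qgx : Q (g - (g.@[x])%:MP).
  apply: (meval_congr (B := setT)) => //.
  rewrite restrE [RHS]mpolyE; apply: eq_bigr => m _; rewrite restrXm.
  by case: forallP => // -[] i; rewrite inE.
by have := idealB iQ Qg Qgx; rewrite opprB addrC subrK.
Qed.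

(** The characteristic polynomial of multiplication by [g] on the generators vanishes at [g] modulo
    [Q]; taking the component of degree [q * k] of its value turns the coefficients into forms. *)
Lemma integral_equation Q g k : hprime Q -> (forall p, I0 p -> Q p) -> g \is k.-homog ->
  exists m (c : nat -> S), [/\ forall i, restr B (c i) = c i,
    forall i, (i < m)%N -> c i \is ((m - i) * k).-homog & Q (g ^+ m + \sum_(i < m) c i * g ^+ i)].
Proof.
move=> [[iQ Qh] _ _] IQ hg; have [q [b [i0 [b0 bP]]]] := finite_over_restr_all.
have [c cP] := boolp.choice (fun a : 'I_q => bP (g * b a)).
pose M := \matrix_(a, l) c a l; pose chi := char_poly M.
have rchi i : restr B chi`_i = chi`_i.
  rewrite -(coef_map (restr B)) /= map_char_poly; congr ((char_poly _)`_i).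
  by apply/matrixP => a l; rewrite !mxE; have [rc _] := cP a; apply: rc.
have Ichi : I0 chi.[g].
  rewrite -[chi.[g]]/(horner_eval g chi) -[horner_eval g chi]mulr1 -b0 /chi /char_poly -det_map_mx.
  apply: (cramer_ideal (b := b) (gen_ideal _ _)) => a.
  have [_] := cP a; rewrite map_mxB map_scalar_mx /= /horner_eval hornerX -map_mx_comp.
  congr (gen h (~: B) _); symmetry; under eq_bigr do rewrite mxE mulrDl.
  rewrite big_split /=; congr (_ + _).
    rewrite (bigD1 a) //= big1 ?addr0 => [|j ja]; first by rewrite mxE eqxx mulr1n.
    by rewrite mxE eq_sym (negPf ja) mulr0n mul0r.
  by rewrite -sumrN; apply: eq_bigr => j _; rewrite !mxE /= hornerC mulNr.
have schi : size chi = q.+1 by rewrite size_char_poly.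
exists q, (fun i => hc ((q - i) * k) chi`_i); split=> [i|i _|].
- by rewrite -hc_restr rchi.
- exact: pihomogP.
have := Qh (q * k)%N _ (IQ _ Ichi); rewrite horner_coef schi linear_sum big_ord_recr /= addrC.
have hgi i : g ^+ i \is (k * i).-homog by apply: dhomogMn.
have -> : chi`_q = 1.
  by have := char_poly_monic M; rewrite monicE lead_coefE -/chi schi => /eqP.
rewrite mul1r (homog_hc (k := q * k)); last by rewrite mulnC.
congr (Q (_ + _)); apply: eq_bigr => i _.
rewrite (hcM _ _ (hgi i)) mulnBl (mulnC i) ifT // mulnC leq_mul2r.
by rewrite ltnW ?orbT.
Qed.

(** If [g] is not in [Q], a shortest integral equation has its constant term outside [Q], as
    otherwise [g] would cancel. That term is nonzero at some point with coordinates in [B1] zero,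
    above which [lying_over] finds a zero of [Q]. There [g] vanishes, hence so does the constant
    term, a contradiction. *)
Lemma homog_nullstellensatz Q (B1 : {set 'I_n.+1}) j0 g k :
  hprime Q -> (forall p, I0 p -> Q p) -> B1 \subset B -> j0 \in B -> j0 \notin B1 ->
  (forall j, j \in B1 -> Q 'X_j) ->
  (forall t, restr B t = t -> Q t -> restr (~: B1) t = 0) ->
  g \is k.-homog ->
  (forall x, (exists j, x j != 0) -> (forall p, Q p -> p.@[x] = 0) -> g.@[x] = 0) -> Q g.
Proof.
move=> hQ IQ sB1 j0B j0B1 QB1 QT; have [[iQ Qh] Q1 QM] := hQ.
have hX j : ('X_j : S) \is 1.-homog by rewrite dhomogX /= mdeg1.
have QX0 : ~ Q 'X_j0.
  move=> /QT; rewrite !restrX j0B inE j0B1 => /(_ erefl)/eqP.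
  by rewrite -msupp_eq0 msuppX.
(* Positive degree is needed to see that the zero [x] found above is a nonzero vector: the constant
   term is then a form of positive degree with nonzero value at [x]. Multiplication by [X_j0], not
   in [Q], achieves it. *)
wlog k0 : g k / (0 < k)%N.
  move=> wl hg gx; apply: (hprime_mulKl hQ (hX j0) QX0).
  rewrite mulrC; apply: (wl _ (k + 1)%N); [by rewrite addn1 | exact: dhomogM |].
  by move=> x x0 Qx; rewrite mevalM (gx x x0 Qx) mul0r.
move=> hg gx; apply: boolp.contrapT => nQg.
have [m [[c [rc hcm Qm]] mmin]] := ex_least (integral_equation hQ IQ hg).
case: m => [|m] in hcm Qm mmin; first by move: Qm; rewrite big_ord0 expr0 addr0.
have nQc0 : ~ Q (c 0%N).
  move=> Qc0; suff : (m < m)%N by rewrite ltnn.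
  apply: mmin.
  exists (fun i => c i.+1); split=> // [i lti|]; first by rewrite -subSS; apply: hcm.
  apply: (hprime_mulKl hQ hg nQg); have := idealB iQ Qm Qc0.
  rewrite big_ord_recl expr0 mulr1 addrCA addrAC subrr add0r mulrDr exprS.
  congr (Q (_ + _)).
  by rewrite mulr_sumr; apply: eq_bigr => i _; rewrite /= exprS mulrCA.
have c00 : restr (~: B1) (c 0%N) != 0.
  apply/eqP => c0; apply: nQc0; rewrite -[c 0%N]subr0 -c0.
  by apply: restr_congr => // i; rewrite inE negbK; apply: QB1.
have [p cp] := mpoly_nonroot c00; rewrite restr_meval in cp.
have [|x [xp Qx]] := @lying_over Q (fun i => if i \in ~: B1 then p i else 0) iQ IQ.
  by move=> t rt Qt; rewrite -restr_meval QT // meval0.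
have c0x : (c 0%N).@[x] != 0.
  apply: contra cp => /eqP c0x; apply/eqP; rewrite -[RHS]c0x -(rc 0%N) !restr_meval.
  apply: meval_eq => i.
  by case: ifP => // /xp->.
have h0 : c 0%N \is (m.+1 * k).-homog by have := hcm 0%N; rewrite subn0; apply.
have x0 : exists j, x j != 0.
  apply: boolp.contrapT => /boolp.forallNP nx; move: c0x; rewrite (homog_meval0 h0) ?eqxx ?muln_gt0 //.
  by move=> i; apply/eqP/negPn/negP/nx.
have := Qx _ Qm; rewrite mevalD rmorphXn /= (gx x x0 Qx) expr0n add0r raddf_sum big_ord_recl /=.
rewrite expr0 mulr1 big1 ?addr0 => [/eqP|i _]; first by rewrite (negPf c0x).
by rewrite mevalM rmorphXn /= (gx x x0 Qx) expr0n mulr0.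
Qed.

(* A form [c] in [T] with [c p != 0] completes, together with the linear forms
   vanishing at [p], the system [h j, j notin B] to a finite system; such systems are
   regular in any order. *)
Lemma restr_nzd c k : c != 0 -> restr B c = c -> c \is k.-homog -> nzd I0 c.
Proof.
move=> c0 rc hc; case: k => [|k] in hc *.
  have c_const : c = (c@_0)%:MP.
    apply/mpolyP => m; rewrite mcoeffC; have [->|m0] := eqVneq m 0%MM; first by rewrite mulr1.
    by rewrite mulr0 (dhomog_nemf_coeff hc) //= mdeg_eq0.
  have u0 : c@_0 != 0 by apply: contraNneq c0 => u0; rewrite c_const u0 mpolyC0.
  move=> x; rewrite c_const mulrC => Ix; have [_ _ IM] := gen_ideal h (~: B).
  have -> : x = (c@_0)^-1%:MP * ((c@_0)%:MP * x) by rewrite mulrA -mpolyCM mulVf // mul1r.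
  exact: IM.
have [p cp] := mpoly_nonroot c0.
have [j0 j0B pj0] : exists2 j, j \in B & p j != 0.
  apply: boolp.contrapT => np; move: cp; rewrite -rc restr_meval (homog_meval0 hc) ?eqxx // => i.
  case: ifP => // iB; apply/eqP/negPn/negP => pi; apply: np; by exists i.
pose h' i : S := if i == j0 then c else if i \in B then p j0 *: 'X_i - p i *: 'X_j0 else h i.
pose e' i := if i == j0 then k.+1 else e i.
have e'0 i : (0 < e' i)%N by rewrite /e'; case: eqP.
have hX j : ('X_j : S) \is 1.-homog by rewrite dhomogX /= mdeg1.
have fh' : forms e' h'.
  move=> i; rewrite /h' /e'; case: eqP => // _; case: ifP => // iB.
  by rewrite e1 //; apply: rpredB; apply: rpredZ.
have ph' : param_system h'.
  move=> j; apply: boolp.contrapT => nj.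
  have [|||Q [[iQ Q1 QM] hQ UQ]] := @prime_avoidance _ (gen h' setT) (fun a => exists m, a = 'X_j ^+ m) (gen_ideal _ _).
  - by exists 0%N.
  - by move=> a b [m ->] [m' ->]; exists (m + m')%N; rewrite exprD.
  - by move=> a Ia [m am]; apply: nj; exists m; rewrite -am.
  have [_ QD QMl] := iQ.
  have Qh' i : Q (h' i) by apply: hQ; apply: gen_mem; rewrite inE.
  have QZ (z : L) a : z != 0 -> Q (z *: a) -> Q a.
    move=> z0 Qa; have -> : a = (z^-1)%:MP * (z *: a) by rewrite mul_mpolyC scalerA mulVf ?scale1r.
    exact: QMl.
  (* Modulo [Q], each [X_i] with [i] in [B] equals [a i] times [X_j0], so the form [c] becomes a
     nonzero multiple of [X_j0 ^ k.+1]. *)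
  have QX0 : Q 'X_j0.
    apply: (@prime_idealX _ _ _ k.+1); first by split.
    pose a i := if i \in B then p i / p j0 else 0.
    apply: (QZ (c.@[a])).
      suff -> : c.@[a] = (p j0)^-1 ^+ k.+1 * c.@[p] by rewrite mulf_neq0 // expf_neq0 // invr_neq0.
      rewrite -[in RHS]rc restr_meval -(mmap_scale_homog _ _ _ hc); apply: meval_eq => i.
      by rewrite /a; case: ifP; rewrite ?mulr0 // mulrC.
    have Qc : Q c by have := Qh' j0; rewrite /h' eqxx.
    suff Qca : Q (c - c.@[a] *: 'X_j0 ^+ k.+1).
      by have := idealB iQ Qc Qca; rewrite opprB addrC subrK.
    have -> : c.@[a] *: 'X_j0 ^+ k.+1 = mmap (@mpolyC _ L) (fun i => 'X_j0 * (a i)%:MP) c.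
      rewrite (mmap_scale_homog _ _ _ hc) -mul_mpolyC mulrC; congr (_ * _).
      rewrite mevalE rmorph_sum; apply: eq_bigr => m _ /=; rewrite rmorphM; congr (_ * _).
      by rewrite rmorph_prod; apply: eq_bigr => i _; rewrite rmorphXn.
    rewrite -{1}rc; apply: mmap_congr_ideal => // i; rewrite /a; case: ifP => iB; last first.
      by rewrite raddf0 mulr0 subrr; case: iQ.
    have := Qh' i; rewrite /h' iB; case: eqP => [->|_] Qi.
      by rewrite divff // mulr1 subrr; case: iQ.
    apply: (QZ (p j0)) => //; rewrite scalerBr mulrC mul_mpolyC scalerA mulrCA divff // mulr1.
    exact: Qi.
  have QX i : i \in B -> Q 'X_i.
    move=> iB; have [->//|ij0] := eqVneq i j0; apply: (QZ (p j0)) => //.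
    have := Qh' i; rewrite /h' (negPf ij0) iB => Qi.
    have := QD _ _ Qi (QMl (p i)%:MP _ QX0); by rewrite mul_mpolyC subrK.
  have Qh i : Q (h i).
    case: (boolP (i \in B)) => iB; first by rewrite hB //; apply: QX.
    have := Qh' i; rewrite /h' (negPf iB); case: eqP => // i_j0.
    by rewrite i_j0 j0B in iB.
  have [M hM] := ph j; apply: (UQ ('X_j ^+ M)); last by exists M.
  by apply: gen_min hM => // i _.
have rh' := param_system_regular e'0 fh' ph'.
have eq_hh' i : i \in ~: B -> h' i = h i.
  rewrite inE /h' => iB; rewrite (negPf iB); case: eqP => // i_j0.
  by rewrite i_j0 j0B in iB.
have j0B' : j0 \notin ~: B by rewrite inE negbK.
have h'j0 : h' j0 = c by rewrite /h' eqxx.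
move=> x Ix; have rx := rh' _ _ j0B' x; rewrite h'j0 in rx.
by apply: (eq_gen eq_hh'); apply: rx; apply: eq_gen Ix => i iB; rewrite eq_hh'.
Qed.

End Finiteness.

(** * Dimension of projective zero sets *)

(* A polynomial relation modulo [P k.+1] may be assumed to have a nonzero constant term
   in the last variable; as [a k] lies in [P k], that term is a relation modulo [P k]. *)
Lemma alg_indep_chain (L : fieldType) (R : comNzRingType) (f : {rmorphism L -> R})
    (P : nat -> R -> Prop) (a : nat -> R) K :
  (forall j, (j <= K)%N -> ideal (P j)) -> (forall j, (j < K)%N -> P j (a j)) ->
  (forall j g, (j < K)%N -> P j.+1 (a j * g) -> P j.+1 g) ->
  (forall j g, (j < K)%N -> P j.+1 g -> P j g) ->
  (forall c, P 0%N (f c) -> c = 0) ->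
  forall k, (k <= K)%N -> forall F : {mpoly L[k]}, P k (mmap f (fun i => a i) F) -> F = 0.
Proof.
move=> iP Pa Pan PS P0; elim=> [|k IHk] lekK F.
  by rewrite (nvar0_mpolyC F) mmapC => /P0->; rewrite mpolyC0.
have iP1 := iP _ lekK; have iPk := iP _ (ltnW lekK).
rewrite mmap_muni => PF; apply/eqP; rewrite -(rmorph_inj_eq0 (muni_bij L k)) /=; apply/eqP.
move: (muni F) PF => q; have [m] := ubnP (size q); elim: m q => // m IHm q.
rewrite ltnS => le_m Pq; case/boolP: (q == 0) => [/eqP //|q0].
pose ev := mmap f (fun i : 'I_k => a i).
have [r [c q_rc]] : exists r c, q = r * 'X + c%:P.
  elim/poly_ind: (q) => [|r c _]; last by exists r, c.
  by exists 0, 0; rewrite mul0r add0r.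
have evq : (map_poly ev q).[a k] = (map_poly ev r).[a k] * a k + ev c.
  by rewrite q_rc rmorphD rmorphM /= map_polyX map_polyC !hornerE.
have Pkc : P k (ev c).
  have Pkq : P k (map_poly ev q).[a k] by apply: PS.
  have Pka : P k ((map_poly ev r).[a k] * a k) by have [_ _ PM] := iPk; apply/PM/Pa.
  by have := idealB iPk Pkq Pka; rewrite evq addrC addKr.
have c0 : c = 0 by apply: IHk => //; apply: ltnW.
have r0 : r = 0.
  apply: IHm; last first.
    by apply: (Pan k) => //; move: Pq; rewrite -/ev evq c0 /ev rmorph0 addr0 mulrC.
  apply: leq_trans le_m; rewrite q_rc c0 addr0; have [r0|r0] := eqVneq r 0.
    by move: q0; rewrite q_rc c0 r0 mul0r addr0 eqxx.
  by rewrite size_mulX.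
by move: q0; rewrite q_rc c0 r0 mul0r addr0 eqxx.
Qed.

Lemma kernel_row (F : fieldType) (U V : finType) (A : U -> V -> F) : (#|V| < #|U|)%N ->
  exists l : U -> F, (exists u, l u != 0) /\ forall v, \sum_u l u * A u v = 0.
Proof.
move=> ltVU; pose M : 'M[F]_(#|U|, #|V|) := \matrix_(i, j) A (enum_val i) (enum_val j).
have /rowV0Pn[v /sub_kermxP vM v0] : kermx M != 0.
  rewrite -mxrank_eq0 mxrank_ker -lt0n subn_gt0; exact: leq_ltn_trans (rank_leq_col M) ltVU.
exists (fun u => v 0 (enum_rank u)); split.
  have [i vi] : exists i, v 0 i != 0.
    apply: boolp.contrapT => /boolp.forallNP nv; case/eqP: v0; apply/rowP => i; rewrite mxE.
    by apply/eqP/negPn/negP/nv.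
  by exists (enum_val i); rewrite enum_valK.
move=> w; have := congr1 (fun r : 'rV_#|V| => r 0 (enum_rank w)) vM; rewrite !mxE => vMw.
rewrite -[RHS]vMw (reindex (fun i : 'I_#|U| => enum_val i)) /=; last first.
  by apply: onW_bij; apply: enum_val_bij.
by apply: eq_bigr => i _; rewrite !mxE enum_valK enum_rankK.
Qed.

Section Dependence.
Variables (L : closedFieldType) (n : nat).
Local Notation S := {mpoly L[n.+1]}.
Variables (e : 'I_n.+1 -> nat) (h : 'I_n.+1 -> S) (B : {set 'I_n.+1}).
Hypotheses (e_gt0 : forall i, (0 < e i)%N) (fh : forms e h) (ph : param_system h).
Hypothesis hB : forall j, j \in B -> h j = 'X_j.
Local Notation I0 := (gen h (~: B)).

(* Dimension count: the [tau ^ #|B|.+1] monomials of degree less than [tau] in each [a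
   i] are combinations of [O(tau ^ #|B|)] elements modulo [I0]. *)
Lemma alg_dependent (a : nat -> S) (ea : nat -> nat) : (forall i, a i \is (ea i).-homog) ->
  exists F : {mpoly L[#|B|.+1]}, F != 0 /\ I0 (mmap (@mpolyC _ L) (fun i => a i) F).
Proof.
move=> ha; have [m [b [i0 [b0 bP]]]] := finite_over_restr fh ph hB.
pose q := #|B|.+1; pose E := (\sum_(i < q) ea i).+1.
(* The products [aU u] have degree less than [D], so at most [m * D ^ #|B|] coefficients occur in
   their expressions; [tau > m * E ^ #|B|] makes this less than [tau ^ q]. *)
pose tau := (m * E ^ #|B|).+1; pose D := (E * tau)%N.
pose U : finType := {ffun 'I_q -> 'I_tau}.
pose mU (u : U) : 'X_{1..q} := [multinom val (u i) | i < q].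
pose aU (u : U) : S := mmap1 (fun i : 'I_q => a i) (mU u).
pose dU (u : U) := (\sum_(i < q) ea i * u i)%N.
have haU u : aU u \is (dU u).-homog.
  rewrite /aU /mmap1 /dU; apply: (big_ind2 (fun (p : S) k => p \is k.-homog)).
  - exact: dhomog1.
  - by move=> p k p' k'; apply: dhomogM.
  - by move=> i _; rewrite mnmE; apply: dhomogMn.
have ltdU u : (dU u < D)%N.
  rewrite /D /E mulSn; apply: leq_ltn_trans (_ : (\sum_(i < q) ea i) * tau < _)%N.
    rewrite big_distrl /=; apply: leq_sum => i _.
    by rewrite leq_mul2l ltnW ?orbT // -[X in (_ <= X)%N]prednK.
  by rewrite -[X in (X < _)%N]add0n ltn_add2r.
have [c cP] := boolp.choice (fun u => bP _ _ (haU u)).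
pose T : finType := {j : 'I_n.+1 | j \in B}.
pose V : finType := ('I_m * {ffun T -> 'I_D})%type.
pose mV (w : {ffun T -> 'I_D}) : 'X_{1..n.+1} :=
  [multinom (if insub i is Some j then val (w j) else 0%N) | i < n.+1].
have ltVU : (#|V| < #|U|)%N.
  have -> : #|V| = (m * E ^ #|B| * tau ^ #|B|)%N.
    by rewrite card_prod card_ffun !card_ord card_sig /D expnMn mulnA (eq_card (B := B)).
  have -> : #|U| = (tau ^ q)%N by rewrite card_ffun !card_ord.
  by rewrite expnS ltn_mul2r expn_gt0 /= ltnSn.
have [l [[u0 lu0] lV]] := kernel_row (fun u (v : V) => (c u v.1)@_(mV v.2)) ltVU.
pose F : {mpoly L[q]} := \sum_u l u *: 'X_[mU u].
have mU_inj : injective mU.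
  move=> u u' /mnmP eq_u; apply/ffunP => i; apply: val_inj.
  by have := eq_u i; rewrite !mnmE.
exists F; split.
  apply: contraNneq lu0 => F0; have := congr1 (fun p => p@_(mU u0)) F0.
  rewrite mcoeff0 raddf_sum (bigD1 u0) //= mcoeffZ mcoeffX eqxx mulr1 big1 ?addr0 => [->//|u uu0].
  by rewrite mcoeffZ mcoeffX (inj_eq mU_inj) (negPf uu0) mulr0.
have -> : mmap (@mpolyC _ L) (fun i : 'I_q => a i) F = \sum_u l u *: aU u.
  by rewrite rmorph_sum; apply: eq_bigr => u _; rewrite /= mmapZ mmapX mul_mpolyC.
have sumc i : \sum_u l u *: c u i = 0.
  apply/mpolyP => mo; rewrite mcoeff0 raddf_sum /=.
  have [[w mo_w]|nw] := boolp.EM (exists w, mo = mV w).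
    rewrite -[RHS](lV (i, w)); apply: eq_bigr => u _; by rewrite mcoeffZ mo_w.
  apply: big1 => u _; rewrite mcoeffZ; have [rc sc _] := cP u.
  case: (eqVneq (c u i)@_mo 0) => [->|cmo]; first by rewrite mulr0.
  case: nw; have lt_mo j : (mo j < D)%N.
    apply: leq_ltn_trans (_ : mo j <= mdeg mo)%N _; first by rewrite mdegE (bigD1 j) //= leq_addr.
    have := msize_mdeg_lt (p := c u i) (m := mo); rewrite mcoeff_msupp => /(_ cmo) lt_mo.
    by apply: leq_ltn_trans (ltdU u); rewrite -ltnS; apply: leq_trans lt_mo (sc i).
  exists [ffun j : T => Ordinal (lt_mo (val j))]; apply/mnmP => j; rewrite mnmE.
  case: insubP => [j' _ <-|jB]; first by rewrite ffunE.
  move: cmo; rewrite -(rc i) restrE raddf_sum /= => cmo.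
  apply/eqP; apply: contraNT cmo => mj; apply/eqP/big1 => m' _.
  rewrite mcoeffZ restrXm; case: forallP => [m'B|_]; last by rewrite mcoeff0 mulr0.
  rewrite mcoeffX; case: eqP => [m'_mo|_]; last by rewrite mulr0.
  by have := m'B j; rewrite jB m'_mo (negPf mj).
rewrite (_ : \sum_u _ = \sum_u l u *: (aU u - \sum_i c u i * b i)); last first.
  under [RHS]eq_bigr do rewrite scalerBr scaler_sumr.
  rewrite sumrB [X in _ - X]exchange_big /= [X in _ - X]big1 ?subr0 // => i _.
  by under eq_bigr do rewrite scalerAl; rewrite -mulr_suml sumc mul0r.
apply: ideal_sum => [|u _]; first exact: gen_ideal.
by have [_ _ IM] := gen_ideal h (~: B); rewrite -mul_mpolyC; apply: IM; case: (cP u).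
Qed.
End Dependence.

(** * Closed sets and their graded ideals *)

Section ProjectiveZeros.
Variables (L : closedFieldType) (n : nat).
Local Notation S := {mpoly L[n.+1]}.
Implicit Types (g p : S) (Q J : S -> Prop) (C : pset L n) (x : coords L n).

Definition zeros Q : pset L n := proj_zeros (fun g => Q g /\ exists k, g \is k.-homog).

(** The graded core makes the ideal graded for every [C], with no appeal to invariance under
    scaling. *)
Definition vanishing C : S -> Prop := graded_core (fun g => forall x, C x -> g.@[x] = 0).

(** Kept as a condition on [Q], since it fails for the irrelevant ideal. *)
Definition nullstellensatz_for Q := forall k g, g \is k.-homog ->
  (forall x, zeros Q x -> g.@[x] = 0) -> Q g.

Lemma zerosP Q x : graded Q ->
  zeros Q x <-> (exists j, x j != 0) /\ forall p, Q p -> p.@[x] = 0.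
Proof.
move=> [_ Qh]; split=> [[x0 Qx]|[x0 Qx]]; last by split=> // g [/Qx].
split=> // p Qp; rewrite (pihomog_partitionE (mf := mdeg) (leqnn (msize p))) raddf_sum /=.
rewrite big1 // => i _; apply: Qx; split; first exact: Qh.
by exists i; apply: pihomogP.
Qed.

Lemma vanish_ideal C : ideal (fun g : S => forall x, C x -> g.@[x] = 0).
Proof.
split=> [x _|a b Ca Cb x Cx|a b Cb x Cx]; first exact: meval0.
  by rewrite mevalD Ca // Cb // addr0.
by rewrite mevalM Cb // mulr0.
Qed.

Lemma vanishing_graded C : graded (vanishing C).
Proof. exact/graded_coreP/vanish_ideal. Qed.

Lemma vanishing_eval C p x : vanishing C p -> C x -> p.@[x] = 0.
Proof. by move=> /(graded_core_sub (vanish_ideal C)); apply. Qed.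

Lemma vanishing_homog C k p : p \is k.-homog -> (forall x, C x -> p.@[x] = 0) -> vanishing C p.
Proof. by move=> hp Cp; apply: graded_core_homog hp Cp; apply: vanish_ideal. Qed.

Lemma sub_vanishing C D p : psubset C D -> vanishing D p -> vanishing C p.
Proof. by move=> CD Dp k x /CD; apply: Dp. Qed.

Lemma closed_neq0 C x : proj_closed C -> C x -> exists j, x j != 0.
Proof. by move=> [G [_ CG]] /CG[]. Qed.

Lemma closed_separate C x : proj_closed C -> (exists j, x j != 0) -> ~ C x ->
  exists k a, [/\ a \is k.-homog, vanishing C a & a.@[x] != 0].
Proof.
move=> [G [Gh CG]] x0 nCx; apply: boolp.contrapT => nex; apply: nCx; apply/CG; split=> // g Gg.
apply/eqP/negPn/negP => gx; apply: nex; have [k hg] := Gh g Gg; exists k, g; split=> //.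
by apply: vanishing_homog hg _ => y /CG[_]; apply.
Qed.

Lemma closed_zeros C x : proj_closed C -> C x <-> zeros (vanishing C) x.
Proof.
move=> cC; rewrite (zerosP _ (vanishing_graded C)); split=> [Cx|[x0 Cx]].
  by split=> [|p /vanishing_eval]; [exact: closed_neq0 Cx | apply].
apply: boolp.contrapT => /(closed_separate cC x0)[k [a [_ Ca]]].
by rewrite (Cx a Ca) eqxx.
Qed.

Lemma zeros_closed Q : proj_closed (zeros Q).
Proof. by exists (fun g => Q g /\ exists k, g \is k.-homog); split=> // g []. Qed.

Lemma hprime_vanishing C : proj_irreducible C -> hprime (vanishing C).
Proof.
move=> [cC [y Cy] irrC]; split; first exact: vanishing_graded.
  by move=> /vanishing_eval /(_ Cy) /eqP; rewrite meval1 oner_eq0.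
move=> k l a b ha hb Cab.
have cl i (g : S) : g \is i.-homog -> proj_closed (proj_zeros (eq g)).
  by move=> hg; exists (eq g); split=> // _ <-; exists i.
have [|Ca|Cb] := irrC _ _ (cl _ _ ha) (cl _ _ hb).
- move=> x Cx; have x0 := closed_neq0 cC Cx.
  have := vanishing_eval Cab Cx; rewrite mevalM => /eqP; rewrite mulf_eq0.
  by case/orP=> /eqP gx; [left|right]; split=> // _ <-.
- by left; apply: vanishing_homog ha _ => x /Ca[_ ]; apply.
- by right; apply: vanishing_homog hb _ => x /Cb[_ ]; apply.
Qed.

Lemma zeros_irreducible Q : hprime Q -> nullstellensatz_for Q -> proj_irreducible (zeros Q).
Proof.
move=> [gQ Q1 QM] nQ; split; first exact: zeros_closed.
  apply: boolp.contrapT => /boolp.forallNP nz; apply: Q1; apply: (nQ 0%N); first exact: dhomog1.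
  by move=> x /nz.
move=> A D cA cD AD; apply: boolp.contrapT => /boolp.not_orP[nA nD].
have sep C : proj_closed C -> ~ psubset (zeros Q) C ->
    exists k a, [/\ a \is k.-homog, forall x, C x -> a.@[x] = 0 & ~ Q a].
  move=> cC nC; have [x [Qx Cx]] : exists x, zeros Q x /\ ~ C x.
    apply: boolp.contrapT => nex; apply: nC => x Qx; apply: boolp.contrapT => Cx.
    by apply: nex; exists x.
  have [x0 Qx0] := (zerosP x gQ).1 Qx.
  have [k [a [ha Ca ax]]] := closed_separate cC x0 Cx.
  exists k, a; split=> // [y|Qa]; first exact: vanishing_eval.
  by rewrite (Qx0 a Qa) eqxx in ax.
have [k [a [ha Aa nQa]]] := sep _ cA nA; have [l [b [hb Db nQb]]] := sep _ cD nD.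
case: (QM _ _ _ _ ha hb) => //; apply: (nQ (k + l)%N); first exact: dhomogM.
by move=> x /AD[/Aa|/Db] gx; rewrite mevalM gx ?mul0r ?mulr0.
Qed.

Lemma vanishing_zeros Q p : graded Q -> nullstellensatz_for Q -> vanishing (zeros Q) p -> Q p.
Proof.
move=> [iQ _] nQ vp; rewrite (pihomog_partitionE (mf := mdeg) (leqnn (msize p))).
by apply: ideal_sum => // i _; apply: (nQ i); [exact: pihomogP | apply: vp].
Qed.

End ProjectiveZeros.

Section ProjectiveDimension.
Variables (L : closedFieldType) (n r : nat).
Local Notation S := {mpoly L[n.+1]}.
Variables (e : 'I_n.+1 -> nat) (h : 'I_n.+1 -> S) (B : {set 'I_n.+1}) (Z : pset L n).
Hypotheses (e_gt0 : forall i, (0 < e i)%N) (fh : forms e h) (ph : param_system h).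
Hypothesis hB : forall j, j \in B -> h j = 'X_j.
Hypothesis cardB : #|B| = r.+1.
Hypothesis ZP : forall x, Z x <-> (exists j, x j != 0) /\ forall i, i \notin B -> (h i).@[x] = 0.
Local Notation I0 := (gen h (~: B)).
Implicit Types (Q : S -> Prop).

(* [Q] contracts to the prime [(X_j, j in B1)] of [T = L[X_j, j in B]]. *)
Definition lies_over Q (B1 : {set 'I_n.+1}) := [/\ hprime Q, forall p, I0 p -> Q p,
  forall j, j \in B1 -> Q 'X_j & forall t, restr B t = t -> Q t -> restr (~: B1) t = 0].

Lemma Z_zeros x : Z x <-> zeros I0 x.
Proof.
have gI : graded I0 by apply: (gen_graded (e := e)) => j _; apply: fh.
rewrite (zerosP x gI) ZP; split=> -[x0 hx]; split=> //.
  move=> p Ip; have vx := gen_min (vanish_ideal (eq x)); apply: (vx _ _ _ _ _ Ip) => // j.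
  by rewrite inE => /hx hj y <-.
by move=> i iB; apply: hx; apply: gen_mem; rewrite inE.
Qed.

Lemma lies_over_nullstellensatz Q (B1 : {set 'I_n.+1}) :
  lies_over Q B1 -> B1 \proper B -> nullstellensatz_for Q.
Proof.
move=> [hQ IQ QB1 QT] /properP[sB1 [j0 j0B j0B1]] k g hg gx; have [gQ _ _] := hQ.
apply: (homog_nullstellensatz fh ph hB hQ IQ sB1 j0B j0B1 QB1 QT hg) => x x0 Qx.
by apply: gx; apply/zerosP.
Qed.

Lemma lies_over_irreducible Q (B1 : {set 'I_n.+1}) :
  lies_over Q B1 -> B1 \proper B -> proj_irreducible (zeros Q).
Proof.
move=> lQ sB1; apply: zeros_irreducible (lies_over_nullstellensatz lQ sB1).
by case: lQ.
Qed.

Lemma lies_over_notin Q (B1 : {set 'I_n.+1}) j :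
  lies_over Q B1 -> j \in B -> j \notin B1 -> ~ Q 'X_j.
Proof.
move=> [_ _ _ QT] jB jB1 /QT; rewrite !restrX jB inE jB1 => /(_ erefl)/eqP.
by rewrite -msupp_eq0 msuppX.
Qed.

Lemma zeros_sub_Z Q : (forall p, I0 p -> Q p) -> psubset (zeros Q) Z.
Proof.
move=> IQ x [x0 Qx]; apply/Z_zeros; split=> // g [Ig hg].
by apply: Qx; split=> //; apply: IQ.
Qed.

Lemma prime_over_core Q (B1 : {set 'I_n.+1}) : prime_ideal Q -> (forall p, I0 p -> Q p) ->
  (forall j, j \in B1 -> Q 'X_j) ->
  (forall k t, t \is k.-homog -> restr B t = t -> Q t -> restr (~: B1) t = 0) ->
  lies_over (graded_core Q) B1.
Proof.
move=> pQ IQ QB1 QT; have [iQ _ _] := pQ.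
have gI : graded I0 by apply: (gen_graded (e := e)) => j _; apply: fh.
split.
- exact: graded_core_hprime.
- exact: sub_graded_core.
- move=> j /QB1; apply: (graded_core_homog (k := 1)) => //.
  by rewrite dhomogX /= mdeg1.
- move=> t rt Qt; rewrite (pihomog_partitionE (mf := mdeg) (leqnn (msize t))).
  rewrite (raddf_sum (restr (~: B1))) big1 // => k _ /=.
  apply: QT (pihomogP _ _ _) _ (Qt k); first by rewrite -hc_restr rt.
Qed.

(** The new prime contains [Q + (X_j)] and avoids the elements of [T] outside [(X_i, i in B2)]. Were
    such an element in [Q + (X_j)], [integral_trick] would give an element of [Q] in [T] whose image
    modulo [(X_i, i in B2)] is a power of a nonzero one. *)
Lemma going_up Q (B1 : {set 'I_n.+1}) j : lies_over Q B1 -> j \in B -> j \notin B1 ->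
  exists Q', lies_over Q' (j |: B1) /\ forall p, Q p -> Q' p.
Proof.
move=> lQ jB jB1; have [[[iQ Qh] Q1 QM] IQ QB1 QT] := lQ.
pose B2 := j |: B1; pose J p := exists q w, Q q /\ p = q + 'X_j * w.
have [Q0 QD QMl] := iQ.
have iJ : ideal J.
  split=> [|a b [q [w [Qq ->]]] [q' [w' [Qq' ->]]]|a b [q [w [Qq ->]]]].
  - by exists 0, 0; rewrite mulr0 addr0.
  - by exists (q + q'), (w + w'); rewrite mulrDr addrACA; split=> //; apply: QD.
  - by exists (a * q), (a * w); rewrite mulrDr mulrCA; split=> //; apply: QMl.
have JQ p : Q p -> J p by exists p, 0; rewrite mulr0 addr0.
have JX : J 'X_j by exists 0, 1; rewrite mulr1 add0r.
pose U (t : S) := restr B t = t /\ restr (~: B2) t != 0.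
have [||a Ja [ra nza]|Q' [pQ' JQ' UQ']] := @prime_avoidance _ J U iJ.
- by split; rewrite rmorph1 // oner_neq0.
- by move=> a b [ra a0] [rb b0]; split; rewrite rmorphM /= ?ra ?rb // mulf_neq0.
- case: Ja => q [w [Qq a_qw]].
  have [|||c [m [rc Qc cm]]] := integral_trick fh ph hB
      (phi := restr (~: B2)) (y := fun _ : unit => 'X_j) (w := fun=> w) (t := a) iQ IQ ra.
  + by move=> _; rewrite restrX jB.
  + by move=> _ /=; rewrite restrX inE setU11.
  + by rewrite big_const card_unit /= addr0 a_qw addrK.
  have : restr (~: B2) c = 0.
    rewrite -(setIidPl (_ : ~: B2 \subset ~: B1)) ?setCS ?subsetUr //.
    by rewrite -restr_restr (QT c rc Qc) raddf0.
  by move/eqP; rewrite cm expf_eq0 (negPf nza) andbF.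
exists (graded_core Q'); split; last first.
  by apply: sub_graded_core => // p /JQ/JQ'.
apply: prime_over_core => //.
- by move=> p /IQ/JQ/JQ'.
- by move=> i; rewrite !inE => /orP[/eqP->|/QB1/JQ/JQ' //]; apply: JQ'.
- move=> k t ht rt Q't; apply/eqP/negPn/negP => t0; apply: UQ' Q't _.
  by split.
Qed.

Lemma irr_chain_mono (Y Y' : pset L n) k C : psubset Y Y' -> irr_chain Y k C -> irr_chain Y' k C.
Proof.
by move=> YY' [CY Cs]; split=> // j /CY[iC CjY]; split=> // x /CjY/YY'.
Qed.

(** Going up kills one more variable [X_j] at each step, and the inclusion is strict because [X_j],
    not being in [Q], does not vanish on all of [zeros Q]. As [B] has [r.+1] elements, the bound
    keeps every set of killed variables proper. *)
Lemma chain_below k Q (B1 : {set 'I_n.+1}) : lies_over Q B1 -> B1 \subset B ->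
  (#|B1| + k <= r)%N -> exists C, irr_chain (zeros Q) k C /\ C k = zeros Q.
Proof.
elim: k Q B1 => [|k IHk] Q B1 lQ sB1 le_r.
  have pB1 : B1 \proper B by rewrite properEcard sB1 cardB; lia.
  exists (fun=> zeros Q); split=> //; split=> // j _; split=> //.
  exact: lies_over_irreducible lQ pB1.
have pB1 : B1 \proper B by rewrite properEcard sB1 cardB; lia.
have [_ [j jB jB1]] := properP pB1.
have [Q' [lQ' QQ']] := going_up lQ jB jB1.
have sB2 : j |: B1 \subset B by rewrite subUset sub1set jB.
have [|C [[CZ Cs] Ck]] := IHk Q' (j |: B1) lQ' sB2.
  by rewrite cardsU1 jB1; lia.
have sub : psubset (zeros Q') (zeros Q).
  by move=> x [x0 Q'x]; split=> // g [Qg hg]; apply: Q'x; split=> //; apply: QQ'.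
have nQ := lies_over_nullstellensatz lQ pB1.
exists (fun i => if (i <= k)%N then C i else zeros Q); rewrite ltnn; split=> //; split.
  move=> i _; case: leqP => [/CZ[iC Ci]|_]; first by split=> // x /Ci/sub.
  by split=> //; apply: lies_over_irreducible lQ pB1.
move=> i; rewrite ltnS => ik; rewrite ik; case: (ltnP i k) => [lt_ik|ki]; first exact: Cs.
have -> : i = k by apply/eqP; rewrite eqn_leq ik.
rewrite Ck; split=> //; apply: boolp.contrapT => nex.
apply: (lies_over_notin lQ jB jB1); apply: (nQ 1%N); first by rewrite dhomogX /= mdeg1.
move=> x Qx; have [Q'x|nQ'x] := boolp.EM (zeros Q' x); last by case: nex; exists x.
have [[gQ' _ _] _ Q'B _] := lQ'.
by have [_] := (zerosP x gQ').1 Q'x; apply; apply: Q'B; rewrite setU11.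
Qed.

(** A form separating each two consecutive ideals of the chain gives, with one more at the bottom,
    [r.+2] forms algebraically independent modulo [I0], against [alg_dependent]. *)
Lemma no_long_chain : ~ exists C, irr_chain Z r.+1 C.
Proof.
move=> [C [CZ Cs]].
(* The irrelevant ideal is put in front of the ideals of the [C i]: it accounts for the affine cone
   having one dimension more. *)
pose P j : S -> Prop := if j is i.+1 then vanishing (C i) else fun p => p@_0%MM = 0.
have irrC j : (j <= r.+1)%N -> proj_irreducible (C j) by move=> /CZ[].
have a_ex j : exists d a, (j <= r.+1)%N -> [/\ a \is d.-homog, P j a & ~ P j.+1 a].
  case: (leqP j r.+1) => [jr|_]; last by exists 0%N, 0.
  case: j jr => [|j] jr.
    have [cC [x Cx] _] := irrC _ jr; have [i xi] := closed_neq0 cC Cx.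
    exists 1%N, 'X_i => _; split; first by rewrite dhomogX /= mdeg1.
      by rewrite /P mcoeffX mnm1_eq0.
    by move=> /vanishing_eval/(_ Cx)/eqP; rewrite mevalXU (negPf xi).
  have [_ [x [Cx nCx]]] := Cs j jr; have [cCj _ _] := irrC j (ltnW jr).
  have [cC _ _] := irrC _ jr.
  have [k [a [ha Ca ax]]] := closed_separate cCj (closed_neq0 cC Cx) nCx.
  exists k, a => _; split=> // /vanishing_eval/(_ Cx) a0.
  by rewrite a0 eqxx in ax.
have [d d_ex] := boolp.choice a_ex; have [a aP] := boolp.choice d_ex.
pose a' j := if (j <= r.+1)%N then a j else 0.
have [|F [F0 FI]] := alg_dependent fh ph hB (a := a') (ea := d).
  by move=> i; rewrite /a'; case: leqP => [/aP[]|_] //; rewrite dhomog0.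
move: F F0 FI; rewrite cardB => F /eqP F0 FI; apply: F0.
have PF : P r.+2 (mmap (@mpolyC _ L) (fun i : 'I_r.+2 => a' i) F).
  have gI : graded I0 by apply: (gen_graded (e := e)) => j _; apply: fh.
  move=> k x /((CZ r.+1 (leqnn _)).2)/Z_zeros/(zerosP x gI)[_]; apply.
  by apply: gI.2.
apply: (alg_indep_chain (P := P) (a := a') (K := r.+2)) PF => //.
- move=> [|j] _; last by case: (vanishing_graded (C j)).
  split=> [|p q p0 q0|p q q0]; rewrite /P ?mcoeff0 ?mcoeffD ?p0 ?q0 ?addr0 //.
  by rewrite -[LHS]/(mcoeff 0%MM (p * q)) rmorphM /= q0 mulr0.
- by move=> j; rewrite ltnS => jr; rewrite /a' jr; case: (aP j jr).
- move=> j g; rewrite ltnS => jr; rewrite /a' jr; have [ha _ nPa] := aP j jr.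
  by apply: (hprime_mulKl _ ha nPa); apply/hprime_vanishing/irrC.
- move=> [|j] g; rewrite ltnS => jr.
    move=> /(_ 0%N) vg; have [_ [x Cx] _] := irrC _ jr.
    have := vg x Cx; rewrite (_ : hc 0 g = (g@_0)%:MP) ?mevalC //.
    apply/mpolyP => m; rewrite mcoeff_hc mcoeffC mdeg_eq0 eq_sym.
    by case: eqP => [->|]; rewrite ?mulr1 ?mulr0.
  exact: sub_vanishing (Cs j jr).1.
- by move=> c; rewrite /P mcoeffC eqxx mulr1.
Qed.

(** The prime avoids all products of an element of [H] and a nonzero form of [T]; by [restr_nzd]
    such a product is in [I0] only if its first factor is. The set [H] allows the prime to be chosen
    below a given one. *)
Lemma minimal_prime (H : S -> Prop) : H 1 -> (forall a b, H a -> H b -> H (a * b)) ->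
  (forall a, H a -> ~ I0 a) -> exists Q, lies_over Q set0 /\
    (forall k p, p \is k.-homog -> Q p -> ~ H p).
Proof.
move=> H1 HM HI.
pose U p := exists a c k, [/\ H a, c != 0, restr B c = c, c \is k.-homog & p = a * c].
have [|||Q [pQ IQ UQ]] := @prime_avoidance _ I0 U (gen_ideal _ _).
- exists 1, 1, 0%N; rewrite mulr1 oner_neq0 rmorph1; split=> //; exact: dhomog1.
- move=> p q [a [c [k [Ha c0 rc hc ->]]]] [b [c' [l [Hb c'0 rc' hc' ->]]]].
  exists (a * b), (c * c'), (k + l)%N; split; first exact: HM.
  + by rewrite mulf_neq0.
  + by rewrite rmorphM /= rc rc'.
  + exact: dhomogM.
  + by rewrite mulrACA.
- move=> p Ip [a [c [k [Ha c0 rc hc p_ac]]]]; apply: (HI a Ha).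
  by apply: (restr_nzd e_gt0 fh ph hB c0 rc hc); rewrite -p_ac.
exists (graded_core Q); have [iQ _ _] := pQ; split.
  apply: prime_over_core => // [j|k t ht rt Qt]; first by rewrite inE.
  rewrite (restr_id (B := B)) ?setC0 ?subsetT //; apply/eqP/negPn/negP => t0.
  by apply: (UQ t Qt); exists 1, t, k; rewrite mul1r.
move=> k p hp /(graded_core_sub iQ) Qp Hp; apply: (UQ p Qp); exists p, 1, 0%N.
by rewrite mulr1 oner_neq0 rmorph1; split=> //; exact: dhomog1.
Qed.

(** Apply [minimal_prime] to the forms that do not vanish identically on [C]. The prime obtained
    lies inside [vanishing C], so its zero set contains [C], and equals it by maximality. *)
Lemma component_lies_over C : irr_component Z C -> lies_over (vanishing C) set0.
Proof.
move=> [iC CZ Cmax]; have hP := hprime_vanishing iC; have [gP P1 PM] := hP.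
pose H p := (exists k, p \is k.-homog) /\ ~ vanishing C p.
have gI : graded I0 by apply: (gen_graded (e := e)) => j _; apply: fh.
have IP p : I0 p -> vanishing C p.
  by move=> Ip k x /CZ/Z_zeros/(zerosP x gI)[_]; apply; apply: gI.2.
have [|||Q [lQ QH]] := @minimal_prime H.
- by split=> //; exists 0%N; apply: dhomog1.
- move=> a b [[k ha] na] [[l hb] nb]; split; first by exists (k + l)%N; apply: dhomogM.
  by case/(PM _ _ _ _ ha hb).
- by move=> a [_ na] /IP.
have pB : set0 \proper B by rewrite properEcard sub0set cards0 cardB.
have [[gQ _ _] IQ _ QT] := lQ; have nQ := lies_over_nullstellensatz lQ pB.
have sub : psubset C (zeros Q).
  move=> x Cx; apply/zerosP => //; have [cC _ _] := iC; split; first exact: closed_neq0 Cx.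
  move=> p Qp; rewrite (pihomog_partitionE (mf := mdeg) (leqnn (msize p))) raddf_sum /=.
  apply: big1 => k _; apply: vanishing_eval Cx; apply: boolp.contrapT => np.
  apply: (QH k (hc k p)); [exact: pihomogP | exact: gQ.2 |].
  by split=> //; exists k; apply: pihomogP.
have QC := Cmax _ (lies_over_irreducible lQ pB) (zeros_sub_Z IQ) sub.
split=> // [j|t rt]; first by rewrite inE.
move=> /(sub_vanishing QC)/(vanishing_zeros gQ nQ); exact: QT.
Qed.

Lemma dim_Z : proj_dim_is Z r.
Proof.
split; last exact: no_long_chain.
have [|||Q [lQ _]] := @minimal_prime (eq 1).
- by [].
- by move=> a b <- <-; rewrite mulr1.
- by move=> a <-; apply: (gen_not1 (e := e)) => j _ //; apply: fh.
have [|C [Cch _]] := chain_below (k := r) lQ (sub0set B); first by rewrite cards0.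
by exists C; apply: irr_chain_mono Cch; apply: zeros_sub_Z; case: lQ.
Qed.

Lemma pure_dim_Z : pure_dim Z r.
Proof.
move=> C cC; have lC := component_lies_over cC; have [iC CZ _] := cC; split; last first.
  by move=> [D /(irr_chain_mono CZ) Dch]; apply: no_long_chain; exists D.
have [|D [Dch _]] := chain_below (k := r) lC (sub0set B); first by rewrite cards0.
exists D; apply: irr_chain_mono Dch => x.
by have [clC _ _] := iC; move/(closed_zeros _ clC).
Qed.

End ProjectiveDimension.

(** * The resultant *)

Lemma eq_mmap (R S : nzRingType) N (f f' : R -> S) (u u' : 'I_N -> S) p :
  f =1 f' -> u =1 u' -> mmap f u p = mmap f' u' p.
Proof.
move=> ff uu; apply: eq_bigr => m _; rewrite ff; congr (_ * _).
by apply: eq_bigr => i _; rewrite uu.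
Qed.

Lemma rmorph_mmap (R S T : nzRingType) N (g : {rmorphism S -> T}) (f : R -> S)
    (u : 'I_N -> S) p : g (mmap f u p) = mmap (g \o f) (g \o u) p.
Proof.
rewrite rmorph_sum; apply: eq_bigr => m _; rewrite rmorphM /=; congr (_ * _).
by rewrite rmorph_prod; apply: eq_bigr => i _; rewrite rmorphXn.
Qed.

Section GenericForms.
Variables (n s : nat) (d : 'I_s -> nat).
Hypotheses (s_gt0 : (0 < s)%N) (ltsn : (s < n)%N) (d_gt0 : forall i, (0 < d i)%N).
Local Notation idx := (Tagged (fun i => monos n (d i))).

Lemma power_mono_subproof k (j : 'I_n.+1) :
  (mdeg (U_(j) *+ k)%MM < k.+1)%N.
Proof. by rewrite mdegMn mdeg1 mul1n. Qed.

Lemma power_mono_subproof2 k (j : 'I_n.+1) :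
  mdeg (BMultinom (power_mono_subproof k j)) == k.
Proof. by rewrite /= mdegMn mdeg1 mul1n. Qed.

Definition power_mono i (j : 'I_n.+1) : monos n (d i) :=
  Sub (BMultinom (power_mono_subproof (d i) j)) (power_mono_subproof2 (d i) j).

Section OverRing.
Variable R : comNzRingType.
Implicit Types (lam : coeff_idx n d -> R) (x : 'I_n.+1 -> R).

Definition geval lam i x : R := \sum_(a : monos n (d i)) lam (idx a) * mmap1 x (val (val a)).

Lemma gen_poly_meval lam i x : (gen_poly lam i).@[x] = geval lam i x.
Proof. by rewrite raddf_sum; apply: eq_bigr => a _; rewrite /= mevalZ /meval mmapX. Qed.

Lemma gen_poly_homog lam i : gen_poly lam i \is (d i).-homog.
Proof.
by apply: rpred_sum => a _; apply: rpredZ; rewrite dhomogX; exact: (valP a).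
Qed.

(* The coefficients of [x_j^d f_i - f_i(x) X_j^d], which vanishes at [x]. *)
Definition force_zero lam j x (c : coeff_idx n d) : R :=
  x j ^+ d (tag c) * lam c - (c == idx (power_mono (tag c) j))%:R * geval lam (tag c) x.

Lemma geval_force_zero lam j x i : geval (force_zero lam j x) i x = 0.
Proof.
rewrite /geval /force_zero /=; under eq_bigr do rewrite mulrBl.
rewrite sumrB; under eq_bigr do rewrite -mulrA.
rewrite -mulr_sumr -/(geval lam i x) (bigD1 (power_mono i j)) //= eqxx mul1r big1 ?addr0.
  rewrite mulrC; apply/eqP; rewrite subr_eq0; apply/eqP; congr (_ * _).
  rewrite /mmap1 (bigD1 j) //= mulmnE mnm1E eqxx mul1n big1 ?mulr1 // => k kj.
  by rewrite mulmnE mnm1E eq_sym (negPf kj) mul0n expr0.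
by move=> a ap; rewrite eq_Tagged /= (negPf ap) !mul0r.
Qed.

Lemma force_zero_id lam j x : x j = 1 -> (forall i, geval lam i x = 0) ->
  force_zero lam j x =1 lam.
Proof. by move=> xj lx c; rewrite /force_zero xj lx expr1n mul1r mulr0 subr0. Qed.

Lemma eq_force_zero lam lam' j x x' : lam =1 lam' -> x =1 x' ->
  force_zero lam j x =1 force_zero lam' j x'.
Proof.
move=> ll xx c; rewrite /force_zero xx ll; congr (_ - _ * _); apply: eq_bigr => a _.
by rewrite ll; congr (_ * _); apply: eq_bigr => i _; rewrite xx.
Qed.

Definition block_of (k : 'I_n.+1) : option 'I_s := insub (val k).

Definition system lam (k : 'I_n.+1) : {mpoly R[n.+1]} :=
  if block_of k is Some i then gen_poly lam i else 'X_k.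

End OverRing.

Definition sdeg (k : 'I_n.+1) : nat := if block_of k is Some i then d i else 1.

Definition emb (i : 'I_s) : 'I_n.+1 := widen_ord (leqW (ltnW ltsn)) i.

Definition last_vars : {set 'I_n.+1} := [set k : 'I_n.+1 | s <= k]%N.

Lemma block_of_emb i : block_of (emb i) = Some i.
Proof.
rewrite /block_of; case: insubP => [j _ ji|]; last by rewrite /= ltn_ord.
by congr Some; apply: val_inj.
Qed.

Lemma block_of_last k : k \in last_vars -> block_of k = None.
Proof. by rewrite inE => sk; rewrite /block_of insubN // -leqNgt. Qed.

Lemma notin_last k : k \notin last_vars -> exists i, k = emb i.
Proof. by rewrite inE -ltnNge => ltk; exists (Ordinal ltk); apply: val_inj. Qed.

Lemma emb_notin i : emb i \notin last_vars.
Proof. by rewrite inE -ltnNge /=. Qed.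

Lemma emb_inj : injective emb.
Proof. by move=> i j [ij]; apply: val_inj. Qed.

Lemma card_last_vars : #|last_vars| = (n - s).+1.
Proof.
have := cardsC last_vars; rewrite card_ord.
have -> : #|~: last_vars| = s.
  rewrite -[RHS]card_ord -(card_imset 'I_s emb_inj); apply: eq_card => k.
  rewrite inE; apply/idP/imsetP => [/notin_last[i ->]|[i _ ->]]; last exact: emb_notin.
  by exists i.
by move: #|_| => c; lia.
Qed.

Lemma sdeg_gt0 k : (0 < sdeg k)%N.
Proof. by rewrite /sdeg; case: block_of. Qed.

Lemma system_emb (R : comNzRingType) (lam : _ -> R) i : system lam (emb i) = gen_poly lam i.
Proof. by rewrite /system block_of_emb. Qed.

Lemma system_last (R : comNzRingType) (lam : _ -> R) k : k \in last_vars -> system lam k = 'X_k.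
Proof. by rewrite /system => /block_of_last->. Qed.

Lemma system_homog (R : comNzRingType) (lam : _ -> R) k : system lam k \is (sdeg k).-homog.
Proof.
rewrite /system /sdeg; case: block_of => [i|]; first exact: gen_poly_homog.
by rewrite dhomogX /= mdeg1.
Qed.

Lemma geval_rmorph (R S : comNzRingType) (g : {rmorphism R -> S}) lam i x :
  g (geval lam i x) = geval (g \o lam) i (g \o x).
Proof.
rewrite rmorph_sum; apply: eq_bigr => a _; rewrite rmorphM /=; congr (_ * _).
by rewrite rmorph_prod; apply: eq_bigr => j _; rewrite rmorphXn.
Qed.

Lemma force_zero_rmorph (R S : comNzRingType) (g : {rmorphism R -> S}) lam j x c :
  g (force_zero lam j x c) = force_zero (g \o lam) j (g \o x) c.
Proof. by rewrite rmorphB !rmorphM rmorphXn rmorph_nat geval_rmorph. Qed.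

Lemma geval_scale (R : comNzRingType) (lam : _ -> R) i r x :
  geval lam i (fun k => r * x k) = r ^+ d i * geval lam i x.
Proof.
rewrite -!gen_poly_meval /meval; exact: (mmap_scale_homog idfun _ _ (gen_poly_homog lam i)).
Qed.

(** * The prime ideal of the resultant *)

Section Vanishing.
Variables (K : fieldType) (L : closedFieldType) (iota : {rmorphism K -> L}).
Local Notation PK := {mpoly K[ncoeffs n d]}.
Implicit Types (A : PK) (lam : coeff_idx n d -> L) (x : 'I_n.+1 -> L).

Definition ceval (R : comNzRingType) (f : {rmorphism K -> R}) A (lam : coeff_idx n d -> R) : R :=
  mmap f (fun j => lam (enum_val j)) A.

Lemma eval_coeffsE A lam : eval_coeffs iota A lam = ceval iota A lam.
Proof.
rewrite /eval_coeffs /ceval /map_mpoly /meval rmorph_mmap; apply: eq_mmap => [c|j] /=.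
  exact: mevalC.
exact: mevalXU.
Qed.

Definition common_zero lam x :=
  [/\ exists j, x j != 0, forall i, geval lam i x = 0 & forall k, k \in last_vars -> x k = 0].

Definition incident_vanishing A := forall lam x, common_zero lam x -> ceval iota A lam = 0.

(** Along a polynomial family of systems, [A] becomes a polynomial in the parameter: nonzero at one
    value, it is nonzero at almost all. *)
Lemma ceval_poly A (lamt : coeff_idx n d -> {poly L}) :
  exists p : {poly L}, forall c, p.[c] = ceval iota A (fun i => (lamt i).[c]).
Proof.
exists (ceval (polyC \o iota) A lamt) => c.
rewrite -[LHS]/(horner_eval c _) /ceval rmorph_mmap; apply: eq_mmap => a //=.
by rewrite /horner_eval hornerC.
Qed.

Lemma eq_ceval (R : comNzRingType) (f : {rmorphism K -> R}) A (u v : coeff_idx n d -> R) :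
  u =1 v -> ceval f A u = ceval f A v.
Proof. by move=> uv; apply: eq_mmap => // j; apply: uv. Qed.

Lemma common_zero_scale lam x j : common_zero lam x -> x j != 0 ->
  exists2 y, common_zero lam y & y j = 1.
Proof.
move=> [_ lx xl] xj; exists (fun k => (x j)^-1 * x k); last by rewrite mulVf.
split=> [|i|k kl]; first by exists j; rewrite mulVf ?oner_neq0.
  by rewrite geval_scale lx mulr0.
by rewrite (xl k kl) mulr0.
Qed.

(** Add [c] to the coordinate [x_0] and let [force_zero] correct the system. Nothing changes at
    [c = 0], so for generic [c] both [A] and the coordinate are nonzero. *)
Lemma common_zero_ord0 A lam x : common_zero lam x -> ceval iota A lam != 0 ->
  exists lam' x', [/\ common_zero lam' x', x' ord0 = 1 & ceval iota A lam' != 0].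
Proof.
move=> cz Al; have [x0|x0] := eqVneq (x ord0) 0; last first.
  by have [y cy y0] := common_zero_scale cz x0; exists lam, y.
have [[j xj0] _ _] := cz; have [y cy yj] := common_zero_scale cz xj0.
have j0 : (ord0 == j) = false by apply: contraNF xj0 => /eqP<-; rewrite x0.
pose yt (k : 'I_n.+1) : {poly L} := (y k)%:P + (k == ord0)%:R *: 'X.
pose lamt := force_zero (fun c => (lam c)%:P) j yt.
have [p pE] := ceval_poly A lamt.
have ytE c k : (yt k).[c] = y k + (k == ord0)%:R * c by rewrite !hornerE.
have ytj c : (yt j).[c] = 1 by rewrite ytE yj eq_sym j0 mul0r addr0.
have lamtE c : (fun i => (lamt i).[c]) =1 force_zero lam j (fun k => (yt k).[c]).
  move=> i; rewrite -[LHS]/(horner_eval c _) force_zero_rmorph; apply: eq_force_zero => // l.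
  by rewrite /= /horner_eval hornerC.
have [_ ly yl] := cy.
have p0 : p.[0] != 0.
  rewrite pE (eq_ceval _ _ (lamtE 0)) (eq_ceval _ _ (_ : _ =1 lam)) //.
  have y0 : (fun k => (yt k).[0]) =1 y by move=> k; rewrite ytE mulr0 addr0.
  by move=> c; rewrite (eq_force_zero _ (frefl lam) y0) force_zero_id.
have /closed_nonrootP[c] : p * ('X + (y ord0)%:P) != 0.
  rewrite mulf_neq0 //; last by rewrite -size_poly_eq0 size_XaddC.
  by apply: contraNneq p0 => ->; rewrite horner0.
rewrite rootE hornerM mulf_eq0 negb_or => /andP[pc c0].
have czc : common_zero (force_zero lam j (fun k => (yt k).[c])) (fun k => (yt k).[c]).
  split=> [|i|k kl]; [by exists j; rewrite ytj oner_neq0 | exact: geval_force_zero |].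
  rewrite ytE yl // add0r; have [k0|] := eqVneq k ord0; last by rewrite mul0r.
  by move: kl; rewrite k0 inE leqNgt s_gt0.
have y0c : (yt ord0).[c] != 0.
  by move: c0; rewrite hornerD hornerX hornerC ytE eqxx mul1r addrC.
have [z cz' z0] := common_zero_scale czc y0c.
exists (force_zero lam j (fun k => (yt k).[c])), z; split=> //.
by rewrite -(eq_ceval _ _ (lamtE c)) -pE.
Qed.

(** Join two witnesses with [x_0 = 1] by a segment. As [x_0] stays 1, [force_zero] makes every
    system on it incident and leaves both ends unchanged; [A] and [A'] become nonzero polynomials in
    the parameter, with a common nonroot. *)
Lemma incident_vanishing_prime A A' :
  incident_vanishing (A * A') -> incident_vanishing A \/ incident_vanishing A'.
Proof.
move=> AA'; apply: boolp.contrapT => /boolp.not_orP[nA nA'].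
have wit A1 : ~ incident_vanishing A1 -> exists lam x,
    [/\ common_zero lam x, x ord0 = 1 & ceval iota A1 lam != 0].
  move=> nA1; apply: boolp.contrapT => nex; apply: nA1 => lam x cz; apply/eqP/negPn/negP => A1l.
  have [lam' [x' [cz' x'0 A1l']]] := common_zero_ord0 cz A1l.
  by apply: nex; exists lam', x'.
have [lam [x [[_ lx xl] x0 Al]]] := wit A nA.
have [lam' [x' [[_ lx' xl'] x'0 Al']]] := wit A' nA'.
pose xt (k : 'I_n.+1) : {poly L} := (1 - 'X) * (x k)%:P + 'X * (x' k)%:P.
pose mu c : {poly L} := (1 - 'X) * (lam c)%:P + 'X * (lam' c)%:P.
pose lamt := force_zero mu ord0 xt.
have xtE c k : (xt k).[c] = (1 - c) * x k + c * x' k by rewrite !hornerE.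
have muE c i : (mu i).[c] = (1 - c) * lam i + c * lam' i by rewrite !hornerE.
have xt0 c : (xt ord0).[c] = 1 by rewrite xtE x0 x'0 !mulr1 subrK.
have lamtE c : (fun i => (lamt i).[c]) =1
    force_zero (fun i => (mu i).[c]) ord0 (fun k => (xt k).[c]).
  by move=> i; rewrite -[LHS]/(horner_eval c _) force_zero_rmorph.
have [p pE] := ceval_poly A lamt; have [q qE] := ceval_poly A' lamt.
have p0 : p.[0] != 0.
  rewrite pE (eq_ceval _ _ (lamtE 0)) (eq_ceval _ _ (_ : _ =1 lam)) // => c.
  have mu_c : (fun i => (mu i).[0]) =1 lam by move=> i; rewrite muE subr0 mul1r mul0r addr0.
  have xt_c : (fun k => (xt k).[0]) =1 x by move=> k; rewrite xtE subr0 mul1r mul0r addr0.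
  by rewrite (eq_force_zero _ mu_c xt_c) force_zero_id.
have q1 : q.[1] != 0.
  rewrite qE (eq_ceval _ _ (lamtE 1)) (eq_ceval _ _ (_ : _ =1 lam')) // => c.
  have mu_c : (fun i => (mu i).[1]) =1 lam' by move=> i; rewrite muE subrr mul1r mul0r add0r.
  have xt_c : (fun k => (xt k).[1]) =1 x' by move=> k; rewrite xtE subrr mul1r mul0r add0r.
  by rewrite (eq_force_zero _ mu_c xt_c) force_zero_id.
have /closed_nonrootP[c] : p * q != 0.
  rewrite mulf_neq0 //; first by apply: contraNneq p0 => ->; rewrite horner0.
  by apply: contraNneq q1 => ->; rewrite horner0.
case/negP; rewrite rootE hornerM pE qE; apply/eqP.
have -> : forall u, ceval iota A u * ceval iota A' u = ceval iota (A * A') u.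
  by move=> u; rewrite /ceval rmorphM.
rewrite (eq_ceval _ _ (lamtE c)); apply: (AA' _ (fun k => (xt k).[c])).
split=> [|i|k kl]; [by exists ord0; rewrite xt0 oner_neq0 | exact: geval_force_zero |].
by rewrite xtE xl // xl' // !mulr0 addr0.
Qed.

Lemma incident_vanishing0 c : incident_vanishing c%:MP -> c = 0.
Proof.
move=> cv; apply/eqP; rewrite -(fmorph_eq0 iota); apply/eqP.
rewrite -(cv (fun=> 0) (fun k => (k == ord0)%:R)); first by rewrite /ceval mmapC.
split=> [|i|k kl]; first by exists ord0; rewrite eqxx oner_neq0.
  by rewrite /geval big1 // => a _; rewrite mul0r.
by have [k0|//] := eqVneq k ord0; move: kl; rewrite k0 inE leqNgt s_gt0.
Qed.

Lemma incident_vanishingD u v A A' : incident_vanishing A -> incident_vanishing A' ->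
  incident_vanishing (u * A + v * A').
Proof.
move=> vA vA' lam x cz; rewrite /ceval rmorphD !rmorphM /= -/(ceval iota A lam).
by rewrite -/(ceval iota A' lam) (vA _ _ cz) (vA' _ _ cz) !mulr0 addr0.
Qed.

End Vanishing.

(** * Macaulay's matrix and its determinant *)

Section Macaulay.
Variable i0 : 'I_s.

(** The least degree in which every monomial is divisible by some [X_k ^ sdeg k]. *)
Definition mac_deg := (\sum_k (sdeg k).-1).+1.
Local Notation t := mac_deg.

(* The lowest priority is given to [i0], so that at most [prod_(k <> i0) d_k] rows of
   Macaulay's matrix [mac] below involve the coefficients of [F_i0]. *)
Definition assigned (m : 'X_{1..n.+1}) : 'I_n.+1 :=
  odflt (emb i0) [pick k | (k != emb i0) && (sdeg k <= m k)%N].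

Lemma assigned_le m : mdeg m = t -> (sdeg (assigned m) <= m (assigned m))%N.
Proof.
rewrite /assigned; case: pickP => [k /andP[] //|nk] mt /=.
rewrite leqNgt; apply/negP => lt0; suff : (t <= \sum_k (sdeg k).-1)%N by rewrite ltnn.
rewrite -mt mdegE; apply: leq_sum => k _.
have ltk : (m k < sdeg k)%N.
  by have [->//|ki] := eqVneq k (emb i0); have := nk k; rewrite ki /= ltnNge => ->.
by rewrite -ltnS prednK ?sdeg_gt0.
Qed.

Section OverRing.
Variable R : comNzRingType.
Implicit Types (lam : coeff_idx n d -> R).

Definition mac_row lam (m : 'X_{1..n.+1}) : {mpoly R[n.+1]} :=
  'X_[m - U_(assigned m) *+ sdeg (assigned m)] * system lam (assigned m).

Definition mac lam : 'M[R]_(nmonos n t) :=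
  \matrix_(a, b) (mac_row lam (mono_of a))@_(mono_of b).

Lemma mac_split m : mdeg m = t ->
  (m - U_(assigned m) *+ sdeg (assigned m) + U_(assigned m) *+ sdeg (assigned m))%MM = m.
Proof.
move=> /assigned_le am; apply: submK; apply/mnm_lepP => k; rewrite mulmnE mnm1E.
by case: eqP => [<-|_]; rewrite ?mul1n ?mul0n.
Qed.

Lemma mac_row_homog lam m : mdeg m = t -> mac_row lam m \is t.-homog.
Proof.
move=> mt; have := congr1 mdeg (mac_split mt); rewrite mdegD mdegMn mdeg1 mul1n mt => <-.
by apply: dhomogM; [rewrite dhomogX | apply: system_homog].
Qed.

End OverRing.

Lemma mac_rmorph (R S : comNzRingType) (g : {rmorphism R -> S}) lam :
  map_mx g (mac lam) = mac (g \o lam).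
Proof.
apply/matrixP => a b; rewrite !mxE -mcoeff_map_mpoly; congr (_@_ _).
rewrite rmorphM /= map_mpolyX; congr (_ * _); rewrite /system.
case: block_of => [i|]; last by rewrite map_mpolyX.
rewrite raddf_sum; apply: eq_bigr => c _ /=; by rewrite map_mpolyZ map_mpolyX.
Qed.

(** The values at [x] of the monomials of degree [t] form a kernel vector, nonzero because of its
    entry [x_j ^ t]. *)
Lemma mac_common_zero (L : closedFieldType) lam (x : 'I_n.+1 -> L) :
  common_zero lam x -> \det (mac lam) = 0.
Proof.
move=> [[j xj] lx xl]; have sx k : (system lam k).@[x] = 0.
  case: (boolP (k \in last_vars)) => [kl|/notin_last[i ->]].
    by rewrite system_last // mevalXU xl.
  by rewrite system_emb gen_poly_meval.
apply/eqP/negPn/negP => dM.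
have MU : mac lam \in unitmx by rewrite unitmxE unitfE.
pose v : 'cV[L]_(nmonos n t) := \col_b ('X_[mono_of b] : {mpoly L[n.+1]}).@[x].
have Mv : mac lam *m v = 0.
  apply/matrixP => a z; rewrite ord1 !mxE.
  have := poly_rowK (mac_row_homog lam (mdeg_mono_of a)) => rowE.
  have : (mac_row lam (mono_of a)).@[x] = 0 by rewrite mevalM sx mulr0.
  rewrite -rowE raddf_sum /= => sum0; rewrite -[RHS]sum0; apply: eq_bigr => b _.
  by rewrite mevalZ !mxE.
have v0 : v = 0 by rewrite -[v]mul1mx -(mulVmx MU) -mulmxA Mv mulmx0.
have [|b mb] := @mono_ofP n t (U_(j) *+ t)%MM; first by rewrite mdegMn mdeg1 mul1n.
have /eqP := congr1 (fun u : 'cV[L]__ => u b 0) v0; rewrite !mxE -mb -mpolyXn rmorphXn /= mevalXU.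
by rewrite expf_eq0 (negPf xj) andbF.
Qed.

(** For the system of pure powers each row reproduces its own monomial; this specialization shows
    that the generic determinant is nonzero. *)
Lemma mac_monomials (R : comNzRingType) :
  mac (fun c => (c == idx (power_mono (tag c) (emb (tag c))))%:R : R) = 1%:M.
Proof.
set lam0 := fun c => _; have sys k : system lam0 k = 'X_k ^+ sdeg k.
  case: (boolP (k \in last_vars)) => [kl|/notin_last[i ->]].
    by rewrite system_last // /sdeg block_of_last.
  rewrite system_emb /sdeg block_of_emb /gen_poly (bigD1 (power_mono i (emb i))) //= /lam0 /= eqxx.
  rewrite scale1r big1 ?addr0 ?mpolyXn // => a ai.
  by rewrite eq_Tagged /= (negPf ai) scale0r.
apply/matrixP => a b; rewrite !mxE /mac_row sys mpolyXn -mpolyXD mac_split ?mdeg_mono_of //.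
by rewrite mcoeffX (inj_eq (@mono_of_inj _ _)).
Qed.

(** A monomial assigned to [emb i0] has exponent less than [sdeg k] at every other [k], thus 0 at
    the last variables, and its degree determines the remaining exponent. *)
Lemma card_assigned : (#|[pred a : 'I_(nmonos n t) | assigned (mono_of a) == emb i0]| <=
  (\prod_(i < s) d i) %/ d i0)%N.
Proof.
pose F (k : 'I_n.+1) : pred 'I_t.+1 := [pred v : 'I_t.+1 | if k == emb i0 then v == ord0 else (v < sdeg k)%N].
pose phi (a : 'I_(nmonos n t)) : {ffun 'I_n.+1 -> 'I_t.+1} :=
  [ffun k => if k == emb i0 then ord0 else inord (mono_of a k)].
have le_t a k : (mono_of (n := n) (k := t) a k <= t)%N.
  by rewrite -[X in (_ <= X)%N](mdeg_mono_of a) mdegE (bigD1 k) //= leq_addr.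
have phi_inj : injective phi.
  move=> a b /ffunP eq_ab; apply: mono_of_inj.
  have eq_off k : k != emb i0 -> mono_of a k = mono_of b k.
    move=> ki; have := eq_ab k; rewrite !ffunE (negPf ki) => /(congr1 val) /=.
    by rewrite !inordK // ltnS.
  apply/mnmP => k; have [->|] := eqVneq k (emb i0); last exact: eq_off.
  have := etrans (mdeg_mono_of a) (esym (mdeg_mono_of b)); rewrite !mdegE.
  rewrite (bigD1 (emb i0)) //= [in RHS](bigD1 (emb i0)) //=.
  by rewrite (eq_bigr (fun k => mono_of b k)) // => /addIn.
set X := [pred a | _]; rewrite -(card_image phi_inj X).
have -> : ((\prod_(i < s) d i) %/ d i0 = #|family F|)%N.
  rewrite (bigD1 i0) //= mulKn // card_family foldrE big_map big_enum /=.
  have F1 k : k \in last_vars -> #|F k| = 1%N.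
    move=> kl; have ki : (k == emb i0) = false by apply: contraTF kl => /eqP->; apply: emb_notin.
    rewrite (eq_card (B := pred1 ord0)) ?card1 // => v.
    by rewrite !inE ki /sdeg block_of_last // ltnS leqn0 -val_eqE.
  have Fd i : #|F (emb i)| = if i == i0 then 1%N else d i.
    case: eqP => [->|/eqP ii0].
      by rewrite (eq_card (B := pred1 ord0)) ?card1 // => v; rewrite !inE eqxx.
    have le_dt : (d i <= t.+1)%N.
      rewrite /mac_deg (bigD1 (emb i)) //= /sdeg block_of_emb.
      by move: (\sum_(_ < _ | _) _)%N => z; have := d_gt0 i; lia.
    rewrite -[RHS]card_ord -(card_image (f := widen_ord le_dt)); last first.
      by move=> u v [uv]; apply: val_inj.
    apply: eq_card => v; rewrite !inE (inj_eq emb_inj) (negPf ii0) /sdeg block_of_emb.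
    apply/idP/imageP => [ltv|[u _ ->] /=]; last exact: ltn_ord.
    by exists (Ordinal ltv) => //; apply: val_inj.
  rewrite [RHS](bigID (mem last_vars)) /= [X in _ = (X * _)%N]big1 ?mul1n //.
  rewrite [RHS](reindex_omap emb block_of) => [|k /notin_last[i ->]]; last first.
    by rewrite block_of_emb.
  rewrite [RHS](eq_bigl predT) => [|i]; last by rewrite emb_notin block_of_emb eqxx.
  rewrite [RHS](bigD1 i0) //= Fd eqxx mul1n; apply: eq_bigr => i ii0.
  by rewrite Fd (negPf ii0).
apply: subset_leq_card; apply/subsetP => _ /imageP[a aX ->]; apply/familyP => k.
rewrite !inE ffunE; have [//|ki] := eqVneq k (emb i0).
rewrite inordK ?ltnS //; move: aX; rewrite inE /assigned; case: pickP => [k' /andP[k'i _]|nk _].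
  by rewrite /= (negPf k'i).
by have := nk k; rewrite ki /= ltnNge => ->.
Qed.

Definition mac_det (K : fieldType) : {mpoly K[ncoeffs n d]} :=
  \det (mac (fun c => 'X_(enum_rank c) : {mpoly K[ncoeffs n d]})).

Lemma mac_det_ceval (K : fieldType) (R : comNzRingType) (f : {rmorphism K -> R})
    (lam : coeff_idx n d -> R) : ceval f (mac_det K) lam = \det (mac lam).
Proof.
rewrite /ceval /mac_det -det_map_mx mac_rmorph; congr (\det (mac _)).
by apply: boolp.funext => c; rewrite /= mmapX mmap1U enum_rankK.
Qed.

Lemma mac_det_neq0 (K : fieldType) : mac_det K != 0.
Proof.
have := mac_det_ceval idfun (fun c => (c == idx (power_mono (tag c) (emb (tag c))))%:R : K).
rewrite mac_monomials det1 => D1; apply: contraTneq (oner_neq0 K) => D0.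
by rewrite negbK -D1 D0 /ceval mmap0.
Qed.

Lemma mac_det_vanishing (K : fieldType) (L : closedFieldType) (iota : {rmorphism K -> L}) :
  incident_vanishing iota (mac_det K).
Proof. by move=> lam x cz; rewrite mac_det_ceval (mac_common_zero cz). Qed.

End Macaulay.

(** * Degrees in one block of coefficients *)

Section BlockDegree.
Variables (K : fieldType) (i : 'I_s).
Local Notation PK := {mpoly K[ncoeffs n d]}.
Implicit Types (p q : PK).

(* [block_scale p] is [p] with the coefficients of [F_i] multiplied by a new variable. *)
Definition block_scale : PK -> {poly PK} :=
  mmap (polyC \o @mpolyC _ K) (fun j => ('X_j)%:P * 'X ^+ (var_block j == i)).

HB.instance Definition _ := GRing.RMorphism.copy block_scale block_scale.

Definition block_deg (m : 'X_{1..ncoeffs n d}) : nat :=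
  \sum_(j < ncoeffs n d | var_block j == i) m j.

Lemma block_scaleE p :
  block_scale p = \sum_(m <- msupp p) (p@_m *: 'X_[m])%:P * 'X ^+ block_deg m.
Proof.
apply: eq_bigr => m _; rewrite /= -mul_mpolyC polyCM -mulrA; congr (_ * _).
rewrite /mmap1; under eq_bigr do rewrite exprMn -exprM.
rewrite big_split /= prodrXr mpolyXE_id rmorph_prod; congr (_ * 'X ^+ _).
  by apply: eq_bigr => j _; rewrite rmorphXn.
rewrite /block_deg [RHS]big_mkcond; apply: eq_bigr => j _.
by case: eqP; rewrite ?mul1n ?mul0n.
Qed.

Lemma block_scale1 p : (block_scale p).[1] = p.
Proof.
rewrite block_scaleE horner_sum [RHS]mpolyE; apply: eq_bigr => m _.
by rewrite hornerM hornerC hornerXn expr1n mulr1.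
Qed.

Lemma block_scale_deg p k : block_scale p = p%:P * 'X ^+ k ->
  forall m, m \in msupp p -> block_deg m = k.
Proof.
move=> pk m mp; have := congr1 (fun r : {poly PK} => r`_(block_deg m)@_m) pk.
rewrite block_scaleE coef_sum raddf_sum /= coefCM coefXn.
rewrite (bigD1_seq m) ?msupp_uniq //= coefCM coefXn eqxx mulr1 mcoeffZ mcoeffX eqxx mulr1.
rewrite big1 ?addr0 => [|m' m'm]; last first.
  rewrite coefCM coefXn mulr_natr mcoeffMn mcoeffZ mcoeffX (negPf m'm) mulr0.
  by rewrite mul0rn.
case: eqP => // _; rewrite mulr0 mcoeff0 => /eqP.
by rewrite mcoeff_eq0 mp.
Qed.

End BlockDegree.

(** Peel off ['X] from whichever factor vanishes at 0. Through [block_scale], homogeneity in a block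
    passes to divisors. *)
Lemma polyX_factor (A : idomainType) (p q : {poly A}) c k : c != 0 -> p * q = c%:P * 'X ^+ k ->
  exists a l, p = a%:P * 'X ^+ l /\ (l <= k)%N.
Proof.
move=> c0; elim: k p q => [|k IHk] p q pq.
  have : size (p * q) == 1%N by rewrite pq expr0 mulr1 size_polyC c0.
  by rewrite size_mul_eq1 => /andP[/size_poly1P[a _ ->] _]; exists a, 0%N; rewrite expr0 mulr1.
have : (p * q).[0] = 0 by rewrite pq hornerM hornerXn expr0n mulr0.
rewrite hornerM => /eqP; rewrite mulf_eq0 -!rootE => /orP[] /factor_theorem[r].
  rewrite polyC0 subr0 => p_r; have [|a [l [r_a le_lk]]] := IHk r q.
    by apply: (mulIf (negbT (polyX_eq0 A))); rewrite mulrAC -p_r pq exprSr mulrA.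
  by exists a, l.+1; rewrite p_r r_a exprSr mulrA.
rewrite polyC0 subr0 => q_r; have [|a [l [p_a le_lk]]] := IHk p r.
  by apply: (mulIf (negbT (polyX_eq0 A))); rewrite -mulrA -q_r pq exprSr mulrA.
by exists a, l; split=> //; apply: leqW.
Qed.

Lemma block_scale_factor (K : fieldType) i (p q D : {mpoly K[ncoeffs n d]}) k : D != 0 ->
  D = p * q -> block_scale i D = D%:P * 'X ^+ k ->
  exists2 l, (l <= k)%N & block_scale i p = p%:P * 'X ^+ l.
Proof.
move=> D0 D_pq Dk; have pq : block_scale i p * block_scale i q = D%:P * 'X ^+ k.
  by rewrite -Dk D_pq rmorphM.
have [a [l [pa le_lk]]] := polyX_factor D0 pq; exists l; first exact: le_lk.
have ap : a = p by rewrite -(block_scale1 i p) pa hornerM hornerC hornerXn expr1n mulr1.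
by move: pa; rewrite ap.
Qed.

(** Scaling the block [i] multiplies exactly the rows built from [F_i] by the new variable. *)
Lemma mac_det_block_scale (K : fieldType) (i0 i : 'I_s) :
  block_scale i (mac_det i0 K) = (mac_det i0 K)%:P *
    'X ^+ #|[pred a : 'I_(nmonos n mac_deg) | assigned i0 (mono_of a) == emb i]|.
Proof.
set gl := fun c => 'X_(enum_rank c) : {mpoly K[ncoeffs n d]}.
rewrite {1}/mac_det -det_map_mx mac_rmorph mulrC.
have -> : (mac_det i0 K)%:P = \det (mac i0 (fun c => (gl c)%:P)).
  by rewrite /mac_det -det_map_mx mac_rmorph.
pose dv : 'rV[{poly {mpoly K[ncoeffs n d]}}]_(nmonos n mac_deg) :=
  \row_a 'X ^+ (assigned i0 (mono_of a) == emb i).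
have -> : mac i0 (block_scale i \o gl) = diag_mx dv *m mac i0 (fun c => (gl c)%:P).
  apply/matrixP => a b; rewrite mul_diag_mx !mxE -mcoeffCM; congr (_@_ _).
  rewrite /mac_row mulrCA; congr (_ * _).
  case: (boolP (assigned i0 (mono_of a) \in last_vars)) => [kl|/notin_last[j ->]].
    rewrite !system_last //; case: eqP => [k_i|_]; last by rewrite expr0 mpolyC1 mul1r.
    by rewrite k_i (negPf (emb_notin i)) in kl.
  rewrite !system_emb (inj_eq emb_inj) /gen_poly mulr_sumr; apply: eq_bigr => c _.
  rewrite mul_mpolyC scalerA; congr (_ *: _).
  by rewrite /= /block_scale mmapX mmap1U /var_block enum_rankK mulrC.
rewrite det_mulmx det_diag; congr (_ * _).
under eq_bigr do rewrite mxE.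
by rewrite prodrXr -big_mkcond sum1_card.
Qed.

(** * The resultant and systems where it does not vanish *)

Section Resultant.
Variables (K : fieldType) (L : closedFieldType) (iota : {rmorphism K -> L}).
Local Notation PK := {mpoly K[ncoeffs n d]}.
Implicit Types (A D : PK) (lam : coeff_idx n d -> L) (x : 'I_n.+1 -> L).

Local Notation i00 := (Ordinal s_gt0).
Local Notation c00 := (idx (power_mono i00 ord0)).

Lemma emb_i00 : emb i00 = ord0.
Proof. exact: val_inj. Qed.

Lemma ceval_free j A lam lam' : free_of j A ->
  (forall l, l != j -> lam (enum_val l) = lam' (enum_val l)) -> ceval iota A lam = ceval iota A lam'.
Proof.
move=> fA ll; rewrite /ceval /mmap !big_seq; apply: eq_bigr => m /fA mj; congr (_ * _).
by apply: eq_bigr => l _; have [->|/ll->//] := eqVneq l j; rewrite mj !expr0.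
Qed.

Lemma gen_poly_segment lam lam' c i :
  gen_poly (fun a => (1 - c) * lam a + c * lam' a) i = (1 - c) *: gen_poly lam i + c *: gen_poly lam' i.
Proof.
rewrite /gen_poly !scaler_sumr -big_split /=; apply: eq_bigr => a _.
by rewrite [LHS]scalerDl !scalerA.
Qed.

(* For generic coefficients the forms [F_i], [i <> 0], have a common zero with [x_0 =
   1] and vanishing last coordinates; the coefficient of [X_0^(d_0)] in [F_0] can then
   be adjusted to make [F_0] vanish there too. *)
Lemma incident_vanishing_free A :
  incident_vanishing iota A -> free_of (enum_rank c00) A -> A = 0.
Proof.
move=> vA fA; apply/eqP/negPn/negP => A0.
have [v Av] : exists v, (map_mpoly iota A).@[v] != 0.
  apply: mpoly_nonroot; apply: contra A0 => /eqP iA; apply/eqP/mpolyP => m.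
  by apply: (fmorph_inj iota); rewrite -mcoeff_map_mpoly iA !mcoeff0 rmorph0.
pose lam1 (c : coeff_idx n d) := v (enum_rank c).
have Al1 : ceval iota A lam1 != 0.
  rewrite -eval_coeffsE /eval_coeffs; apply: contra Av => /eqP<-; apply/eqP/meval_eq => j.
  by rewrite /lam1 enum_valK.
pose lam0 (c : coeff_idx n d) : L := (c == idx (power_mono (tag c) (emb (tag c))))%:R.
(* With [F_0] replaced by [X_0], the other forms get a common zero above the point
   [(1, 0, ..., 0)]. *)
pose e' k := if k == ord0 then 1%N else sdeg k.
pose sys lam k : {mpoly L[n.+1]} := if k == ord0 then 'X_k else system lam k.
have e'0 k : (0 < e' k)%N by rewrite /e'; case: eqP => // _; apply: sdeg_gt0.
have fsys lam : forms e' (sys lam).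
  move=> k; rewrite /sys /e'; case: eqP => _; first by rewrite dhomogX /= mdeg1.
  exact: system_homog.
have sys0 k : sys lam0 k = 'X_k ^+ e' k.
  rewrite /sys /e'; case: eqP => [->|_]; first by rewrite expr1.
  case: (boolP (k \in last_vars)) => [kl|/notin_last[i ->]].
    by rewrite system_last // /sdeg block_of_last.
  rewrite system_emb /sdeg block_of_emb /gen_poly (bigD1 (power_mono i (emb i))) //= /lam0 /= eqxx.
  rewrite scale1r big1 ?addr0 ?mpolyXn // => a ai.
  by rewrite eq_Tagged /= (negPf ai) scale0r.
have psys0 : param_system (sys lam0).
  move=> j; have [k hk] := param_system_monomials L e' j.
  by exists k; apply: eq_gen hk => l _; rewrite sys0.
(* The segment starts at pure powers, a finite system, and ends where [A] is nonzero; a generic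
   point of it has both properties. *)
have [p [p0 pP]] := param_system_open (fsys lam0) (fsys lam1) psys0.
pose lamt c : {poly L} := (1 - 'X) * (lam0 c)%:P + 'X * (lam1 c)%:P.
have lamtE c a : (lamt a).[c] = (1 - c) * lam0 a + c * lam1 a by rewrite !hornerE.
have [q qE] := ceval_poly iota A lamt.
have q1 : q.[1] != 0.
  rewrite qE (eq_ceval _ _ (_ : _ =1 lam1)) // => a.
  by rewrite lamtE subrr mul0r mul1r add0r.
have /closed_nonrootP[c] : p * q != 0.
  rewrite mulf_neq0 //; first by apply: contraNneq p0 => ->; rewrite horner0.
  by apply: contraNneq q1 => ->; rewrite horner0.
rewrite rootE hornerM mulf_eq0 negb_or => /andP[/pP psys qc].
pose lam a := (1 - c) * lam0 a + c * lam1 a.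
have {}psys : param_system (sys lam).
  move=> j; have [k hk] := psys j; exists k; apply: eq_gen hk => l _.
  rewrite /sys; case: eqP => _; first by rewrite -scalerDl subrK scale1r.
  case: (boolP (l \in last_vars)) => [ll|/notin_last[i ->]].
    by rewrite !system_last // -scalerDl subrK scale1r.
  by rewrite !system_emb gen_poly_segment.
have Al : ceval iota A lam != 0.
  by apply: contra qc => /eqP Al; rewrite qE (eq_ceval _ _ (_ : _ =1 lam)) ?Al // => a; rewrite lamtE.
pose B := ord0 |: last_vars; pose I0 := gen (sys lam) (~: B).
have hB j : j \in B -> sys lam j = 'X_j.
  by rewrite inE in_set1 /sys; case: eqP => //= _ /system_last->.
have I01 : ~ I0 1 by apply: (gen_not1 (e := e')) => j _ //; apply: fsys.
have gI0 : graded I0 by apply: (gen_graded (e := e')) => j _; apply: fsys.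
have TI0 t : restr B t = t -> I0 t -> t = 0.
  move=> rt It; rewrite (pihomog_partitionE (mf := mdeg) (leqnn (msize t))) big1 // => k _.
  apply/eqP/negPn/negP => t0; apply: I01.
  apply: (restr_nzd e'0 (fsys lam) psys hB t0 _ (pihomogP _ _ _)); first by rewrite -hc_restr rt.
  by rewrite mul1r; apply: gI0.2.
have [|x [xB Ix]] := lying_over (fsys lam) psys hB (J := I0) (p := fun k => (k == ord0)%:R)
  gI0.1 (fun g Ig => Ig).
  by move=> t rt /(TI0 t rt)->; rewrite meval0.
have x0 : x ord0 = 1 by rewrite xB ?eqxx // setU11.
have xl k : k \in last_vars -> x k = 0.
  move=> kl; rewrite xB; last by rewrite inE kl orbT.
  case: eqP => [k0|_]; last exact: mulr0n.
  by rewrite k0 inE leqNgt s_gt0 in kl.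
have lx i : i != i00 -> geval lam i x = 0.
  move=> ii; rewrite -gen_poly_meval -system_emb.
  have i0 : (emb i == ord0) = false by rewrite -emb_i00 (inj_eq emb_inj) (negPf ii).
  have -> : system lam (emb i) = sys lam (emb i) by rewrite /sys i0.
  by apply/Ix/gen_mem; rewrite !inE i0 /= -ltnNge.
(* Since the other forms already vanish at [x] and [x_0 = 1], [force_zero] alters only the
   coefficient [c00], of which [A] is free. *)
case/negP: Al; apply/eqP; rewrite (ceval_free (lam' := force_zero lam ord0 x) fA) => [|l ll].
  apply: (vA _ x); split=> [|i|//]; first by exists ord0; rewrite x0 oner_neq0.
  exact: geval_force_zero.
rewrite /force_zero x0 expr1n mul1r; set a := enum_val l.
have [ai|/lx->] := eqVneq (tag a) i00; last by rewrite mulr0 subr0.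
case: eqP => [a_eq|_]; last by rewrite mul0r subr0.
by case/eqP: ll; rewrite -[l]enum_valK -/a a_eq ai.
Qed.

Lemma resultant_exists (i : 'I_s) : exists R : PK, [/\ R != 0, incident_vanishing iota R
  & forall D, incident_vanishing iota D -> divides R D].
Proof.
have [|m [[R [R0 vR mR]] mmin]] := @ex_least (fun m => exists R : PK,
    [/\ R != 0, incident_vanishing iota R & msize R = m]).
  exists (msize (mac_det i K)), (mac_det i K); split=> //; first exact: mac_det_neq0.
  exact: mac_det_vanishing.
have small b c : R = b * c -> incident_vanishing iota b -> c \is a GRing.unit.
  move=> R_bc vb; have [b0 c0] : b != 0 /\ c != 0.
    by apply/andP; rewrite -negb_or -mulf_eq0 -R_bc.
  rewrite -(mpoly_unit_degree K _).2 //.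
  have : (m <= msize b)%N by apply: mmin; exists b.
  rewrite -mR R_bc msizeM // (mpolySpred mdeg b0) (mpolySpred mdeg c0) /=.
  by rewrite addnS /=; lia.
have iR : irred R.
  split=> // [|b c R_bc].
    rewrite -(mpoly_unit_degree K _).2 //; apply/negP => /eqP RU; have sR : msize R == 1%N.
      by rewrite (mpolySpred mdeg R0) RU.
    case/msize_poly1P: sR => c c0 R_c; case/eqP: c0; apply: (incident_vanishing0 (iota := iota)).
    by rewrite -R_c.
  move: (vR); rewrite R_bc => /incident_vanishing_prime[vb|vc]; first by right; apply: small vb.
  by left; apply: (small c b) vc; rewrite mulrC.
exists R; split=> // D vD; apply: boolp.contrapT => nRD.
have nfR : ~ free_of (enum_rank c00) R.
  by move=> /(incident_vanishing_free vR) /eqP; rewrite (negPf R0).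
have [c [u [v [c0 fc c_uv]]]] := irred_elim iR nfR nRD.
case/eqP: c0; apply: incident_vanishing_free fc.
by rewrite c_uv; apply: incident_vanishingD.
Qed.

Lemma ceval_scale_block (R : comNzRingType) (f : {rmorphism K -> R}) A e (u : coeff_idx n d -> R) r :
  multihomog A e -> ceval f A (fun c => r ^+ d (tag c) * u c) =
    r ^+ (\sum_(i < s) d i * e i) * ceval f A u.
Proof.
move=> hA; rewrite /ceval /mmap mulr_sumr big_seq [RHS]big_seq; apply: eq_bigr => m mA.
rewrite [RHS]mulrCA; congr (_ * _); rewrite /mmap1 /=.
under eq_bigr do rewrite exprMn -exprM.
rewrite big_split /= prodrXr; congr (_ ^+ _ * _).
rewrite (partition_big (@var_block n s d) predT) //=. apply: eq_bigr => i _.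
rewrite -(hA m mA i) big_distrr /=; apply: eq_bigr => j /eqP ji.
by rewrite /var_block in ji; rewrite ji.
Qed.

(* Substituting for the coefficients of [F_i] those of [X_j^(d_i) f_i - f_i(X)
   X_j^(d_i)] kills [R]; modulo the [f_i] the result is [X_j^M R(lam)]. *)
Lemma resultant_param_system (R : PK) e lam : multihomog R e -> incident_vanishing iota R ->
  ceval iota R lam != 0 -> param_system (system lam).
Proof.
move=> hR vR Rl j; have iJ := gen_ideal (system lam) setT; have [J0 JD JM] := iJ.
set J := gen (system lam) setT in iJ J0 JD JM *.
have JX k : k \in last_vars -> J 'X_k.
  by move=> kl; rewrite -(system_last lam kl); apply: gen_mem; rewrite inE.
case: (boolP (j \in last_vars)) => [/JX Jj|jl]; first by exists 1%N; rewrite expr1.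
pose X' k : {mpoly L[n.+1]} := if k \in ~: last_vars then 'X_k else 0.
have X'j : X' j = 'X_j by rewrite /X' inE jl.
pose lamC c : {mpoly L[n.+1]} := (lam c)%:MP.
pose CK : {rmorphism K -> {mpoly L[n.+1]}} := @mpolyC n.+1 L \o iota.
have kill : ceval CK R (force_zero lamC j X') = 0.
  apply/eqP/negPn/negP => /mpoly_nonroot[y] /negP[].
  rewrite /ceval rmorph_mmap /=; pose y' k := if k \in ~: last_vars then y k else 0.
  have lamE : (fun c => (force_zero lamC j X' c).@[y]) =1 force_zero lam j y'.
    move=> c; rewrite (force_zero_rmorph (meval y)); apply: eq_force_zero => [a|k] /=.
      exact: mevalC.
    by rewrite /X' /y'; case: ifP; rewrite ?mevalXU ?meval0.
  have -> : mmap (meval y \o CK) (meval y \o (fun l => force_zero lamC j X' (enum_val l))) R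
      = ceval iota R (force_zero lam j y').
    by apply: eq_mmap => [a|l] /=; [exact: mevalC | rewrite -lamE].
  apply/eqP; have [[k yk]|ny] := boolp.EM (exists k, y' k != 0).
    apply: (vR _ y'); split=> [|i|l ll]; [by exists k | exact: geval_force_zero |].
    by rewrite /y' inE ll.
  (* The zero vector is no point of projective space, but there [force_zero] returns the zero
     system, the degrees being positive, and this system vanishes everywhere. *)
  have y0 k : y' k = 0 by apply/eqP/negPn/negP => yk; apply: ny; exists k.
  rewrite (eq_ceval _ _ (_ : _ =1 fun=> 0)) => [|c].
    apply: (vR _ (fun k => (k == ord0)%:R)); split=> [|i|k kl].
    - by exists ord0; rewrite eqxx oner_neq0.
    - by rewrite /geval big1 // => a _; rewrite mul0r.
    - case: eqP => [k0|_]; last exact: mulr0n.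
      by move: kl; rewrite k0 inE leqNgt s_gt0.
  rewrite /force_zero y0 expr0n gtn_eqF ?d_gt0 // mul0r sub0r.
  rewrite -gen_poly_meval (homog_meval0 (gen_poly_homog lam (tag c))) ?mulr0 ?oppr0 //.
exists (\sum_(i < s) d i * e i)%N.
have : J (ceval CK R (force_zero lamC j X') - ceval CK R (fun c => 'X_j ^+ d (tag c) * lamC c)).
  apply: mmap_congr_ideal => // l; rewrite /force_zero X'j addrAC subrr add0r.
  apply: idealN => //; apply: (JM); set i := tag _.
  have -> : geval lamC i X' = restr (~: last_vars) (gen_poly lam i).
    rewrite /restr /gen_poly (raddf_sum (mmap _ _)); apply: eq_bigr => a _ /=.
    by rewrite mmapZ mmapX.
  have Jf : J (gen_poly lam i).
    by rewrite -system_emb; apply: gen_mem; rewrite inE.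
  have Jr : J (gen_poly lam i - restr (~: last_vars) (gen_poly lam i)).
    by apply: restr_congr => // k; rewrite inE negbK; apply: JX.
  by have := idealB iJ Jf Jr; rewrite opprB addrC subrK.
rewrite kill sub0r => /(idealN iJ); rewrite opprK (ceval_scale_block _ _ _ hR).
have -> : ceval CK R lamC = (ceval iota R lam)%:MP by rewrite /ceval (rmorph_mmap (@mpolyC _ _)).
move=> /(JM (ceval iota R lam)^-1%:MP); rewrite mulrCA -mpolyCM mulVf //.
by rewrite mulr1.
Qed.

End Resultant.
End GenericForms.

Theorem theorem3p2 (K : fieldType) (L : closedFieldType)
    (iota : {rmorphism K -> L}) (halg : is_alg_closure iota)
    (n s : nat) (d : 'I_s -> nat)
    (hs : (0 < s)%N) (hsn : (s < n)%N)
    (hdec : forall i j : 'I_s, (i <= j)%N -> (d j <= d i)%N)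
    (hd1 : forall i : 'I_s, (1 <= d i)%N)
    (hd2 : forall i : 'I_s, val i = 0%N -> (2 <= d i)%N) :
  let delta := (\prod_(i < s) d i)%N in
  exists P : {mpoly K[ncoeffs n d]},
    [/\ P != 0,
        exists e : 'I_s -> nat, multihomog P e /\ forall i, (e i <= delta %/ d i)%N
      & forall lam : coeff_idx n d -> L,
          is_multiproj_point lam ->
          eval_coeffs iota P lam != 0 ->
          [/\ proj_dim_is (Zf (gen_poly lam)) (n - s),
              stci (gen_poly lam)
            & regular_seq (gen_poly lam)]].
Proof.
move=> delta.
have [R [R0 vR Rdiv]] := resultant_exists hs hsn hd1 iota (Ordinal hs).
have degR i : exists e, (e <= delta %/ d i)%N /\ forall m, m \in msupp R -> block_deg i m = e.
  (* For each block the determinant giving that block the lowest priority is used. *)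
  have [Q D_QR] := Rdiv _ (mac_det_vanishing hsn hd1 i iota).
  rewrite mulrC in D_QR.
  have [l le_l Rl] := block_scale_factor (mac_det_neq0 hsn hd1 i K) D_QR
    (@mac_det_block_scale n s d hsn K i i).
  exists l; split; last exact: block_scale_deg Rl.
  exact: leq_trans le_l (card_assigned hs hsn hd1 i).
have [e eP] := boolp.choice degR.
have hR : multihomog R e by move=> m mR i; exact: (eP i).2.
exists R; split=> //; first by exists e; split=> // i; case: (eP i).
move=> lam _; rewrite eval_coeffsE => Rl.
have psys := resultant_param_system hs hsn hd1 hR vR Rl.
have fsys : forms (@sdeg n s d) (system lam) by move=> k; apply: system_homog.
have sdeg0 := @sdeg_gt0 n s d hd1.
have hB j : j \in @last_vars n s -> system lam j = 'X_j by exact: system_last.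
have ZP x : Zf (gen_poly lam) x <->
    (exists j, x j != 0) /\ forall k, k \notin @last_vars n s -> (system lam k).@[x] = 0.
  split=> -[x0 fx]; split=> //.
    by move=> k /(notin_last hsn)[i ->]; rewrite system_emb; apply: fx; exists i.
  by move=> g [i ->]; rewrite -(system_emb hsn); apply/fx/emb_notin.
have cB := card_last_vars hs hsn.
split.
- exact: (dim_Z sdeg0 fsys psys hB cB ZP).
- exact: (pure_dim_Z sdeg0 fsys psys hB cB ZP).
have rsys := param_system_regular sdeg0 fsys psys.
pose A (i : 'I_s) := [set k : 'I_n.+1 | (k < i)%N].
have iA i : emb hsn i \notin A i by rewrite inE ltnn.
have idealE (i : 'I_s) g : in_ideal_lt (gen_poly lam) i g <-> gen (system lam) (A i) g.
  have sumE (w : 'I_n.+1 -> {mpoly L[n.+1]}) : \sum_(k in A i) w k * system lam k =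
      \sum_(j < s | (j < i)%N) w (emb hsn j) * gen_poly lam j.
    rewrite (reindex_omap (emb hsn) (@block_of n s)) => [|k]; last first.
      rewrite inE => ltk; have [|j ->] := notin_last hsn (k := k); last by rewrite block_of_emb.
      by rewrite inE -ltnNge (ltn_trans ltk).
    by apply: eq_big => [j|j _]; rewrite ?inE ?block_of_emb ?eqxx ?andbT ?system_emb.
  split=> [[w ->]|[w ->]]; last by exists (w \o emb hsn); rewrite sumE.
  exists (fun k => if block_of s k is Some j then w j else 0); rewrite sumE.
  by apply: eq_bigr => j _; rewrite block_of_emb.
have nz (i : 'I_s) g : in_ideal_lt (gen_poly lam) i (g * gen_poly lam i) -> in_ideal_lt (gen_poly lam) i g.
  by move=> /idealE; rewrite -(system_emb hsn) => /(rsys _ _ (iA i)) /idealE.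
(* Together with [nz] this excludes that [f_i] is zero or in the ideal of its predecessors:
   otherwise 1 would be in that ideal. *)
have not1 (i : 'I_s) : ~ in_ideal_lt (gen_poly lam) i 1.
  by move=> /idealE; apply: (gen_not1 (e := @sdeg n s d)) => j _ //; apply: fsys.
split=> [i i0|i]; last first.
  by split=> [fi|g]; [apply: (not1 i); apply: nz; rewrite mul1r | apply: nz].
apply/eqP => f0; apply: (not1 i); apply: nz; rewrite f0 mulr0.
by exists (fun=> 0); rewrite big1 // => j _; rewrite mul0r.
Qed.
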